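(* Let $A=K\otimes K$ be the tensor square of the four dimensional Sweedler Hopf algebra $K$ over a field $\Bbbk$ of characteristic $0$, with its bicovariant braided differential calculus described in the context, with left invariant vector fields $u,u'$ and dual left invariant one-forms $\omega,\omega'$. The Levi-Civita connection $\nabla:\mathfrak X(A)\to\Omega(A)\otimes_A\mathfrak X(A)$ (the unique torsion free, metric compatible left connection) of the arbitrary metric tensor $\mathsf g=(\omega\otimes_A\omega'+\omega'\otimes_A\omega)\,t$, with $t\in A$ invertible, is given by $$\nabla(u)=-\omega'\otimes_A\big(u\,\widetilde{u'(t)t^{-1}}+u'\,\widetilde{u(t)t^{-1}}\big),\qquad \nabla(u')=-\omega\otimes_A\big(u\,\widetilde{u'(t)t^{-1}}+u'\,\widetilde{u(t)t^{-1}}\big).$$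
   Context: Sweedler algebra. $K$ is generated by $x,g$ with $g^2=1$, $x^2=0$, $xg=-gx$; $\Delta(g)=g\otimes g$, $\Delta(x)=x\otimes g+1\otimes x$, $S(g)=g$, $S(x)=gx$. $U$ is a second copy of $K$ with generators $\gamma,\psi$ in place of $g,x$, dually paired with $K$ by the Hopf pairing with $\langle\gamma,1\rangle=1$, $\langle\gamma,g\rangle=-1$, $\langle1,g\rangle=1$, $\langle\psi,x\rangle=1$, other pairings among generators zero. $U$ has triangular structure $\mathscr R=\frac12(1\otimes1+\gamma\otimes1+1\otimes\gamma-\gamma\otimes\gamma)$. The algebra $A$. In $A=K\otimes K$ the two copies of $K$ commute, with generators $x,g$ (of $K\otimes1$) and $x',g'$ (of $1\otimes K$). $\mathcal U=U\otimes U$ is dual to $A$ and has the triangular structure $\mathfrak R$ given by the product of the two copies of $\mathscr R$. $H=\mathcal U^{op}\otimes\mathcal U$ ($\mathcal U^{op}$: opposite product) is triangular with $\mathcal R=(\mathrm{id}\otimes\mathrm{flip}\otimes\mathrm{id})(\mathfrak R^{-1}\otimes\mathfrak R)$, $\mathcal R^{-1}=\bar R^\alpha\otimes\bar R_\alpha$ (sum understood), and acts on $A$ by $(\zeta\otimes\xi)\triangleright a=\langle\zeta,a_{(1)}\rangle a_{(2)}\langle\xi,a_{(3)}\rangle$; $A$ is braided commutative: $ab=(\bar R^\alpha\triangleright b)(\bar R_\alpha\triangleright a)$. For $a=a(x,g,x',g')\in A$, $\tilde a:=a(-x,-g,-x',-g')$ (algebra involution). Calculus. $\mathfrak X(A)$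 is the $A$-bimodule of braided derivations: $\Bbbk$-linear $w:A\to A$ with $w(ab)=w(a)b+(\bar R^\alpha\triangleright a)(\bar R_\alpha\triangleright w)(b)$, where $(h\triangleright w)(a)=h_{(1)}\triangleright(w(S(h_{(2)})\triangleright a))$; $(aw)(b)=a\,w(b)$, $wa=(\bar R^\alpha\triangleright a)(\bar R_\alpha\triangleright w)$; bracket $[w,v]=w\circ v-(\bar R^\alpha\triangleright v)\circ(\bar R_\alpha\triangleright w)$. It is a free $A$-module with basis $u,u'$, where $u(a)=a_{(1)}\langle\chi,a_{(2)}\rangle$, $\chi=\gamma\psi\in U\otimes1$, and $u'$ likewise with $\chi'=\gamma'\psi'\in1\otimes U$; explicitly $u$ acts on the first factor by $u(1)=u(g)=0$, $u(x)=1$, $u(xg)=g$ (and is linear over the second factor), and similarly for $u'$ on the second. $\Omega(A)={}^*\mathfrak X(A)$ is the module of left $A$-linear maps $\mathfrak X(A)\to A$, with $\langle w,\theta\rangle=\theta(w)$, $(\theta a)(w)=\theta(w)a$, $(a\theta)(w)=\theta(wa)$, and $H$-action $(h\triangleright\theta)(w)=h_{(2)}\triangleright\theta(S^{-1}(h_{(1)})\triangleright w)$; $\omega,\omega'$ is the basis dual to $u,u'$; $\langle w,\mathrm da\rangle=w(a)$. The braiding is $\tau(v\otimes_Aw)=\bar R^\alpha\triangleright w\otimes_A\bar R_\alpha\triangleright v$. Levi-Civita connection. A left connection on $\mathfrak X(A)$ is a $\Bbbk$-linear $\nabla:\mathfrak X(A)\to\Omega(A)\otimes_A\mathfrak X(A)$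 with $\nabla(av)=\mathrm da\otimes_Av+a\nabla(v)$ (so it is determined by its values on $u,u'$). With $\nabla_wv:=\mathrm i_w(\nabla v)$, $\mathrm i_w(\theta\otimes_Av)=\langle w,\theta\rangle v$, it is torsion free if $\nabla_wv-\nabla_{\bar R^\alpha\triangleright v}(\bar R_\alpha\triangleright w)-[w,v]=0$ for all $w,v$. Its dual right connection ${}^*\nabla:\Omega(A)\to\Omega(A)\otimes_A\Omega(A)$ is defined by $\mathrm d\langle v,\theta\rangle=\langle\nabla v,\theta\rangle+\langle v,{}^*\nabla\theta\rangle$, where $\langle\eta\otimes_Av,\theta\rangle=\eta\langle v,\theta\rangle$, $\langle v,\theta\otimes_A\eta\rangle=\langle v,\theta\rangle\eta$, and lifted to $\Omega(A)\otimes_A\Omega(A)$ by ${}^*\nabla(\theta\otimes_A\eta)=\tau_{23}({}^*\nabla(\theta)\otimes_A\eta)+\bar R^\beta\triangleright\theta\otimes_A(\bar R_\beta\triangleright{}^*\nabla)(\eta)$ with $h\triangleright{}^*\nabla=h_{(1)}\triangleright\circ{}^*\nabla\circ S(h_{(2)})\triangleright$ and $\tau_{23}$ the braiding of the last two factors; $\nabla$ is metric compatible if ${}^*\nabla(\mathsf g)=0$. *)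

(* Defs.v *)
From HB Require Import structures.
From mathcomp Require Import all_boot all_order all_algebra all_field ring.
Set Implicit Arguments.
Unset Strict Implicit.
Unset Printing Implicit Defensive.
Import GRing.Theory.
Local Open Scope ring_scope.

(* Algebras with a finite basis e_i: mulb i j m is the coefficient of e_m in     *)
(* e_i e_j. An element is the function of its coordinates.                       *)
Record scalg (k : fieldType) := SCAlg {
  idx : finType;
  mulb : idx -> idx -> {ffun idx -> k^o};
  oneb : {ffun idx -> k^o};
  mulbA : forall i j l m,
    \sum_p mulb i j p * mulb p l m = \sum_p mulb j l p * mulb i p m;
  onebl : forall i m, \sum_p oneb p * mulb p i m = (m == i)%:R;
  onebr : forall i m, \sum_p oneb p * mulb i p m = (m == i)%:R;
  oneb_neq0 : oneb != 0 }.
Arguments mulb {k s}.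
Arguments oneb {k s}.

Definition scalg_sort (k : fieldType) (B : scalg k) : Type :=
  {ffun idx B -> k^o}.
Coercion scalg_sort : scalg >-> Sortclass.

Section ScalgAlgebra.
Variables (k : fieldType) (B : scalg k).

HB.instance Definition _ := Vector.copy (scalg_sort B) {ffun idx B -> k^o}.

Definition sc_mul (x y : B) : B :=
  [ffun m => \sum_i \sum_j x i * y j * mulb i j m].

Definition bas (i : idx B) : B := [ffun j => (j == i)%:R].

Fact sc_mulA : associative sc_mul.
Proof.
move=> x y z; apply/ffunP=> m; rewrite !ffunE.
transitivity (\sum_i \sum_j \sum_l x i * y j * z l *
                (\sum_p mulb j l p * mulb i p m)).
  apply: eq_bigr => i _.
  transitivity (\sum_p \sum_j \sum_l
      x i * y j * z l * (mulb j l p * mulb i p m)).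
    apply: eq_bigr => p _; rewrite ffunE mulr_sumr mulr_suml.
    apply: eq_bigr => j _; rewrite mulr_sumr mulr_suml.
    by apply: eq_bigr => l _; rewrite !mulrA.
  rewrite exchange_big; apply: eq_bigr => j _.
  by rewrite exchange_big; apply: eq_bigr => l _; rewrite mulr_sumr.
transitivity (\sum_p \sum_l \sum_i \sum_j
      x i * y j * z l * (mulb i j p * mulb p l m)).
  rewrite [RHS]exchange_big /=.
  under [RHS]eq_bigr => l _ do rewrite exchange_big /=.
  under [RHS]eq_bigr => l _ do under eq_bigr => i _ do rewrite exchange_big /=.
  rewrite [RHS]exchange_big /=; apply: eq_bigr => i _.
  rewrite [RHS]exchange_big /=; apply: eq_bigr => j _.
  by apply: eq_bigr => l _; rewrite -mulbA mulr_sumr.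
apply: eq_bigr => p _; apply: eq_bigr => l _.
rewrite ffunE !mulr_suml; apply: eq_bigr => i _; rewrite !mulr_suml.
apply: eq_bigr => j _; rewrite !mulrA; congr (_ * _).
by rewrite -!mulrA; congr (_ * (_ * _)); rewrite mulrC.
Qed.

Fact sc_mul1x : left_id (oneb : B) sc_mul.
Proof.
move=> x; apply/ffunP=> m; rewrite ffunE exchange_big /= (bigD1 m) //=.
under eq_bigr => i _ do rewrite mulrAC.
rewrite -mulr_suml onebl eqxx mul1r big1 ?addr0 // => j /negPf nj.
under eq_bigr => i _ do rewrite mulrAC.
by rewrite -mulr_suml onebl eq_sym nj mul0r.
Qed.

Fact sc_mulx1 : right_id (oneb : B) sc_mul.
Proof.
move=> x; apply/ffunP=> m; rewrite ffunE (bigD1 m) //=.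
under eq_bigr => i _ do rewrite -mulrA.
rewrite -mulr_sumr onebr eqxx mulr1 big1 ?addr0 // => j /negPf nj.
under eq_bigr => i _ do rewrite -mulrA.
by rewrite -mulr_sumr onebr eq_sym nj mulr0.
Qed.

Fact sc_mulDl : left_distributive sc_mul +%R.
Proof.
move=> x y z; apply/ffunP=> m; rewrite !ffunE -big_split; apply: eq_bigr => i _.
by rewrite -big_split; apply: eq_bigr => j _; rewrite ffunE !mulrDl.
Qed.

Fact sc_mulDr : right_distributive sc_mul +%R.
Proof.
move=> x y z; apply/ffunP=> m; rewrite !ffunE -big_split; apply: eq_bigr => i _.
by rewrite -big_split; apply: eq_bigr => j _; rewrite ffunE mulrDr mulrDl.
Qed.

HB.instance Definition _ := GRing.Zmodule_isNzRing.Build (scalg_sort B)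
  sc_mulA sc_mul1x sc_mulx1 sc_mulDl sc_mulDr (@oneb_neq0 k B).

Fact sc_scaleAl (c : k) (x y : B) : c *: (x * y) = (c *: x) * y.
Proof.
apply/ffunP=> m; rewrite !ffunE scaler_sumr; apply: eq_bigr => i _.
by rewrite scaler_sumr; apply: eq_bigr => j _; rewrite ffunE /GRing.scale /= !mulrA.
Qed.
HB.instance Definition _ :=
  GRing.Lmodule_isLalgebra.Build k (scalg_sort B) sc_scaleAl.

Fact sc_scaleAr (c : k) (x y : B) : c *: (x * y) = x * (c *: y).
Proof.
apply/ffunP=> m; rewrite !ffunE scaler_sumr; apply: eq_bigr => i _.
rewrite scaler_sumr; apply: eq_bigr => j _; rewrite ffunE /GRing.scale /=.
by rewrite !mulrA [c * _]mulrC.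
Qed.
HB.instance Definition _ :=
  GRing.Lalgebra_isAlgebra.Build k (scalg_sort B) sc_scaleAr.
HB.instance Definition _ := Algebra_isFalgebra.Build k (scalg_sort B).

End ScalgAlgebra.

Arguments bas {k B} i.

Section ScalgTensor.
Variables (k : fieldType) (B C : scalg k).

Let tmul (p q : idx B * idx C) : {ffun idx B * idx C -> k^o} :=
  [ffun r => mulb p.1 q.1 r.1 * mulb p.2 q.2 r.2].
Let tone : {ffun idx B * idx C -> k^o} := [ffun r => oneb r.1 * oneb r.2].

Fact tmulA i j l m :
  \sum_p tmul i j p * tmul p l m = \sum_p tmul j l p * tmul i p m.
Proof.
transitivity ((\sum_p mulb i.1 j.1 p * mulb p l.1 m.1) *
              (\sum_p mulb i.2 j.2 p * mulb p l.2 m.2)).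
  rewrite big_distrlr pair_bigA; apply: eq_bigr => p _ /=.
  by rewrite !ffunE /= mulrACA.
rewrite !mulbA big_distrlr pair_bigA; apply: eq_bigr => p _ /=.
by rewrite !ffunE /= mulrACA.
Qed.

Fact tonel i m : \sum_p tone p * tmul p i m = (m == i)%:R.
Proof.
transitivity ((\sum_p oneb p * mulb p i.1 m.1) *
              (\sum_p oneb p * mulb p i.2 m.2)).
  rewrite big_distrlr pair_bigA; apply: eq_bigr => p _ /=.
  by rewrite !ffunE /= mulrACA.
by rewrite !onebl -natrM mulnb -pair_eqE.
Qed.

Fact toner i m : \sum_p tone p * tmul i p m = (m == i)%:R.
Proof.
transitivity ((\sum_p oneb p * mulb i.1 p m.1) *
              (\sum_p oneb p * mulb i.2 p m.2)).
  rewrite big_distrlr pair_bigA; apply: eq_bigr => p _ /=.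
  by rewrite !ffunE /= mulrACA.
by rewrite !onebr -natrM mulnb -pair_eqE.
Qed.

Fact tone_neq0 : tone != 0.
Proof.
have nz (D : scalg k) : exists i : idx D, oneb i != 0 :> k.
  apply/existsP; have := oneb_neq0 D; apply: contraNT.
  rewrite negb_exists => /forallP z; apply/eqP/ffunP=> i.
  by rewrite ffunE; apply/eqP; have := z i; rewrite negbK.
have [[i ni] [j nj]] := (nz B, nz C).
apply/eqP => /ffunP/(_ (i, j))/eqP; rewrite !ffunE /=.
by rewrite mulf_eq0 (negPf ni) (negPf nj).
Qed.

Definition tens : scalg k := SCAlg tmulA tonel toner tone_neq0.

Definition pure (b : B) (c : C) : tens := [ffun p => b p.1 * c p.2].

Definition sweed (V : lmodType k) (z : tens) (f : B -> C -> V) : V :=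
  \sum_p z p *: f (bas p.1) (bas p.2).

End ScalgTensor.

Notation "b ⊗ c" := (pure b c) (at level 40, left associativity).

(* For z = \sum z_(1) ⊗ z_(2) and f bilinear, \sum f z_(1) z_(2). *)
Notation "\sw_ ( a , b <- z ) E" := (sweed z (fun a b => E))
  (at level 41, a name, b name, z at level 200, E at level 41).

Section ScalgOp.
Variables (k : fieldType) (B : scalg k).

Fact opA (i j l m : idx B) :
  \sum_p mulb j i p * mulb l p m = \sum_p mulb l j p * mulb p i m.
Proof. by rewrite mulbA. Qed.

Definition opalg : scalg k :=
  @SCAlg k (idx B) (fun i j => mulb j i) oneb opA (@onebr k B) (@onebl k B)
    (oneb_neq0 B).

End ScalgOp.

(* id ⊗ flip ⊗ id. *)
Definition midflip (k : fieldType) (B C D E : scalg k)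
    (z : tens (tens B C) (tens D E)) : tens (tens B D) (tens C E) :=
  [ffun p => z ((p.1.1, p.2.1), (p.1.2, p.2.2))].

(* The counit is not recorded: no construction below uses it. *)
Record hopf (k : fieldType) := Hopf {
  halg :> scalg k;
  comul : halg -> tens halg halg;
  antip : 'End(halg) }.
Arguments comul {k h} z.
Arguments antip {k} h.

Definition tensH (k : fieldType) (B C : hopf k) : hopf k := {|
  halg := tens B C;
  comul := fun z => \sw_(b, c <- z) midflip (comul b ⊗ comul c);
  antip := linfun (fun z : tens B C =>
    \sw_(b, c <- z) (antip B b ⊗ antip C c)) |}.

Definition opH (k : fieldType) (B : hopf k) : hopf k := {|
  halg := opalg B;
  comul := @comul k B;
  antip := (antip B)^-1%VF |}.

Section Linearity.
Variable k : fieldType.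

Lemma subDD (V : zmodType) (a b c d : V) : (a + b) - (c + d) = (a - c) + (b - d).
Proof. by rewrite opprD addrACA. Qed.

Lemma sub3D (V : zmodType) (a b c d e f : V) :
  (a + b) - (c + d) - (e + f) = (a - c - e) + (b - d - f).
Proof. by rewrite (subDD a) subDD. Qed.

Lemma linfunE (V W : vectType k) (f : V -> W) : linear f -> linfun f =1 f.
Proof.
move=> lf v; pose F : {linear V -> W} := HB.pack f (GRing.isLinear.Build _ _ _ _ f lf).
exact: (lfunE F).
Qed.

Lemma bas_sum (B : scalg k) (x : B) : x = \sum_i x i *: bas i.
Proof.
apply/ffunP=> j; rewrite sum_ffunE (bigD1 j) //= !ffunE eqxx.
rewrite big1 ?addr0 => [|i /negPf ni]; first by rewrite /GRing.scale /= mulr1.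
by rewrite !ffunE eq_sym ni scaler0.
Qed.

Lemma linear_bas (B : scalg k) (V : lmodType k) (f : B -> V) x :
  linear f -> f x = \sum_i x i *: f (bas i).
Proof.
move=> lf; pose F : {linear B -> V} :=
  HB.pack f (GRing.isLinear.Build _ _ _ _ f lf).
rewrite -[f x]/(F x) {1}[x]bas_sum linear_sum.
by apply: eq_bigr => i _; rewrite linearZ.
Qed.

Lemma sweed_linear (B C : scalg k) (V : lmodType k) (f : B -> C -> V) :
  linear (fun z => sweed z f).
Proof.
move=> c z z'; rewrite scaler_sumr -big_split; apply: eq_bigr => p _.
by rewrite !ffunE scalerDl scalerA.
Qed.

Lemma sweed_linear_fun (B C : scalg k) (W V : lmodType k)
    (f : W -> B -> C -> V) (z : tens B C) :
  (forall b c, linear (fun w => f w b c)) -> linear (fun w => sweed z (f w)).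
Proof.
move=> lf c w w'; rewrite scaler_sumr -big_split; apply: eq_bigr => p _.
by rewrite lf scalerDr !scalerA mulrC.
Qed.

Lemma sweed_pure (B C : scalg k) (V : lmodType k) (f : B -> C -> V) b c :
  (forall b', linear (f b')) -> (forall c', linear (f^~ c')) ->
  sweed (b ⊗ c) f = f b c.
Proof.
move=> lf fl.
transitivity (\sum_i \sum_j (b i * c j) *: f (bas i) (bas j)).
  by rewrite pair_bigA; apply: eq_bigr => p _; rewrite ffunE.
pose L c' : {linear B -> V} :=
  HB.pack (f^~ c') (GRing.isLinear.Build _ _ _ _ _ (fl c')).
pose R b' : {linear C -> V} :=
  HB.pack (f b') (GRing.isLinear.Build _ _ _ _ _ (lf b')).
rewrite -[f b c]/(L c b) {2}[b]bas_sum linear_sum; apply: eq_bigr => i _.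
rewrite linearZ /= -[f _ c]/(R (bas i) c) {2}[c]bas_sum linear_sum scaler_sumr.
by apply: eq_bigr => j _; rewrite linearZ /= scalerA.
Qed.

Lemma pure_linear_l (B C : scalg k) (c : C) : linear (fun b : B => b ⊗ c).
Proof.
by move=> x b b'; apply/ffunP=> p; rewrite !ffunE mulrDl -scalerAl.
Qed.

Lemma pure_linear_r (B C : scalg k) (b : B) : linear (fun c : C => b ⊗ c).
Proof.
by move=> x c c'; apply/ffunP=> p; rewrite !ffunE mulrDr -scalerAr.
Qed.

Lemma pureM (B C : scalg k) (b b' : B) (c c' : C) :
  (b ⊗ c) * (b' ⊗ c') = (b * b') ⊗ (c * c').
Proof.
apply/ffunP=> m; rewrite !ffunE big_distrlr /= [RHS]pair_bigA /=.
apply: eq_bigr => p _; rewrite big_distrlr /= pair_bigA /=.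
apply: eq_bigr => q _; rewrite !ffunE [RHS]mulrACA; congr (_ * _).
by rewrite [LHS]mulrACA.
Qed.

Lemma memv_bigcapP (V : vectType k) (I : finType) (Us : I -> {vspace V}) v :
  reflect (forall i, v \in Us i) (v \in (\bigcap_i Us i)%VS).
Proof.
by rewrite memvE; apply: (iffP subv_bigcapP) => Uv i => [|_]; have := Uv i;
  rewrite memvE // => /(_ isT).
Qed.

End Linearity.

Section Sweedler.
Variable k : fieldType.

(* The basis vector of index (a, b) is x^a g^b. *)
Let smul (p q : bool * bool) : {ffun bool * bool -> k^o} :=
  [ffun r => if p.1 && q.1 then 0 else
     (-1) ^+ (p.2 && q.1) * (r == (p.1 || q.1, p.2 (+) q.2))%:R].
Let sone : {ffun bool * bool -> k^o} := [ffun r => (r == (false, false))%:R].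

Let sum_smul i j (F : bool * bool -> k) :
  \sum_p smul i j p * F p = if i.1 && j.1 then 0 else
    (-1) ^+ (i.2 && j.1) * F (i.1 || j.1, i.2 (+) j.2).
Proof.
case E: (i.1 && j.1); first by rewrite big1 // => p _; rewrite ffunE E mul0r.
rewrite (bigD1 (i.1 || j.1, i.2 (+) j.2)) //= ffunE E eqxx mulr1.
by rewrite big1 ?addr0 // => p /negPf np; rewrite ffunE E np mulr0 mul0r.
Qed.

Fact smulA i j l m :
  \sum_p smul i j p * smul p l m = \sum_p smul j l p * smul i p m.
Proof.
rewrite !sum_smul !ffunE; case: i j l => [[] []] [[] []] [[] []] /=;
  by rewrite ?(mulr0, mulr1, mul1r, expr0, expr1, mulrA, mulrNN).
Qed.

Let sum_sone (F : bool * bool -> k) :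
  \sum_p sone p * F p = F (false, false).
Proof.
rewrite (bigD1 (false, false)) //= ffunE eqxx mul1r.
by rewrite big1 ?addr0 // => p /negPf np; rewrite ffunE np mul0r.
Qed.

Fact sonel i m : \sum_p sone p * smul p i m = (m == i)%:R.
Proof. by rewrite sum_sone ffunE /= mul1r; case: i. Qed.

Fact soner i m : \sum_p sone p * smul i p m = (m == i)%:R.
Proof.
by rewrite sum_sone ffunE /= !andbF mul1r orbF addbF; case: i.
Qed.

Fact sone_neq0 : sone != 0.
Proof.
by apply/eqP => /ffunP/(_ (false, false))/eqP; rewrite !ffunE oner_eq0.
Qed.

Definition Kalg : scalg k := SCAlg smulA sonel soner sone_neq0.

Definition xK : Kalg := bas ((true, false) : idx Kalg).
Definition gK : Kalg := bas ((false, true) : idx Kalg).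

Definition K : hopf k := {|
  halg := Kalg;
  comul := fun z => \sum_(p : idx Kalg)
    z p *: ((xK ⊗ gK + 1 ⊗ xK) ^+ p.1 * (gK ⊗ gK) ^+ p.2);
  antip := linfun (fun z : Kalg => \sum_(p : idx Kalg)
    z p *: (gK ^+ p.2 * (gK * xK) ^+ p.1)) |}.

Let bas_mul (p q : idx Kalg) : (bas p * bas q : Kalg) = smul p q.
Proof.
apply/ffunP=> m; rewrite [LHS]ffunE (bigD1 p) //= (bigD1 q) //= !ffunE !eqxx !mul1r.
rewrite !big1 ?addr0 // => [i /negPf ni | j /negPf nj].
  by rewrite big1 // => j _; rewrite ffunE ni !mul0r.
by rewrite ffunE nj mulr0 mul0r.
Qed.

Fact basM (p q : idx Kalg) : (bas p * bas q : Kalg) =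
  if p.1 && q.1 then 0 else
    (-1) ^+ (p.2 && q.1) *: bas ((p.1 || q.1, p.2 (+) q.2) : idx Kalg).
Proof.
by rewrite bas_mul; apply/ffunP=> m; rewrite ffunE; case: ifP; rewrite !ffunE.
Qed.

Fact basK (a b : bool) : bas ((a, b) : idx Kalg) = xK ^+ a * gK ^+ b.
Proof.
case: a b => [] [] /=; rewrite ?expr1 ?expr0 ?mulr1 ?mul1r //.
by rewrite bas_mul; apply/ffunP=> m; rewrite !ffunE /= mul1r.
Qed.

Fact gK2 : gK * gK = 1.
Proof. by rewrite bas_mul; apply/ffunP=> m; rewrite !ffunE /= mul1r. Qed.

Fact xK2 : xK * xK = 0.
Proof. by rewrite bas_mul; apply/ffunP=> m; rewrite !ffunE. Qed.

Fact xgK : xK * gK = - (gK * xK).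
Proof.
by rewrite !bas_mul; apply/ffunP=> m; rewrite !ffunE /= mul1r mulN1r opprK.
Qed.

Fact comulK_bas (a b : bool) :
  comul (bas ((a, b) : idx Kalg) : K) =
  if a then bas ((true, b) : idx Kalg) ⊗ bas ((false, ~~ b) : idx Kalg)
            + bas ((false, b) : idx Kalg) ⊗ bas ((true, b) : idx Kalg)
  else bas ((false, b) : idx Kalg) ⊗ bas ((false, b) : idx Kalg).
Proof.
rewrite /= (bigD1 (a, b)) //= ffunE eqxx scale1r big1 ?addr0; last first.
  by move=> p /negPf np; rewrite ffunE np scale0r.
have e1 : bas ((false, false) : idx Kalg) = 1 :> Kalg by rewrite basK !expr0 mul1r.
case: a b => [] []; rewrite ?expr1 ?expr0 ?mul1r ?mulr1 ?e1 ?mulrDl ?pureM //.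
by rewrite gK2 mul1r (basK true true).
Qed.

(* <psi^a gamma^b, x^c g^d>: zero unless a = c; <gamma^b, g^d> = (-1)^(b d) and  *)
(* <psi gamma^b, x g^d> = (-1)^(d + b (d + 1)) by the coproducts of psi and x.   *)
(* The facts pairK_mull, pairK_mulr and pairK_gen characterize the Hopf pairing. *)
Definition pairb (p q : bool * bool) : k :=
  if p.1 == q.1 then (-1) ^+ ((p.2 && q.2) + (p.1 && (p.2 (+) q.2))) else 0.

Definition pairK (z y : K) : k := \sum_p \sum_q z p * y q * pairb p q.

Lemma pairK_linear_l y : linear (fun z => pairK z y : k^o).
Proof.
move=> c z z'; rewrite scaler_sumr -big_split; apply: eq_bigr => p _.
rewrite scaler_sumr -big_split; apply: eq_bigr => q _ /=.
by rewrite !ffunE !mulrDl /GRing.scale /= !mulrA.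
Qed.

Lemma pairK_linear_r z : linear (fun y => pairK z y : k^o).
Proof.
move=> c y y'; rewrite scaler_sumr -big_split; apply: eq_bigr => p _.
rewrite scaler_sumr -big_split; apply: eq_bigr => q _ /=.
by rewrite !ffunE mulrDr !mulrDl /GRing.scale /= !mulrA [c * z p]mulrC.
Qed.

Lemma pairK_bas p q : pairK (bas p) (bas q) = pairb p q.
Proof.
rewrite /pairK (bigD1 p) //= (bigD1 q) //= !ffunE !eqxx !mul1r.
rewrite !big1 ?addr0 // => [i /negPf ni | j /negPf nj].
  by rewrite big1 // => j _; rewrite ffunE ni !mul0r.
by rewrite [bas q j]ffunE nj mulr0 mul0r.
Qed.

Lemma comulK_linear : linear (@comul k K).
Proof.
move=> c z z'; rewrite /= scaler_sumr -big_split; apply: eq_bigr => p _.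
by rewrite !ffunE scalerDl scalerA.
Qed.

Let linear_bas3 (V : lmodType k) (f : K -> K -> K -> V) :
    (forall y z, linear (fun x => f x y z)) ->
    (forall x z, linear (fun y => f x y z)) ->
    (forall x y, linear (f x y)) ->
    (forall p q r, f (bas p) (bas q) (bas r) = 0) ->
  forall x y z, f x y z = 0.
Proof.
move=> l1 l2 l3 f0 x y z.
rewrite (linear_bas _ (l1 y z)) big1 // => p _.
rewrite (linear_bas _ (l2 _ z)) big1 ?scaler0 // => q _.
rewrite (linear_bas _ (l3 _ _)) big1 ?scaler0 // => r _.
by rewrite f0 scaler0.
Qed.

Fact pairK_mull (z w y : K) : pairK (z * w) y =
  \sw_(y1, y2 <- comul y) (pairK z y1 * pairK w y2 : k^o).
Proof.
apply/eqP; rewrite -subr_eq0; apply/eqP; move: z w y.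
apply: (linear_bas3 (V := k^o) (f := fun z w y => pairK (z * w) y -
  \sw_(y1, y2 <- comul y) (pairK z y1 * pairK w y2 : k^o))).
- move=> w y c z z'; rewrite mulrDl -scalerAl pairK_linear_l.
  rewrite (@sweed_linear_fun _ _ _ _ _ (fun z y1 y2 => pairK z y1 * pairK w y2 : k^o)).
    by rewrite subDD scalerBr.
  by move=> y1 y2 d u u'; rewrite pairK_linear_l mulrDl /GRing.scale /= mulrA.
- move=> z y c w w'; rewrite mulrDr -scalerAr pairK_linear_l.
  rewrite (@sweed_linear_fun _ _ _ _ _ (fun w y1 y2 => pairK z y1 * pairK w y2 : k^o)).
    by rewrite subDD scalerBr.
  by move=> y1 y2 d u u'; rewrite pairK_linear_l mulrDr /GRing.scale /= mulrCA.
- move=> z w c y y'; rewrite pairK_linear_r comulK_linear sweed_linear.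
  by rewrite subDD scalerBr.
move=> p q r; apply/eqP; rewrite subr_eq0; apply/eqP.
have bl (b c : K) : sweed (b ⊗ c)
    (fun y1 y2 => pairK (bas p) y1 * pairK (bas q) y2 : k^o) = pairK (bas p) b * pairK (bas q) c.
  apply: sweed_pure => [b' d u u' | c' d u u'] /=.
    by rewrite pairK_linear_r mulrDr /GRing.scale /= mulrCA.
  by rewrite pairK_linear_r mulrDl /GRing.scale /= mulrA.
case: r => a b; rewrite comulK_bas.
pose S y := sweed y (fun y1 y2 => pairK (bas p) y1 * pairK (bas q) y2 : k^o).
have SD y y' : S (y + y') = S y + S y'.
  by rewrite -[y]scale1r /S sweed_linear !scale1r.
have PZ (c : k) (p' q' : idx Kalg) : pairK (c *: bas p') (bas q') = c * pairb p' q'.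
  pose L : {linear K -> k^o} := HB.pack (fun z : K => pairK z (bas q') : k^o)
    (GRing.isLinear.Build _ _ _ _ _ (pairK_linear_l (bas q'))).
  by rewrite -[pairK _ _]/(L _) linearZ /= pairK_bas.
have P0 q' : pairK 0 (bas q') = 0 by rewrite -(scale0r (bas q')) PZ mul0r.
rewrite basM -/(S _).
case: p q a b @S bl SD => [[] []] [[] []] [] [] S bl SD /=;
  rewrite ?SD /S ?bl ?P0 ?PZ !pairK_bas /pairb /=; ring.
Qed.

Lemma pairK_sym z y : pairK z y = pairK y z.
Proof.
rewrite /pairK exchange_big; apply: eq_bigr => p _; apply: eq_bigr => q _.
rewrite [y p * _]mulrC /pairb eq_sym [p.2 && _]andbC [p.2 (+) _]addbC.
by case: eqP => // ->.
Qed.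

Fact pairK_mulr (z y y' : K) : pairK z (y * y') =
  \sw_(z1, z2 <- comul z) (pairK z1 y * pairK z2 y' : k^o).
Proof.
rewrite pairK_sym pairK_mull; apply: eq_bigr => p _.
by rewrite ![pairK _ (bas _)]pairK_sym.
Qed.

Fact pairK_gen :
  [/\ pairK gK 1 = 1, pairK gK gK = -1, pairK 1 gK = 1 & pairK xK xK = 1] /\
  [/\ pairK gK xK = 0, pairK xK gK = 0, pairK xK 1 = 0 & pairK 1 xK = 0].
Proof.
have e1 : 1 = bas ((false, false) : idx Kalg) :> Kalg.
  by rewrite basK !expr0 mul1r.
by rewrite !e1 !pairK_bas /pairb /= ?expr0 ?expr1.
Qed.

End Sweedler.
Arguments xK {k}.
Arguments gK {k}.

Section Calculus.
Variable k : fieldType.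

Definition U : hopf k := K k.
Definition gam : U := gK.
Definition psi : U := xK.
Definition RU : tens U U :=
  2^-1 *: (1 ⊗ 1 + gam ⊗ 1 + 1 ⊗ gam - gam ⊗ gam).

Definition A : hopf k := tensH (K k) (K k).
Definition UU : hopf k := tensH U U.
Definition RUU : tens UU UU := midflip (RU ⊗ RU).
Definition RUUinv : tens UU UU := RUU^-1.

Definition H : hopf k := tensH (opH UU) UU.
Definition RH : tens H H :=
  midflip ((RUUinv : tens (opH UU) (opH UU)) ⊗ RUU).
Definition Rbar : tens H H := RH^-1.

Definition pairA (z : UU) (y : A) : k :=
  \sw_(z1, z2 <- z) \sw_(y1, y2 <- y) (pairK z1 y1 * pairK z2 y2 : k^o).

Definition act (h : H) (a : A) : A :=
  \sw_(z, xi <- h) \sw_(a1, a' <- comul a) \sw_(a2, a3 <- comul a')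
    ((pairA z a1 * pairA xi a3) *: a2).

Definition hactE (h : H) (w : 'End(A)) : 'End(A) :=
  \sw_(h1, h2 <- comul h)
    (linfun (act h1) \o w \o linfun (act (antip H h2)))%VF.

Definition braided_derivation (w : 'End(A)) : Prop := forall a b : A,
  w (a * b) = w a * b + \sw_(r, s <- Rbar) (act r a * hactE s w b).

(* vfieldsP below identifies this space with that of the braided derivations. *)
Definition leibniz_defect (a b : A) (w : 'End(A)) : A :=
  w (a * b) - w a * b - \sw_(r, s <- Rbar) (act r a * hactE s w b).

Definition vfields : {vspace 'End(A)} :=
  (\bigcap_i \bigcap_j lker (linfun (leibniz_defect (bas i) (bas j))))%VS.

Lemma act_linear h : linear (act h).
Proof.
apply: sweed_linear_fun => z xi c a a'.
by rewrite -sweed_linear; congr (sweed _ _); apply: sweed_linear.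
Qed.

Lemma hactE_linear h : linear (hactE h).
Proof.
apply: sweed_linear_fun => h1 h2 c w w'.
by rewrite comp_lfunDr comp_lfunDl -comp_lfunZr -comp_lfunZl.
Qed.

Lemma leibniz_linear_fun a b : linear (leibniz_defect a b).
Proof.
have lS : linear (fun w => \sw_(r, s <- Rbar) (act r a * hactE s w b)).
  apply: sweed_linear_fun => r s c w w'.
  by rewrite hactE_linear add_lfunE scale_lfunE mulrDr -scalerAr.
move=> c w w'; rewrite /leibniz_defect lS !add_lfunE !scale_lfunE mulrDl.
by rewrite -scalerAl sub3D -!scalerBr.
Qed.

Lemma leibniz_linear_l b w : linear (fun a => leibniz_defect a b w).
Proof.
have lS : linear (fun a => \sw_(r, s <- Rbar) (act r a * hactE s w b)).
  apply: sweed_linear_fun => r s c a a'.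
  by rewrite act_linear mulrDl -scalerAl.
move=> c a a'; rewrite /leibniz_defect lS mulrDl -scalerAl !(linearP w).
by rewrite mulrDl -scalerAl sub3D -!scalerBr.
Qed.

Lemma leibniz_linear_r a w : linear (fun b => leibniz_defect a b w).
Proof.
have lS : linear (fun b => \sw_(r, s <- Rbar) (act r a * hactE s w b)).
  apply: sweed_linear_fun => r s c b b'.
  by rewrite linearP mulrDr -scalerAr.
move=> c b b'; rewrite /leibniz_defect lS !mulrDr -!scalerAr (linearP w).
by rewrite sub3D -!scalerBr.
Qed.

Lemma vfieldsP w : reflect (braided_derivation w) (w \in vfields).
Proof.
apply: (iffP idP) => [Xw a b | dw].
  apply/eqP; rewrite -subr_eq0 opprD addrA; apply/eqP.
  rewrite -/(leibniz_defect a b w) (linear_bas _ (leibniz_linear_l b w)) big1 // => i _.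
  rewrite (linear_bas _ (leibniz_linear_r (bas i) w)) big1 ?scaler0 // => j _.
  have /memv_bigcapP/(_ i)/memv_bigcapP/(_ j) := Xw.
  rewrite memv_ker linfunE => [/eqP -> |]; first by rewrite scaler0.
  exact: leibniz_linear_fun.
apply/memv_bigcapP => i; apply/memv_bigcapP => j.
rewrite memv_ker linfunE; last exact: leibniz_linear_fun.
by rewrite /leibniz_defect dw -addrA -opprD subrr.
Qed.

Definition vf : vectType k := subvs_of vfields.

(* The space of braided derivations is stable under the bimodule operations and  *)
(* the H-action, so the projection vsproj only changes the type here.            *)
Definition mkvf (w : 'End(A)) : vf := vsproj vfields w.
Definition vapp (w : vf) (a : A) : A := vsval w a.

Definition vf_lmul (a : A) (w : vf) : vf := mkvf (amull a \o vsval w)%VF.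
Definition vf_act (h : H) (w : vf) : vf := mkvf (hactE h (vsval w)).
Definition vf_rmul (w : vf) (a : A) : vf :=
  \sw_(r, s <- Rbar) vf_lmul (act r a) (vf_act s w).

Definition bracket (w v : vf) : 'End(A) :=
  (vsval w \o vsval v)%VF -
  \sw_(r, s <- Rbar) (vsval (vf_act r v) \o vsval (vf_act s w))%VF.

(* By formsP below, these are the left A-linear maps. *)
Definition lin_defect (a : A) (w : vf) (th : 'Hom(vf, A)) : A :=
  th (vf_lmul a w) - a * th w.

Definition forms : {vspace 'Hom(vf, A)} :=
  (\bigcap_i \bigcap_(j < \dim {:vf})
     lker (linfun (lin_defect (bas i) (vbasis {:vf})`_j)))%VS.

Lemma vf_lmul_linear_l w : linear (fun a => vf_lmul a w).
Proof.
move=> c a a'; rewrite /vf_lmul /mkvf -linearP; congr (vsproj _ _).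
by rewrite linearP comp_lfunDl comp_lfunZl.
Qed.

Lemma vf_lmul_linear_r a : linear (vf_lmul a).
Proof.
move=> c w w'; rewrite /vf_lmul /mkvf -linearP; congr (vsproj _ _).
by rewrite linearP comp_lfunDr comp_lfunZr.
Qed.

Lemma formsP (th : 'Hom(vf, A)) :
  reflect (forall a w, th (vf_lmul a w) = a * th w) (th \in forms).
Proof.
have ll w : linear (fun a => lin_defect a w th).
  move=> c a a'; rewrite /lin_defect vf_lmul_linear_l (linearP th) mulrDl.
  by rewrite -scalerAl subDD scalerBr.
have lr a : linear (fun w => lin_defect a w th).
  move=> c w w'; rewrite /lin_defect vf_lmul_linear_r !(linearP th) mulrDr.
  by rewrite -scalerAr subDD scalerBr.
have lf a w : linear (lin_defect a w).
  move=> c f f'; rewrite /lin_defect !add_lfunE !scale_lfunE mulrDr.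
  by rewrite -scalerAr subDD scalerBr.
apply: (iffP idP) => [Fth a w | thP].
  apply/eqP; rewrite -subr_eq0; apply/eqP.
  rewrite -/(lin_defect a w th) (linear_bas _ (ll w)) big1 // => i _.
  rewrite (coord_vbasis (memvf w)).
  pose L : {linear vf -> A} := HB.pack (fun w => lin_defect (bas i) w th)
    (GRing.isLinear.Build _ _ _ _ _ (lr (bas i))).
  rewrite -[lin_defect _ _ _]/(L _) linear_sum big1 ?scaler0 // => j _.
  have /memv_bigcapP/(_ i)/memv_bigcapP/(_ j) := Fth.
  by rewrite memv_ker linfunE // linearZ /= => /eqP ->; rewrite scaler0.
apply/memv_bigcapP => i; apply/memv_bigcapP => j.
by rewrite memv_ker linfunE // /lin_defect thP subrr.
Qed.

Definition omf : vectType k := subvs_of forms.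
(* As for mkvf, f is left A-linear in every use below. *)
Definition mkom (f : vf -> A) : omf := vsproj forms (linfun f).
Definition ev (w : vf) (th : omf) : A := vsval th w.

Definition om_lmul (a : A) (th : omf) : omf :=
  mkom (fun w => ev (vf_rmul w a) th).
Definition om_rmul (th : omf) (a : A) : omf := mkom (fun w => ev w th * a).
Definition om_act (h : H) (th : omf) : omf := mkom (fun w =>
  \sw_(h1, h2 <- comul h) act h2 (ev (vf_act ((antip H)^-1%VF h1) w) th)).

Definition d (a : A) : omf := mkom (fun w => vapp w a).

(* The operations of an A-bimodule with an H-action; the laws hold for X, Om and *)
(* their tensor products over A, but are not part of the structure.              *)
Record bimod := Bimod {
  carrier :> vectType k;
  lmul : A -> carrier -> carrier;
  rmul : carrier -> A -> carrier;
  hact : H -> carrier -> carrier }.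

Section TensorA.
Variables M N : bimod.

Definition kpure (m : M) (n : N) : 'M[k]_(\dim {:M}, \dim {:N}) :=
  \matrix_(i, j) (coord (vbasis {:M}) i m * coord (vbasis {:N}) j n).

(* Spanned by all (m a) ⊗ n - m ⊗ (a n); basis vectors suffice by linearity. *)
Definition balancing : {vspace 'M[k]_(\dim {:M}, \dim {:N})} :=
  (\sum_(i < \dim {:M}) \sum_(p : idx A) \sum_(j < \dim {:N})
     let m := (vbasis {:M})`_i in let n := (vbasis {:N})`_j in
     <[kpure (rmul m (bas p)) n - kpure m (lmul (bas p) n)]>)%VS.

(* The quotient by balancing, realized on a complement; apure is m ⊗_A n. *)
Definition atens_sp : vectType k := subvs_of (balancing^C)%VS.

Definition apure (m : M) (n : N) : atens_sp :=
  vsproj (balancing^C) (daddv_pi (balancing^C) balancing (kpure m n)).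

(* alift f is the map m ⊗_A n |-> f m n on the tensor product over A, for every  *)
(* bilinear and A-balanced f (see alift_pure and apure_balanced).                *)
Definition kext (V : lmodType k) (f : M -> N -> V)
    (z : 'M[k]_(\dim {:M}, \dim {:N})) : V :=
  \sum_i \sum_j z i j *: f (vbasis {:M})`_i (vbasis {:N})`_j.

Definition alift (V : lmodType k) (f : M -> N -> V) (z : atens_sp) : V :=
  kext f (vsval z).

Lemma kext_linear (V : lmodType k) (f : M -> N -> V) :
  linear (kext f).
Proof.
move=> c z z'; rewrite scaler_sumr -big_split; apply: eq_bigr => i _.
rewrite scaler_sumr -big_split; apply: eq_bigr => j _.
by rewrite !mxE scalerDl scalerA.
Qed.

Lemma linear_vbasis (W : vectType k) (V : lmodType k) (f : W -> V) w :
  linear f -> f w = \sum_(i < \dim {:W}) coord (vbasis {:W}) i w *: f (vbasis {:W})`_i.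
Proof.
move=> lf; pose F : {linear W -> V} :=
  HB.pack f (GRing.isLinear.Build _ _ _ _ f lf).
rewrite {1}(coord_vbasis (memvf w)) -[LHS]/(F _) linear_sum.
by apply: eq_bigr => i _; rewrite linearZ.
Qed.

Lemma kext_pure (V : lmodType k) (f : M -> N -> V) m n :
  (forall m', linear (f m')) -> (forall n', linear (f^~ n')) ->
  kext f (kpure m n) = f m n.
Proof.
move=> lf fl; rewrite (linear_vbasis _ (fl n)); apply: eq_bigr => i _.
rewrite (linear_vbasis _ (lf _)) scaler_sumr.
by apply: eq_bigr => j _; rewrite mxE scalerA.
Qed.

Lemma kpure_linear_l n : linear (kpure^~ n).
Proof. by move=> c m m'; apply/matrixP=> i j; rewrite !mxE linearP mulrDl mulrA. Qed.

Lemma kpure_linear_r m : linear (kpure m).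
Proof.
move=> c n n'; apply/matrixP=> i j; rewrite !mxE linearP mulrDr.
by congr (_ + _); rewrite /= mulrCA.
Qed.

Lemma alift_pure (V : vectType k) (f : M -> N -> V) m n :
  (forall m', linear (f m')) -> (forall n', linear (f^~ n')) ->
  (forall m' a n', f (rmul m' a) n' = f m' (lmul a n')) ->
  alift f (apure m n) = f m n.
Proof.
move=> lf fl fb; rewrite -(kext_pure m n lf fl) /alift /apure.
pose F := linfun (kext f).
have FE z : kext f z = F z by rewrite linfunE //; apply: kext_linear.
have kF : (balancing <= lker F)%VS.
  apply/subv_sumP => i _; apply/subv_sumP => p _; apply/subv_sumP => j _ /=.
  by rewrite -memvE memv_ker linearB /= -!FE !kext_pure // fb subrr.
rewrite vsprojK ?memv_pi // !FE.
rewrite -[in RHS](@daddv_pi_add _ _ (balancing^C) balancing (kpure m n)).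
- rewrite linearD /=; have /(subvP kF) := memv_pi balancing balancing^C (kpure m n).
  by rewrite memv_ker => /eqP ->; rewrite addr0.
- by rewrite capvC capv_compl.
- by rewrite addvC addv_complf memvf.
Qed.

Lemma apure_balanced m a n :
  (forall m', linear (rmul (b := M) m')) ->
  (forall a', linear ((rmul (b := M))^~ a')) ->
  (forall a', linear (lmul (b := N) a')) ->
  (forall n', linear ((lmul (b := N))^~ n')) ->
  apure (rmul m a) n = apure m (lmul a n).
Proof.
move=> rl rr ll lr; apply/eqP; rewrite -subr_eq0 -!linearB /=; apply/eqP.
pose D m a n := kpure (rmul m a) n - kpure m (lmul a n).
have Dm a' n' : linear (fun m' => D m' a' n').
  move=> c x y; rewrite /D rr !kpure_linear_l.
  by rewrite subDD scalerBr.
have Da m' n' : linear (fun a' => D m' a' n').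
  by move=> c x y; rewrite /D rl lr kpure_linear_l kpure_linear_r subDD scalerBr.
have Dn m' a' : linear (fun n' => D m' a' n').
  by move=> c x y; rewrite /D ll !kpure_linear_r subDD scalerBr.
have DB : D m a n \in balancing.
  rewrite (linear_vbasis _ (Dm a n)); apply: memv_suml => i _; apply: memvZ.
  rewrite (linear_bas _ (Da _ n)); apply: memv_suml => p _; apply: memvZ.
  rewrite (linear_vbasis _ (Dn _ _)); apply: memv_suml => j _; apply: memvZ.
  rewrite memvE; apply: (sumv_sup i) => //; apply: (sumv_sup p) => //.
  exact: (sumv_sup j).
rewrite -/(D m a n) (_ : daddv_pi _ _ _ = 0) ?linear0 //.
have I0 : (balancing^C :&: balancing = 0)%VS by rewrite capvC capv_compl.
have := daddv_pi_add (w := D m a n) I0.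
rewrite [in X in _ + X]daddv_pi_id //; last by rewrite capv_compl.
rewrite addvC addv_complf memvf => /(_ isT).
by rewrite -[RHS]add0r => /addIr.
Qed.

Definition atens : bimod := {|
  carrier := atens_sp;
  lmul := fun a => alift (fun m n => apure (lmul a m) n);
  rmul := fun z a => alift (fun m n => apure m (rmul n a)) z;
  hact := fun h => alift (fun m n =>
    \sw_(h1, h2 <- comul h) apure (hact h1 m) (hact h2 n)) |}.

End TensorA.

Definition X : bimod := Bimod vf_lmul vf_rmul vf_act.
Definition Om : bimod := Bimod om_lmul om_rmul om_act.

Definition tau (M N : bimod) : atens M N -> atens N M :=
  alift (fun m n => \sw_(r, s <- Rbar) apure (hact r n) (hact s m)).

Definition assoc (M N P : bimod) : atens M (atens N P) -> atens (atens M N) P :=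
  alift (fun (m : M) (z : atens N P) =>
    alift (fun n p => apure (apure m n : atens M N) p) z).

Definition tau23 (M N P : bimod) :
    atens (atens M N) P -> atens (atens M P) N :=
  alift (fun (y : atens M N) (p : P) =>
    alift (fun m n => assoc (apure m (tau (apure n p : atens N P)))) y).

Section Connection.
Variable nabla : 'Hom(X, atens Om X).

Definition left_connection : Prop := forall (a : A) (v : X),
  nabla (lmul a v) = apure (d a : Om) v + lmul a (nabla v).

Definition interior (w : X) : atens Om X -> X :=
  alift (fun (th : Om) (v : X) => lmul (ev w th) v).

Definition torsion_free : Prop := forall w v : X,
  vsval (interior w (nabla v)
         - \sw_(r, s <- Rbar) interior (hact r v) (nabla (hact s w)))
  - bracket w v = 0.

(* <eta ⊗_A v, theta> = eta <v, theta>; <v, theta ⊗_A eta> = <v, theta> eta. *)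
Definition ev_left (z : atens Om X) (th : Om) : Om :=
  alift (fun (eta : Om) (v : X) => rmul eta (ev v th)) z.

Definition ev_right (v : X) : atens Om Om -> Om :=
  alift (fun th eta : Om => lmul (ev v th) eta).

Definition dual_connection (dn : 'Hom(Om, atens Om Om)) : Prop :=
  forall (v : X) (th : Om),
    d (ev v th) = ev_left (nabla v) th + ev_right v (dn th).

End Connection.

Definition dn_act (dn : 'Hom(Om, atens Om Om)) (h : H) (eta : Om) :
    atens Om Om :=
  \sw_(h1, h2 <- comul h) hact h1 (dn (hact (antip H h2) eta)).

Definition dn_lift (dn : 'Hom(Om, atens Om Om)) :
    atens Om Om -> atens (atens Om Om) Om :=
  alift (fun th eta => tau23 (apure (dn th) eta) +
    \sw_(r, s <- Rbar) assoc (apure (hact r th) (dn_act dn s eta))).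

(* The dual connection dn exists and is determined by a left connection nabla. *)
Definition metric_compatible (g : atens Om Om) (nabla : 'Hom(X, atens Om X)) :=
  exists2 dn, dual_connection nabla dn & dn_lift dn g = 0.

Definition levi_civita (g : atens Om Om) (nabla : 'Hom(X, atens Om X)) : Prop :=
  [/\ left_connection nabla, torsion_free nabla & metric_compatible g nabla].

(* a |-> a_(1) <chi, a_(2)>, a braided derivation for the two chi below. *)
Definition inv_vfield (chi : UU) : X :=
  mkvf (linfun (fun a : A => \sw_(a1, a2 <- comul a) (pairA chi a2 *: a1))).

Definition u : X := inv_vfield ((gam * psi : U) ⊗ (1 : U)).
Definition u' : X := inv_vfield ((1 : U) ⊗ (gam * psi : U)).

Definition dual_basis (w w' : Om) : Prop :=
  [/\ ev u w = 1, ev u' w = 0, ev u w' = 0 & ev u' w' = 1].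

(* Changes the sign of each of the generators x, g, x', g'. *)
Definition tilde (a : A) : A :=
  [ffun p : (bool * bool) * (bool * bool) =>
     (-1) ^+ (p.1.1 + p.1.2 + p.2.1 + p.2.2)%N * a p].

End Calculus.

(* Main.v *)
Require Import Defs.
From HB Require Import structures.
From mathcomp Require Import all_boot all_order all_algebra all_field ring.
Set Implicit Arguments.
Unset Strict Implicit.
Unset Printing Implicit Defensive.
Import GRing.Theory.
Local Open Scope ring_scope.

(** The R-matrix of H lives on the group generated by the grouplikes gamma and
    gamma' of the four copies of U. Since its inverse is the Fourier transform of
    a bicharacter of this group (sweed_Rbar), the action of H enters the braiding
    only through a grading by sixteen degrees and a commutation factor: A is color
    commutative, X consists of color derivations, and whenever one of two braided
    vectors has degree p, the braiding is the action of the grouplike of index p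
    on the other one (sweed_Rbar_homog). All the modules in play are symmetric
    bimodules for this commutation factor (lawful, atens_lawful), and they are
    generated by homogeneous vectors, so every identity reduces to a sign rule.

    The degrees of x and x' anticommute with themselves and commute with each
    other. A braided derivation vanishes on g and g', because g is an involution
    that commutes with itself; hence it is determined by its values on x and x',
    and u, u' are a basis of X (vf_decomp).

    The torsion is tensorial, u and u' have vanishing brackets, and for u against
    itself torsion freeness reads 2 nabla_u u = 0. So a torsion free connection has
    nabla(u) = omega' ⊗ s and nabla(u') = omega ⊗ s with one common vector field
    s = a u + b u' (torsionlessP). Its dual connection is then minus
    (omega ⊗ omega' + omega' ⊗ omega) a on omega and minus the same tensor times b on
    omega' (dual_conn_const). Applying the lifted dual connection to the metric
    leaves, after the signs of the braiding are taken into account, two independent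
    equations (conn_lift_metric, tri_free): b t + u(t) = 0 after the sign change of
    x and g in b, and a t + u'(t) = 0 after the sign change of x' and g' in a. As t
    is invertible they have exactly one solution, and moving its coefficients
    to the right of u and u' turns these sign changes into tilde.

    Existence uses the same computation: the connection with these values on u and
    u' (conn_of) has a dual connection (dual_conn_exists), and both conditions hold
    by the equivalences above. *)

(** * Linear maps and finite tensors *)

(* The maps of the calculus are bare functions, so linearity is carried as a
   proposition and the usual consequences of linearity are needed in that
   form. *)
Section LinearFacts.
Variables (k : fieldType) (V W : lmodType k) (f : V -> W).
Hypothesis lf : linear f.

Lemma lin0 : f 0 = 0.
Proof. by have := lf (-1) 0 0; rewrite scaler0 addr0 scaleN1r addNr. Qed.

Lemma linD v w : f (v + w) = f v + f w.
Proof. by have := lf 1 v w; rewrite !scale1r. Qed.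

Lemma linZ c v : f (c *: v) = c *: f v.
Proof. by have := lf c v 0; rewrite lin0 !addr0. Qed.

Lemma linN v : f (- v) = - f v.
Proof. by rewrite -!scaleN1r linZ. Qed.

Lemma linB v w : f (v - w) = f v - f w.
Proof. by rewrite linD linN. Qed.

Lemma lin_sum (I : finType) (P : pred I) (F : I -> V) :
  f (\sum_(i | P i) F i) = \sum_(i | P i) f (F i).
Proof. exact: (big_morph f linD lin0). Qed.

End LinearFacts.

Lemma lin_comp (k : fieldType) (V W Z : lmodType k) (f : W -> Z) (g : V -> W) :
  linear f -> linear g -> linear (fun v => f (g v)).
Proof. by move=> lf lg c v w; rewrite lg lf. Qed.

Lemma lin_add (k : fieldType) (V W : lmodType k) (f g : V -> W) :
  linear f -> linear g -> linear (fun v => f v + g v).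
Proof. by move=> lf lg c v w; rewrite lf lg scalerDr addrACA. Qed.

Lemma lin_opp (k : fieldType) (V W : lmodType k) (f : V -> W) :
  linear f -> linear (fun v => - f v).
Proof. by move=> lf c v w; rewrite lf opprD scalerN. Qed.

Lemma lin_scale (k : fieldType) (V W : lmodType k) (c : k) (f : V -> W) :
  linear f -> linear (fun v => c *: f v).
Proof. by move=> lf l v w; rewrite lf scalerDr !scalerA mulrC. Qed.

Lemma sweed_bas (k : fieldType) (B C : scalg k) (V : lmodType k)
    (p : idx (tens B C)) (f : B -> C -> V) :
  sweed (bas p) f = f (bas p.1) (bas p.2).
Proof.
rewrite /sweed (bigD1 p) //= ffunE eqxx scale1r big1 ?addr0 // => q /negPf nq.
by rewrite ffunE nq scale0r.
Qed.

Lemma sweed_ext (k : fieldType) (B C : scalg k) (V : lmodType k)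
    (z : tens B C) (f g : B -> C -> V) :
  (forall b c, f b c = g b c) -> sweed z f = sweed z g.
Proof. by move=> fg; apply: eq_bigr => p _; rewrite fg. Qed.

Lemma lin_sweed (k : fieldType) (B C : scalg k) (V W : lmodType k)
    (z : tens B C) (f : B -> C -> V) (L : V -> W) :
  linear L -> L (sweed z f) = sweed z (fun b c => L (f b c)).
Proof.
by move=> lL; rewrite /sweed (lin_sum lL); apply: eq_bigr => p _; rewrite (linZ lL).
Qed.

Lemma bas_pure (k : fieldType) (B C : scalg k) (i : idx B) (j : idx C) :
  bas ((i, j) : idx (tens B C)) = bas i ⊗ bas j.
Proof.
by apply/ffunP=> q; rewrite !ffunE -natrM mulnb -pair_eqE.
Qed.

Section Midflip.
Variables (k : fieldType) (B C D E : scalg k).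

Lemma midflipM (z z' : tens (tens B C) (tens D E)) :
  midflip (z * z') = midflip z * midflip z'.
Proof.
pose phi (p : (idx B * idx D) * (idx C * idx E)) :=
  ((p.1.1, p.2.1), (p.1.2, p.2.2)).
have bphi : bijective phi.
  by exists (fun p => ((p.1.1, p.2.1), (p.1.2, p.2.2))) => [] [[] ? ? []].
apply/ffunP=> m; rewrite !ffunE (reindex phi) /=; last exact: onW_bij.
apply: eq_bigr => i _; rewrite (reindex phi) /=; last exact: onW_bij.
apply: eq_bigr => j _; rewrite !ffunE /=; congr (_ * _).
exact: mulrACA.
Qed.

Lemma midflip1 : midflip (1 : tens (tens B C) (tens D E)) = 1.
Proof.
apply/ffunP=> m; rewrite ffunE; do !rewrite [oneb _]ffunE /=.
rewrite !ffunE /=. exact: mulrACA.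
Qed.

End Midflip.

Lemma pure1 (k : fieldType) (B C : scalg k) : (1 : B) ⊗ (1 : C) = 1.
Proof. by apply/ffunP=> p; rewrite !ffunE. Qed.

Lemma inv_invol (R : unitRingType) (x : R) : x * x = 1 -> x^-1 = x.
Proof.
move=> xx; have ux : x \is a GRing.unit by apply/unitrP; exists x.
by apply: (mulrI ux); rewrite divrr.
Qed.

(** * The universal R-matrix is an involution *)

Section RMatrix.
Variable k : fieldType.
Hypothesis char0 : [pchar k] =i pred0.

Lemma two_neq0 : 2 != 0 :> k.
Proof. by have /pcharf0P -> := char0. Qed.

Lemma RU_invol : RU k * RU k = 1.
Proof.
rewrite /RU; set a := gam k ⊗ 1; set b := 1 ⊗ gam k.
have aa : a * a = 1 by rewrite pureM gK2 mulr1 pure1.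
have bb : b * b = 1 by rewrite pureM gK2 mulr1 pure1.
have ab : a * b = gam k ⊗ gam k by rewrite pureM mulr1 mul1r.
have ba : b * a = a * b by rewrite !pureM !mulr1 !mul1r.
(* Twice RU is x + b y with x = 1 + a and y = 1 - a, and x, y are orthogonal
   and square to their doubles. *)
rewrite -ab pure1 -scalerAl -scalerAr scalerA.
have -> : 1 + a + b - a * b = (1 + a) + b * (1 - a).
  by rewrite mulrBr mulr1 ba addrA.
set y := 1 - a; set x := 1 + a.
have xy : x * y = 0 by rewrite /x mulrDl mul1r /y mulrBr mulr1 aa addrA subrK subrr.
have yx : y * x = 0 by rewrite /x mulrDr mulr1 /y mulrBl mul1r aa addrA subrK subrr.
have xx : x * x = x *+ 2.
  by rewrite {1}/x mulrDl mul1r {2}/x mulrDr mulr1 aa [a + 1]addrC -/x.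
have yy : y * y = y *+ 2.
  by rewrite {1}/y mulrBl mul1r {2}/y mulrBr mulr1 aa opprB -/y.
have yb : y * b = b * y by rewrite /y mulrBr mulrBl ba mulr1 mul1r.
have xbb : x * b = b * x by rewrite /x mulrDr mulrDl ba mulr1 mul1r.
have -> : (x + b * y) * (x + b * y) = (x + y) *+ 2.
  move: (x) (y) xy yx xx yy yb xbb => p q pq qp pp qq qb pb.
  rewrite mulrDl !mulrDr pp mulrA pb -[b * p * q]mulrA pq mulr0 addr0.
  rewrite -[b * q * p]mulrA qp mulr0 add0r mulrA -[b * q * b]mulrA qb mulrA bb.
  by rewrite mul1r qq -mulrnDl.
have -> : (x + y) *+ 2 = 1 *+ 4.
  by rewrite /x /y addrACA subrr addr0 -mulr2n -mulrnA.
rewrite -scaler_nat scalerA -[4%N]/(2 * 2)%N natrM mulrACA mulVf ?two_neq0 //.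
by rewrite mulr1 scale1r.
Qed.

Lemma RUU_invol : RUU k * RUU k = 1.
Proof. by rewrite -midflipM pureM RU_invol pure1 midflip1. Qed.

Lemma RUUinvE : RUUinv k = RUU k.
Proof. exact/inv_invol/RUU_invol. Qed.

(** The two legs are reversed together, so the square is the same in the
    opposite algebra. *)
Lemma RUUop_invol :
  (RUU k : tens (opalg (UU k)) (opalg (UU k))) * RUU k = 1.
Proof.
apply/ffunP=> m; have /ffunP/(_ m) := RUU_invol.
rewrite !ffunE => e; apply: etrans e.
rewrite exchange_big /=; apply: eq_bigr => i _; apply: eq_bigr => j _.
by rewrite [y in y * _ = _]mulrC.
Qed.

Lemma RH_invol : RH k * RH k = 1.
Proof.
by rewrite -midflipM pureM RUUinvE RUUop_invol RUU_invol pure1 midflip1.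
Qed.

Lemma RbarE : Rbar k = RH k.
Proof. exact/inv_invol/RH_invol. Qed.

End RMatrix.

(** * The degree group and its bicharacter *)

(** Indices of the sixteen grouplikes of H, and also their characters: the
    first pair belongs to the factor with opposite product, the second pair
    to the other one, and within a pair the entries belong to the two copies
    of U. *)
Definition deg := ((bool * bool) * (bool * bool))%type.

Definition dadd (i j : deg) : deg :=
  ((i.1.1 (+) j.1.1, i.1.2 (+) j.1.2), (i.2.1 (+) j.2.1, i.2.2 (+) j.2.2)).

Definition dzero : deg := ((false, false), (false, false)).

Definition dot (i j : deg) : bool :=
  (i.1.1 && j.1.1) (+) (i.1.2 && j.1.2) (+)
  ((i.2.1 && j.2.1) (+) (i.2.2 && j.2.2)).

Lemma daddC : commutative dadd.
Proof. by move=> [[a b] [c d]] [[a' b'] [c' d']]; rewrite /dadd /= (addbC a) (addbC b) (addbC c) (addbC d). Qed.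

Lemma daddA : associative dadd.
Proof. by move=> i j l; rewrite /dadd /= !addbA. Qed.

Lemma daddii i : dadd i i = dzero.
Proof. by rewrite /dadd !addbb. Qed.

Lemma dadd0 i : dadd i dzero = i.
Proof. by case: i => [[a b] [c d]]; rewrite /dadd /= !addbF. Qed.

Lemma add0d i : dadd dzero i = i.
Proof. by rewrite daddC dadd0. Qed.

Lemma daddKl i : involutive (dadd i).
Proof. by move=> j; rewrite daddA daddii add0d. Qed.

Lemma dotC i j : dot i j = dot j i.
Proof. by rewrite /dot (andbC i.1.1) (andbC i.1.2) (andbC i.2.1) (andbC i.2.2). Qed.

Lemma dotDl i j p : dot (dadd i j) p = dot i p (+) dot j p.
Proof.
rewrite /dot /= !andb_addl.
by do 8!case: (_ && _).
Qed.

Section Sign.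
Variable k : fieldType.

(** The value of the character of degree j on the grouplike of index i, and
    also the commutation factor of vectors of degrees i and j. *)
Definition sgn (i j : deg) : k := (-1) ^+ dot i j.

Lemma sgnC i j : sgn i j = sgn j i.
Proof. by rewrite /sgn dotC. Qed.

Lemma sgnDl i j p : sgn (dadd i j) p = sgn i p * sgn j p.
Proof. by rewrite /sgn dotDl signr_addb. Qed.

Lemma sgnDr p i j : sgn p (dadd i j) = sgn p i * sgn p j.
Proof. by rewrite sgnC sgnDl !(sgnC p). Qed.

Lemma sgn_sq i j : sgn i j * sgn i j = 1.
Proof. by rewrite /sgn -signr_addb addbb. Qed.

Lemma sgn0r i : sgn i dzero = 1.
Proof. by rewrite /sgn /dot !andbF. Qed.

Lemma sgn0l i : sgn dzero i = 1.
Proof. by []. Qed.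

Lemma sgnKl i j (V : lmodType k) (v : V) : sgn i j *: (sgn i j *: v) = v.
Proof. by rewrite scalerA sgn_sq scale1r. Qed.

(** Orthogonality of characters; the sum is a product of four sums over the
    two-element group. *)
Lemma sgn_ortho j p : \sum_i sgn i j * sgn i p = 16 * (j == p)%:R.
Proof.
have one (a b : bool) : \sum_(i : bool) (-1) ^+ (i && a) * (-1) ^+ (i && b)
     = 2 * (a == b)%:R :> k.
  rewrite big_bool /= expr0 mulr1 -signr_addb.
  by case: a b => [] []; rewrite /= ?expr0 ?expr1 ?mulr1 ?mulr0 ?addNr // -[2]/(1 + 1).
pose F (a b i : bool) : k := (-1) ^+ (i && a) * (-1) ^+ (i && b).
transitivity ((\sum_i F j.1.1 p.1.1 i) * (\sum_i F j.1.2 p.1.2 i) *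
   ((\sum_i F j.2.1 p.2.1 i) * (\sum_i F j.2.2 p.2.2 i))).
  rewrite big_distrlr /= pair_bigA /= big_distrlr /= pair_bigA /=.
  rewrite big_distrlr /= pair_bigA /=.
  apply: eq_bigr => i _; rewrite /sgn /dot /F !signr_addb.
  by ring.
rewrite !one.
case: j p => [[a b] [c d]] [[a' b'] [c' d']] /=.
rewrite -!pair_eqE /= /pair_eq /=.
rewrite -!mulnb !natrM.
by ring.
Qed.

End Sign.

(** * The R-matrix in terms of grouplikes *)

Section Braiding.
Variable k : fieldType.

Definition grp (i : deg) : idx (H k) :=
  (((false, i.1.1), (false, i.1.2)), ((false, i.2.1), (false, i.2.2))).

(** The products of the elements gamma and gamma' of the four copies of U. *)
Definition grpl (i : deg) : H k := bas (grp i).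

Definition ungrp (p : idx (H k)) : deg :=
  ((p.1.1.2, p.1.2.2), (p.2.1.2, p.2.2.2)).

Lemma ungrpK i : ungrp (grp i) = i.
Proof. by case: i => [[a b] [c d]]. Qed.

Definition is_grp (p : idx (H k)) : bool :=
  [&& ~~ p.1.1.1, ~~ p.1.2.1, ~~ p.2.1.1 & ~~ p.2.2.1].

Lemma grpK p : is_grp p -> grp (ungrp p) = p.
Proof. by case: p => [[[[] a] [[] b]] [[[] c] [[] d]]]. Qed.

Lemma RU_coef (p : idx (tens (U k) (U k))) :
  RU k p = (~~ p.1.1 && ~~ p.2.1)%:R * (2^-1 * (-1) ^+ (p.1.2 && p.2.2)).
Proof.
rewrite /RU; do !rewrite ffunE /=.
case: p => [[[] a] [[] b]] /=;
  case: a b => [] [];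
  rewrite /GRing.scale /= ?(mulr0, mul0r, mulr1, mul1r, addr0, add0r, oppr0, subr0, sub0r) //.
all: try by rewrite ?expr0 ?expr1 ?mulrN1 ?mulr1 ?mulrN.
Qed.

Lemma RUU_coef (p : idx (tens (UU k) (UU k))) :
  RUU k p = RU k ((p.1.1, p.2.1) : idx (tens (U k) (U k))) *
            RU k ((p.1.2, p.2.2) : idx (tens (U k) (U k))).
Proof. by rewrite /RUU !ffunE. Qed.

Hypothesis char0 : [pchar k] =i pred0.

Lemma RH_coef (p : idx (tens (H k) (H k))) :
  RH k p = (is_grp p.1 && is_grp p.2)%:R *
           (16^-1 * sgn k (ungrp p.1) (ungrp p.2)).
Proof.
rewrite /RH RUUinvE // ffunE ffunE /= !RUU_coef !RU_coef /=.
rewrite /is_grp /sgn /dot /=.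
have -> : 16^-1 = 2^-1 * 2^-1 * (2^-1 * 2^-1) :> k.
  by rewrite -!invfM -!natrM.
rewrite !signr_addb.
by rewrite -!mulnb !natrM; ring.
Qed.

Lemma RH_grp i j : RH k (grp i, grp j) = 16^-1 * sgn k i j.
Proof. by rewrite RH_coef !ungrpK mul1r. Qed.

(** The inverse R-matrix is the Fourier transform of the bicharacter sgn, so
    that only the action of the grouplikes enters the braiding. *)
Lemma sweed_Rbar (V : lmodType k) (f : H k -> H k -> V) :
  sweed (Rbar k) f =
  16^-1 *: \sum_i \sum_j sgn k i j *: f (grpl i) (grpl j).
Proof.
rewrite RbarE // /sweed pair_bigA /= scaler_sumr.
rewrite (bigID (fun p : idx (tens (H k) (H k)) => is_grp p.1 && is_grp p.2)) /=.
rewrite [X in _ + X]big1 ?addr0 => [|p /negPf np]; last first.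
  by rewrite RH_coef np mul0r scale0r.
rewrite (reindex_onto (fun q : deg * deg => (grp q.1, grp q.2))
                      (fun p => (ungrp p.1, ungrp p.2))) /=; last first.
  by move=> [p q] /= /andP[gp gq]; rewrite !grpK.
apply: eq_big => [[i j] | [i j] _] /=; first by rewrite !ungrpK eqxx.
by rewrite RH_grp scalerA.
Qed.

(** If the first leg meets a vector of degree p, orthogonality of characters
    collapses the braiding to the action of the grouplike of index p on the
    second leg. Every occurrence of the R-matrix is computed in this way. *)
Lemma sweed_Rbar_homog (V : lmodType k) (f : H k -> H k -> V) (p : deg)
    (F : H k -> V) :
  (forall i j, f (grpl i) (grpl j) = sgn k i p *: F (grpl j)) ->
  sweed (Rbar k) f = F (grpl p).
Proof.
move=> fE; rewrite sweed_Rbar exchange_big /= (bigD1 p) //=.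
have S j : \sum_i sgn k i j *: f (grpl i) (grpl j)
           = (16 * (j == p)%:R) *: F (grpl j).
  rewrite -sgn_ortho scaler_suml; apply: eq_bigr => i _.
  by rewrite fE scalerA.
rewrite S eqxx mulr1 big1 ?addr0 => [|j /negPf nj]; last first.
  by rewrite S nj mulr0 scale0r.
rewrite scalerA mulVf ?scale1r //.
by have /pcharf0P -> := char0.
Qed.

End Braiding.

(** * Antipodes and coproducts of the grouplikes *)

Lemma lin_eq_bas (k : fieldType) (B : scalg k) (V : lmodType k) (f g : B -> V) :
  linear f -> linear g -> (forall i, f (bas i) = g (bas i)) -> f =1 g.
Proof.
move=> lf lg fg x; rewrite (linear_bas x lf) (linear_bas x lg).
by apply: eq_bigr => i _; rewrite fg.
Qed.

Lemma lker0_cancel (k : fieldType) (V W : vectType k) (f : 'Hom(V, W)) g :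
  cancel f g -> lker f == 0%VS.
Proof. by move=> fK; apply/lker0P; apply: can_inj fK. Qed.

Section TensorHopf.
Variables (k : fieldType) (B C : hopf k).

Lemma comul_tensH_bas (i : idx B) (j : idx C) :
  comul (bas i ⊗ bas j : tensH B C) =
  midflip (comul (bas i : B) ⊗ comul (bas j : C)).
Proof. by rewrite -bas_pure /= sweed_bas. Qed.

Lemma antip_tensH_pure (b : B) (c : C) :
  antip (tensH B C) (b ⊗ c) = antip B b ⊗ antip C c.
Proof.
rewrite /= linfunE; last exact: sweed_linear.
apply: sweed_pure => [b' | c'].
  by apply: (lin_comp (pure_linear_r _)); apply: linearP.
by apply: (lin_comp (@pure_linear_l _ _ _ _) (g := antip B)); apply: linearP.
Qed.

(** The action on forms uses the inverse of the antipode, which is a genuine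
    inverse only for an injective antipode. *)
Lemma antip_tensH_inj :
  lker (antip B) == 0%VS -> lker (antip C) == 0%VS ->
  lker (antip (tensH B C)) == 0%VS.
Proof.
move=> iB iC.
pose T z := sweed z (fun (b : B) (c : C) =>
  ((antip B)^-1%VF b ⊗ (antip C)^-1%VF c) : tens B C).
apply: (@lker0_cancel _ _ _ _ T).
apply: lin_eq_bas => [c x y|c x y|[i j]] //.
  by rewrite linearP; apply: sweed_linear.
rewrite bas_pure antip_tensH_pure /T sweed_pure => [|b c x y|c' c x y].
- by rewrite !lker0_lfunK.
- by rewrite linearP pure_linear_r.
- by rewrite linearP pure_linear_l.
Qed.

End TensorHopf.

Lemma midflip_pure (k : fieldType) (B C D E : scalg k)
    (b : B) (c : C) (e : D) (f : E) :
  midflip ((b ⊗ c) ⊗ (e ⊗ f)) = (b ⊗ e) ⊗ (c ⊗ f).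
Proof. by apply/ffunP=> p; rewrite !ffunE /= mulrACA. Qed.

Section Antipode.
Variable k : fieldType.

Lemma antipK_bas (a b : bool) :
  antip (K k) (bas ((a, b) : idx (K k))) =
  if a then (-1) ^+ (~~ b) *: bas ((true, ~~ b) : idx (K k))
  else bas ((false, b) : idx (K k)).
Proof.
rewrite /= linfunE; last first.
  move=> c z z'; rewrite scaler_sumr -big_split; apply: eq_bigr => p _.
  by rewrite !ffunE scalerDl scalerA.
rewrite (bigD1 (a, b)) //= ffunE eqxx scale1r big1 ?addr0; last first.
  by move=> p /negPf np; rewrite ffunE np scale0r.
case: a b => [] [] /=; rewrite ?expr0 ?expr1 ?mul1r ?mulr1 ?scale1r.
- by rewrite mulrA gK2 mul1r.
- by rewrite /gK /xK !basM /= !expr1.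
- by [].
- by rewrite basK !expr0 mulr1.
Qed.

Lemma antipK_inj : lker (antip (K k)) == 0%VS.
Proof.
(* The antipode of K has order four. *)
apply: (@lker0_cancel _ _ _ _
  (fun z => antip (K k) (antip (K k) (antip (K k) z)))).
apply: lin_eq_bas => [c x y|c x y|[a b]] //; first by rewrite !linearP.
rewrite antipK_bas; case: a b => [] [] /=; rewrite ?linearZ /= !antipK_bas /=;
  rewrite ?linearZ /= ?antipK_bas /= ?linearZ /= ?antipK_bas //=;
  by rewrite !scalerA ?expr0 ?expr1 ?mulr1 ?mulrNN ?mul1r ?scale1r ?mulrN1 ?opprK ?scale1r.
Qed.

Lemma antipUU_inj : lker (antip (UU k)) == 0%VS.
Proof. by apply: antip_tensH_inj; apply: antipK_inj. Qed.

Lemma antipUUop_inj : lker (antip (opH (UU k))) == 0%VS.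
Proof.
apply: (@lker0_cancel _ _ _ _ (antip (UU k))) => z /=.
by rewrite lker0_lfunVK // antipUU_inj.
Qed.

Lemma antipH_inj : lker (antip (H k)) == 0%VS.
Proof. by apply: antip_tensH_inj; rewrite ?antipUUop_inj ?antipUU_inj. Qed.

Lemma antipUU_grp (b c : bool) (z := bas (((false, b), (false, c)) : idx (UU k))) :
  antip (UU k) z = z.
Proof. by rewrite /z bas_pure antip_tensH_pure !antipK_bas. Qed.

Lemma grplE i : grpl k i =
  (bas (((false, i.1.1), (false, i.1.2)) : idx (UU k)) : opH (UU k)) ⊗
  (bas (((false, i.2.1), (false, i.2.2)) : idx (UU k)) : UU k).
Proof. by rewrite /grpl /grp bas_pure. Qed.

Lemma antip_grpl i : antip (H k) (grpl k i) = grpl k i.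
Proof.
rewrite grplE antip_tensH_pure antipUU_grp; congr (_ ⊗ _).
have /= := lker0_lfunK antipUU_inj (bas (((false, i.1.1), (false, i.1.2)) : idx (UU k))).
by rewrite antipUU_grp.
Qed.

Lemma antipV_grpl i : (antip (H k))^-1%VF (grpl k i) = grpl k i.
Proof. by have := lker0_lfunK antipH_inj (grpl k i); rewrite antip_grpl. Qed.

Lemma comulUU_grp (b c : bool) (z := bas (((false, b), (false, c)) : idx (UU k))) :
  comul (z : UU k) = z ⊗ z.
Proof.
rewrite /z bas_pure comul_tensH_bas.
by rewrite !(comulK_bas k false) /= midflip_pure.
Qed.

Lemma comul_grpl i : comul (grpl k i) = grpl k i ⊗ grpl k i.
Proof.
rewrite grplE comul_tensH_bas.
rewrite [comul (bas _ : opH _)]comulUU_grp comulUU_grp.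
exact: midflip_pure.
Qed.

Lemma sweed_comul_grpl (V : lmodType k) i (f : H k -> H k -> V) :
  sweed (comul (grpl k i)) f = f (grpl k i) (grpl k i).
Proof. by rewrite comul_grpl /grpl -bas_pure sweed_bas. Qed.

End Antipode.

(** * Translations of A *)

Section Translations.
Variable k : fieldType.

Let transl (c : U k) (z : K k) : K k :=
  \sw_(a, b <- comul z) (pairK c a *: b).
Let transr (c : U k) (z : K k) : K k :=
  \sw_(a, b <- comul z) (pairK c b *: a).

Lemma sweed_pairKl (c : U k) (b b' : K k) :
  sweed (b ⊗ b') (fun x y : K k => pairK c x *: y) = pairK c b *: b'.
Proof.
apply: sweed_pure => [x | y] l v w; first by rewrite scalerDr !scalerA mulrC.
by rewrite pairK_linear_r scalerDl scalerA.
Qed.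

Lemma sweed_pairKr (c : U k) (b b' : K k) :
  sweed (b ⊗ b') (fun x y : K k => pairK c y *: x) = pairK c b' *: b.
Proof.
apply: sweed_pure => [x | y] l v w; last by rewrite scalerDr !scalerA mulrC.
by rewrite pairK_linear_r scalerDl scalerA.
Qed.

Let basf (s : bool) : U k := bas ((false, s) : idx (K k)).

Lemma transl_grp s a b (z := bas ((a, b) : idx (K k))) :
  transl (basf s) z = (-1) ^+ (s && b) *: z.
Proof.
rewrite /z {z} /transl comulK_bas; case: a; last first.
  by rewrite sweed_pairKl pairK_bas /pairb /= addn0.
rewrite (linD (@sweed_linear _ _ _ _ _)) !sweed_pairKl !pairK_bas /pairb /=.
by rewrite scale0r add0r addn0.
Qed.

Lemma transr_grp s a b (z := bas ((a, b) : idx (K k))) :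
  transr (basf s) z = (-1) ^+ (s && (a (+) b)) *: z.
Proof.
rewrite /z {z} /transr comulK_bas; case: a; last first.
  by rewrite sweed_pairKr pairK_bas /pairb /= addn0.
rewrite (linD (@sweed_linear _ _ _ _ _)) !sweed_pairKr !pairK_bas /pairb /=.
by rewrite scale0r addr0 addn0.
Qed.

(** Only the summand 1 ⊗ x of the coproduct of x pairs with psi, so right
    translation by gamma psi removes the generator x. *)
Lemma transr_chi a b :
  transr (gam k * psi k) (bas ((a, b) : idx (K k))) =
  a%:R *: bas ((false, b) : idx (K k)).
Proof.
have -> : gam k * psi k = - bas ((true, true) : idx (K k)).
  by rewrite -(opprK (gam k * psi k)) -xgK /gam /psi /gK /xK basM /= expr0 scale1r.
have N z : pairK (- bas ((true, true) : idx (K k))) z = - pairK (bas ((true, true) : idx (K k))) z.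
  by rewrite (linN (pairK_linear_l z)).
rewrite /transr comulK_bas; case: a; last first.
  by rewrite sweed_pairKr N pairK_bas /pairb /= oppr0.
rewrite (linD (@sweed_linear _ _ _ _ _)) !sweed_pairKr !N !pairK_bas /pairb /=.
by rewrite oppr0 scale0r add0r; case: b; rewrite /= expr1 opprK.
Qed.

Lemma pairA_pure (c c' : U k) (b b' : K k) :
  pairA ((c ⊗ c') : UU k) ((b ⊗ b') : A k) = pairK c b * pairK c' b'.
Proof.
have inner z1 z2 : sweed (b ⊗ b') (fun y1 y2 : K k => pairK z1 y1 * pairK z2 y2 : k^o) = pairK z1 b * pairK z2 b'.
  apply: (@sweed_pure _ _ _ k^o) => [x | y] l v w /=; rewrite pairK_linear_r.
    by rewrite mulrDr /GRing.scale /= mulrCA.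
  by rewrite mulrDl /GRing.scale /= mulrA.
rewrite /pairA (sweed_ext _ inner).
apply: (@sweed_pure _ _ _ k^o) => [x | y] l v w /=; rewrite pairK_linear_l.
  by rewrite mulrDr /GRing.scale /= mulrCA.
by rewrite mulrDl /GRing.scale /= mulrA.
Qed.

Lemma pairA_linear_r (c : UU k) : linear (fun y : A k => pairA c y : k^o).
Proof.
rewrite /pairA; apply: sweed_linear_fun => z1 z2; exact: sweed_linear.
Qed.

(** By linearity in both arguments it is enough to compare basis elements, on
    which the coproduct of A splits into those of the two copies of K. *)
Lemma sweed_midflip_pairAl (c c' : U k) (z z' : tens (K k) (K k)) :
  sweed (midflip (z ⊗ z') : tens (A k) (A k))
    (fun a1 a2 : A k => pairA ((c ⊗ c') : UU k) a1 *: a2) =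
  (\sw_(a, b <- z) (pairK c a *: b)) ⊗ (\sw_(a, b <- z') (pairK c' a *: b)).
Proof.
have lm : linear (@midflip k (K k) (K k) (K k) (K k)).
  by move=> l v w; apply/ffunP=> p; rewrite !ffunE.
move: z; apply: lin_eq_bas => [||[i i']].
- by apply: (lin_comp (@sweed_linear _ _ _ _ _)); apply: (lin_comp lm); apply: pure_linear_l.
- by apply: (lin_comp (@pure_linear_l _ _ _ _)); apply: sweed_linear.
move: z'; apply: lin_eq_bas => [||[j j']].
- by apply: (lin_comp (@sweed_linear _ _ _ _ _)); apply: (lin_comp lm); apply: pure_linear_r.
- by apply: (lin_comp (@pure_linear_r _ _ _ _)); apply: sweed_linear.
rewrite !bas_pure midflip_pure !sweed_pairKl sweed_pure.
- by rewrite pairA_pure (linZ (@pure_linear_l _ _ _ _)) (linZ (@pure_linear_r _ _ _ _)) scalerA.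
- by move=> x l v w; rewrite scalerDr !scalerA mulrC.
- by move=> y l v w; rewrite pairA_linear_r scalerDl scalerA.
Qed.

Lemma sweed_midflip_pairAr (c c' : U k) (z z' : tens (K k) (K k)) :
  sweed (midflip (z ⊗ z') : tens (A k) (A k))
    (fun a1 a2 : A k => pairA ((c ⊗ c') : UU k) a2 *: a1) =
  (\sw_(a, b <- z) (pairK c b *: a)) ⊗ (\sw_(a, b <- z') (pairK c' b *: a)).
Proof.
have lm : linear (@midflip k (K k) (K k) (K k) (K k)).
  by move=> l v w; apply/ffunP=> p; rewrite !ffunE.
move: z; apply: lin_eq_bas => [||[i i']].
- by apply: (lin_comp (@sweed_linear _ _ _ _ _)); apply: (lin_comp lm); apply: pure_linear_l.
- by apply: (lin_comp (@pure_linear_l _ _ _ _)); apply: sweed_linear.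
move: z'; apply: lin_eq_bas => [||[j j']].
- by apply: (lin_comp (@sweed_linear _ _ _ _ _)); apply: (lin_comp lm); apply: pure_linear_r.
- by apply: (lin_comp (@pure_linear_r _ _ _ _)); apply: sweed_linear.
rewrite !bas_pure midflip_pure !sweed_pairKr sweed_pure.
- by rewrite pairA_pure (linZ (@pure_linear_l _ _ _ _)) (linZ (@pure_linear_r _ _ _ _)) scalerA.
- by move=> x l v w; rewrite pairA_linear_r scalerDl scalerA.
- by move=> y l v w; rewrite scalerDr !scalerA mulrC.
Qed.

(** By the coproduct x ⊗ g + 1 ⊗ x of x, left translation by gamma fixes x
    and right translation changes its sign, while both change the sign of g. *)
Definition dg (p : idx (A k)) : deg :=
  ((p.1.2, p.2.2), (p.1.1 (+) p.1.2, p.2.1 (+) p.2.2)).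

Lemma act_bas i p : act (grpl k i) (bas p) = sgn k i (dg p) *: (bas p : A k).
Proof.
have tr s s' : sweed (comul (bas p : A k))
     (fun a1 a2 : A k => pairA ((basf s ⊗ basf s') : UU k) a2 *: a1) =
   (-1) ^+ ((s && (p.1.1 (+) p.1.2)) (+) (s' && (p.2.1 (+) p.2.2))) *: bas p.
  move: (p) => [[a b] [c d]]; rewrite bas_pure comul_tensH_bas sweed_midflip_pairAr.
  rewrite -/(transr (basf s) _) -/(transr (basf s') _) !transr_grp (linZ (@pure_linear_l _ _ _ _)).
  by rewrite (linZ (@pure_linear_r _ _ _ _)) scalerA signr_addb.
have tl s s' : sweed (comul (bas p : A k))
     (fun a1 a2 : A k => pairA ((basf s ⊗ basf s') : UU k) a1 *: a2) =
   (-1) ^+ ((s && p.1.2) (+) (s' && p.2.2)) *: bas p.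
  move: (p) => [[a b] [c d]]; rewrite bas_pure comul_tensH_bas sweed_midflip_pairAl.
  rewrite -/(transl (basf s) _) -/(transl (basf s') _) !transl_grp (linZ (@pure_linear_l _ _ _ _)).
  by rewrite (linZ (@pure_linear_r _ _ _ _)) scalerA signr_addb.
(* The action is a right translation following a left translation. *)
have -> : act (grpl k i) (bas p) = sweed (comul (bas p : A k)) (fun a1 a' : A k =>
    sweed (comul a') (fun a2 a3 : A k =>
      (pairA (basf i.1.1 ⊗ basf i.1.2 : UU k) a1 *
       pairA (basf i.2.1 ⊗ basf i.2.2 : UU k) a3) *: a2)).
  by rewrite /act /grpl sweed_bas -!bas_pure.
pose R a' := sweed (comul a') (fun a2 a3 : A k =>
    pairA (basf i.2.1 ⊗ basf i.2.2 : UU k) a3 *: a2).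
have lR : linear R.
  by apply: (lin_comp (@sweed_linear _ _ _ _ _)); apply: sweed_linear.
transitivity (R (sweed (comul (bas p : A k)) (fun a1 a2 : A k =>
    pairA (basf i.1.1 ⊗ basf i.1.2 : UU k) a1 *: a2))).
  rewrite (lin_sweed _ _ lR); apply: sweed_ext => a1 a'.
  rewrite (linZ lR) /R /sweed scaler_sumr; apply: eq_bigr => q _.
  by rewrite !scalerA mulrA [comul a' q * _]mulrC.
by rewrite tl (linZ lR) /R tr scalerA -signr_addb.
Qed.

Lemma transr1 z : transr 1 z = z.
Proof.
move: z; apply: lin_eq_bas => [||[a b]] //.
  apply: (lin_comp (@sweed_linear _ _ _ _ _)); exact: comulK_linear.
have -> : 1 = basf false :> U k by rewrite /basf basK !expr0 mul1r.
by rewrite transr_grp scale1r.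
Qed.

(** The vector field u as a map on A. *)
Definition del : 'End(A k) := linfun (fun a : A k =>
  \sw_(a1, a2 <- comul a) (pairA ((gam k * psi k) ⊗ (1 : U k) : UU k) a2 *: a1)).
Definition del' : 'End(A k) := linfun (fun a : A k =>
  \sw_(a1, a2 <- comul a) (pairA ((1 : U k) ⊗ (gam k * psi k) : UU k) a2 *: a1)).

Lemma inv_vfield_linear (chi : UU k) : linear (fun a : A k =>
  \sw_(a1, a2 <- comul a) (pairA chi a2 *: a1)).
Proof. by apply: (lin_comp (@sweed_linear _ _ _ _ _)); apply: sweed_linear. Qed.

Lemma del_bas (p q : idx (K k)) : del (bas p ⊗ bas q) =
  p.1%:R *: ((bas ((false, p.2) : idx (K k)) : K k) ⊗ bas q).
Proof.
rewrite linfunE; last exact: inv_vfield_linear.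
rewrite comul_tensH_bas sweed_midflip_pairAr.
rewrite -/(transr (gam k * psi k) _) -/(transr 1 _) transr1.
by case: p => a b; rewrite transr_chi (linZ (@pure_linear_l _ _ _ _)).
Qed.

Lemma del'_bas (p q : idx (K k)) : del' (bas p ⊗ bas q) =
  q.1%:R *: (bas p ⊗ (bas ((false, q.2) : idx (K k)) : K k)).
Proof.
rewrite linfunE; last exact: inv_vfield_linear.
rewrite comul_tensH_bas sweed_midflip_pairAr.
rewrite -/(transr (gam k * psi k) _) -/(transr 1 _) transr1.
by case: q => a b; rewrite transr_chi (linZ (@pure_linear_r _ _ _ _)).
Qed.

End Translations.

(** * A as a color commutative algebra *)

Section ColorCommutative.
Variable k : fieldType.

Lemma mulA_linl (x : A k) : linear (fun y : A k => y * x).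
Proof. by move=> l v w; rewrite mulrDl scalerAl. Qed.

Lemma mulA_linr (x : A k) : linear (fun y : A k => x * y).
Proof. by move=> l v w; rewrite mulrDr scalerAr. Qed.

(** Among the generators of K only x and g anticommute; the sign extends this
    to monomials, up to the relation x x = 0 which leaves the sign of x
    against x free. *)
Lemma basK_comm (p q : idx (K k)) : bas q * bas p =
  (-1) ^+ ((p.2 && q.2) (+) ((p.1 (+) p.2) && (q.1 (+) q.2))) *: (bas p * bas q : K k).
Proof.
rewrite !basM; case: p q => [a b] [c d] /=; rewrite orbC addbC.
case: a b c d => [] [] [] [] //=; rewrite ?scaler0 ?scalerA //;
by rewrite ?expr0 ?expr1 ?mulr1 ?mulrNN ?mulr1.
Qed.

Lemma basA_comm (p q : idx (A k)) :
  bas q * bas p = sgn k (dg p) (dg q) *: (bas p * bas q : A k).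
Proof.
case: p q => [p p'] [q q']; rewrite !bas_pure !pureM basK_comm (basK_comm p').
rewrite (linZ (@pure_linear_l _ _ _ _)) (linZ (@pure_linear_r _ _ _ _)) scalerA.
rewrite -signr_addb /sgn /dot /=; congr (_ ^+ _ *: _).
by do 4!case: (_ && _).
Qed.

(** The degree of a product of monomials is the sum of their degrees, unless
    the product vanishes. *)
Lemma actM_bas i (p q : idx (A k)) :
  act (grpl k i) (bas p * bas q) = sgn k i (dadd (dg p) (dg q)) *: (bas p * bas q : A k).
Proof.
have la := linZ (act_linear (grpl k i)).
case: p q => [[a b] [c d]] [[a' b'] [c' d']].
rewrite !bas_pure !pureM !basM /=.
case: ifP => [_|E]; first by rewrite (lin0 (@pure_linear_l _ _ _ _)) scaler0 (lin0 (act_linear (grpl k i))).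
case: ifP => [_|E']; first by rewrite (lin0 (@pure_linear_r _ _ _ _)) scaler0 (lin0 (act_linear (grpl k i))).
rewrite (linZ (@pure_linear_l _ _ _ _)) (linZ (@pure_linear_r _ _ _ _)) !la.
rewrite -bas_pure act_bas; set d1 := dg _; set d2 := dadd _ _.
have -> : d1 = d2.
  rewrite /d1 /d2 /dg /dadd /= {d1 d2}; move: E E' => /=.
  by case: a b c d => [] [] [] []; case: a' b' c' d' => [] [] [] [].
by rewrite !scalerA; congr (_ *: _); ring.
Qed.

Lemma actM i a b : act (grpl k i) (a * b) = act (grpl k i) a * act (grpl k i) b.
Proof.
move: a; apply: lin_eq_bas => [||p].
- by apply: (lin_comp (act_linear _)); apply: mulA_linl.
- by apply: (lin_comp (mulA_linl _)); apply: act_linear.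
move: b; apply: lin_eq_bas => [||q].
- by apply: (lin_comp (act_linear _)); apply: mulA_linr.
- by apply: (lin_comp (mulA_linr _)); apply: act_linear.
rewrite actM_bas !act_bas sgnDr.
by rewrite -scalerAl -scalerAr scalerA.
Qed.

(** Braided commutativity of A. Only one of the factors is homogeneous: the
    grouplike of its degree acts on the other factor. *)
Lemma mulA_bas (p : idx (A k)) (b : A k) :
  b * bas p = bas p * act (grpl k (dg p)) b.
Proof.
move: b; apply: lin_eq_bas => [||q].
- by move=> l v w; rewrite mulrDl scalerAl.
- by move=> l v w; rewrite act_linear mulrDr scalerAr.
by rewrite act_bas -scalerAr basA_comm.
Qed.

Lemma act_add i j a : act (grpl k i) (act (grpl k j) a) = act (grpl k (dadd i j)) a.
Proof.
move: a; apply: lin_eq_bas => [||q].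
- exact: (lin_comp (act_linear _) (act_linear _)).
- exact: act_linear.
by rewrite !act_bas (linZ (act_linear _)) act_bas scalerA sgnDl mulrC.
Qed.

Lemma act0 a : act (grpl k dzero) a = a.
Proof.
move: a; apply: lin_eq_bas => [||q] //; first exact: act_linear.
by rewrite act_bas sgn0l scale1r.
Qed.

Lemma act1 i : act (grpl k i) 1 = 1.
Proof.
have -> : 1 = bas (((false, false), (false, false)) : idx (A k)) :> A k.
  by rewrite bas_pure basK !expr0 mul1r pure1.
by rewrite act_bas /dg /= -[(_, _, _)]/dzero sgn0r scale1r.
Qed.

End ColorCommutative.

(** * Braided derivations of A *)

Section Derivations.
Variable k : fieldType.
Hypothesis char0 : [pchar k] =i pred0.
Notation gm i := (grpl k i).

Lemma mulA_scale c (x y : A k) : c *: (x * y) = (c *: x) * y.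
Proof. exact: scalerAl. Qed.

Lemma hactE_grpl i (w : 'End(A k)) a :
  hactE (gm i) w a = act (gm i) (w (act (gm i) a)).
Proof.
rewrite /hactE sweed_comul_grpl antip_grpl !comp_lfunE.
by rewrite !linfunE //; apply: act_linear.
Qed.

(** The braided Leibniz rule only has to be tested on monomials in the first
    factor, where the R-matrix collapses to one grouplike. *)
Lemma derP (w : 'End(A k)) :
  braided_derivation w <->
  forall (p : idx (A k)) (b : A k),
    w (bas p * b) = w (bas p) * b + bas p * hactE (gm (dg p)) w b.
Proof.
have E (p : idx (A k)) b : sweed (Rbar k) (fun r s => act r (bas p) * hactE s w b)
     = bas p * hactE (gm (dg p)) w b.
  apply: (sweed_Rbar_homog char0 (F := fun s => bas p * hactE s w b)) => i j.
  by rewrite act_bas -scalerAl.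
split=> [dw p b | dw a b]; first by rewrite dw E.
move: a; apply: lin_eq_bas => [l v z|l v z|p].
- by rewrite mulrDl -scalerAl linearP.
- have lS : linear (fun a => \sw_(r, s <- Rbar k) (act r a * hactE s w b)).
    apply: sweed_linear_fun => r s; exact: (lin_comp (mulA_linl _) (act_linear r)).
  by rewrite lS linearP mulrDl -scalerAl addrACA -scalerDr.
by rewrite dw E.
Qed.

(** Here the braided commutativity of A is essential: it moves the
    coefficient a past the first factor of a product. *)
Lemma der_lmul a (w : 'End(A k)) :
  braided_derivation w -> braided_derivation (amull a \o w)%VF.
Proof.
move=> /derP dw; apply/derP => p b.
rewrite hactE_grpl !comp_lfunE !lfunE /= dw mulrDr !mulrA; congr (_ + _).
by rewrite hactE_grpl actM mulA_bas !mulrA.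
Qed.

Lemma der_hact i (w : 'End(A k)) :
  braided_derivation w -> braided_derivation (hactE (gm i) w).
Proof.
move=> /derP dw; apply/derP => p b.
rewrite !hactE_grpl actM act_bas -mulA_scale linearZ /= dw scalerDr.
rewrite (linD (act_linear _)) linearZ /=; congr (_ + _).
  by rewrite !(linZ (act_linear _)) actM act_add daddii act0 mulA_scale.
rewrite (linZ (act_linear _)) actM act_bas -mulA_scale sgnKl hactE_grpl.
by rewrite !act_add daddC.
Qed.

Definition dgx : deg := ((false, false), (true, false)).
Definition dgx' : deg := ((false, false), (false, true)).

Lemma del_hact i : hactE (gm i) (del k) = sgn k i dgx *: del k.
Proof.
apply/lfunP; apply: lin_eq_bas => [||[p p']]; try exact: linearP.
rewrite scale_lfunE hactE_grpl act_bas linearZ /= (linZ (act_linear _)).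
rewrite bas_pure del_bas (linZ (act_linear _)) -bas_pure act_bas !scalerA.
case: p => [[] b] /=; last by rewrite !(mulr0, mul0r) !scale0r.
rewrite !mulr1; congr (_ *: _); rewrite /sgn -signr_addb; congr (_ ^+ nat_of_bool _).
rewrite /dot /dg /=; case: i p' => [[i1 i2] [i3 i4]] [c d] /=.
by case: b i1 i2 i3 i4 c d => [] [] [] [] [] [] [].
Qed.

Lemma del'_hact i : hactE (gm i) (del' k) = sgn k i dgx' *: del' k.
Proof.
apply/lfunP; apply: lin_eq_bas => [||[p p']]; try exact: linearP.
rewrite scale_lfunE hactE_grpl act_bas linearZ /= (linZ (act_linear _)).
rewrite bas_pure del'_bas (linZ (act_linear _)) -bas_pure act_bas !scalerA.
case: p' => [[] b] /=; last by rewrite !(mulr0, mul0r) !scale0r.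
rewrite !mulr1; congr (_ *: _); rewrite /sgn -signr_addb; congr (_ ^+ nat_of_bool _).
rewrite /dot /dg /=; case: i p => [[i1 i2] [i3 i4]] [c d] /=.
by case: b i1 i2 i3 i4 c d => [] [] [] [] [] [] [].
Qed.

(** Differentiation in x on one copy of K; the fields u and u' act by it on
    the two tensor factors. *)
Definition dK : 'End(K k) :=
  linfun (fun z : K k => \sum_(p : idx (K k)) z p *: (p.1%:R *: (bas ((false, p.2) : idx (K k)) : K k))).

Lemma dK_bas (p : idx (K k)) : dK (bas p) = p.1%:R *: bas ((false, p.2) : idx (K k)).
Proof.
rewrite linfunE; last first.
  move=> c z z'; rewrite scaler_sumr -big_split; apply: eq_bigr => q _.
  by rewrite !ffunE scalerDl [in RHS]scalerA.
rewrite (bigD1 p) //= ffunE eqxx scale1r big1 ?addr0 // => q /negPf np.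
by rewrite ffunE np scale0r.
Qed.

Lemma dK_leibniz (p q : idx (K k)) : dK (bas p * bas q) =
  dK (bas p) * bas q + (-1) ^+ (p.1 (+) p.2) *: (bas p * dK (bas q)).
Proof.
rewrite !dK_bas basM -scalerAl -scalerAr !basM.
case: p q => [[] b] [[] d] /=;
  rewrite ?linear0 ?linearZ /= ?dK_bas /= ?(scale0r, scale1r, scaler0, addr0, add0r, expr0) //.
all: try by case: b => /=; rewrite ?andbF ?andbT ?expr0 ?expr1 ?scale1r ?addrN ?addNr ?scaleN1r ?opprK ?subrr ?addNr.
Qed.

Lemma del_pure (b c : K k) : del k (b ⊗ c) = dK b ⊗ c.
Proof.
move: b; apply: lin_eq_bas => [||p].
- by apply: (lin_comp (@linearP _ _ _ _ (del k))); apply: pure_linear_l.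
- by apply: (lin_comp (@pure_linear_l _ _ _ _)); apply: linearP.
move: c; apply: lin_eq_bas => [||q].
- by apply: (lin_comp (@linearP _ _ _ _ (del k))); apply: pure_linear_r.
- exact: pure_linear_r.
by rewrite del_bas dK_bas (linZ (@pure_linear_l _ _ _ _)).
Qed.

Lemma del'_pure (b c : K k) : del' k (b ⊗ c) = b ⊗ dK c.
Proof.
move: b; apply: lin_eq_bas => [||p].
- by apply: (lin_comp (@linearP _ _ _ _ (del' k))); apply: pure_linear_l.
- exact: pure_linear_l.
move: c; apply: lin_eq_bas => [||q].
- by apply: (lin_comp (@linearP _ _ _ _ (del' k))); apply: pure_linear_r.
- by apply: (lin_comp (@pure_linear_r _ _ _ _)); apply: linearP.
by rewrite del'_bas dK_bas (linZ (@pure_linear_r _ _ _ _)).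
Qed.

Lemma der_del : braided_derivation (del k).
Proof.
apply/derP => p; apply: lin_eq_bas => [||q].
- by apply: (lin_comp (@linearP _ _ _ _ (del k))); apply: mulA_linr.
- apply: lin_add; first exact: mulA_linr.
  by apply: (lin_comp (mulA_linr _)); apply: linearP.
rewrite del_hact scale_lfunE -scalerAr; case: p q => [p p'] [q q'].
rewrite !bas_pure !pureM !del_pure dK_leibniz (linD (@pure_linear_l _ _ _ _)).
rewrite (linZ (@pure_linear_l _ _ _ _)) !pureM; congr (_ + _ *: _).
by rewrite /sgn /dot /= !andbF /= andbT addbF.
Qed.

Lemma der_del' : braided_derivation (del' k).
Proof.
apply/derP => p; apply: lin_eq_bas => [||q].
- by apply: (lin_comp (@linearP _ _ _ _ (del' k))); apply: mulA_linr.
- apply: lin_add; first exact: mulA_linr.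
  by apply: (lin_comp (mulA_linr _)); apply: linearP.
rewrite del'_hact scale_lfunE -scalerAr; case: p q => [p p'] [q q'].
rewrite !bas_pure !pureM !del'_pure dK_leibniz (linD (@pure_linear_r _ _ _ _)).
rewrite (linZ (@pure_linear_r _ _ _ _)) !pureM; congr (_ + _ *: _).
by rewrite /sgn /dot /= !andbF /= andbT.
Qed.

End Derivations.

(** * Symmetric bimodules over A *)

(** The laws shared by A, X, Omega and their tensor products over A. In
    rmul_bas the right action is the left action precomposed with the
    braiding, which makes the bimodule symmetric, and the axioms only mention
    the grouplikes because the R-matrix only involves them. *)
Record lawful (k : fieldType) (M : bimod k) : Prop := Lawful {
  lmul_linl : forall m : M, linear (fun a => lmul a m);
  lmul_linr : forall a, linear (lmul (b := M) a);
  rmul_linr : forall m : M, linear (rmul m);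
  lmulA : forall a b (m : M), lmul a (lmul b m) = lmul (a * b) m;
  lmul1 : forall m : M, lmul 1 m = m;
  hact_lin : forall i, linear (hact (b := M) (grpl k i));
  hact_add : forall i j (m : M),
    hact (grpl k i) (hact (grpl k j) m) = hact (grpl k (dadd i j)) m;
  hact0 : forall m : M, hact (grpl k dzero) m = m;
  hact_lmul : forall i a (m : M),
    hact (grpl k i) (lmul a m) = lmul (act (grpl k i) a) (hact (grpl k i) m);
  rmul_bas : forall (m : M) (p : idx (A k)),
    rmul m (bas p) = lmul (bas p : A k) (hact (grpl k (dg p)) m) }.

Section Lawful.
Variables (k : fieldType).
Hypothesis char0 : [pchar k] =i pred0.
Notation gm i := (grpl k i).

Section OneBimodule.
Variable M : bimod k.
Hypothesis lM : lawful M.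

Lemma lmulZl c a (m : M) : lmul (c *: a) m = c *: lmul a m.
Proof. exact: (linZ (lmul_linl lM m)). Qed.

Lemma lmulZr c a (m : M) : lmul a (c *: m) = c *: lmul a m.
Proof. exact: (linZ (lmul_linr lM a)). Qed.

Lemma rmulZr c a (m : M) : rmul m (c *: a) = c *: rmul m a.
Proof. exact: (linZ (rmul_linr lM m)). Qed.

Lemma hactZ i c (m : M) : hact (gm i) (c *: m) = c *: hact (gm i) m.
Proof. exact: (linZ (hact_lin lM i)). Qed.

Definition homog (p : deg) (m : M) := forall i, hact (gm i) m = sgn k i p *: m.

Lemma hact_invol i (m : M) : hact (gm i) (hact (gm i) m) = m.
Proof. by rewrite (hact_add lM) daddii (hact0 lM). Qed.

(** The component of degree p, as a Fourier coefficient for the action of the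
    grouplikes. *)
Definition homproj (p : deg) (m : M) : M :=
  16^-1 *: \sum_i sgn k i p *: hact (gm i) m.

Lemma homog_homproj p m : homog p (homproj p m).
Proof.
move=> i; have lh := hact_lin lM i; rewrite (linZ lh) scalerA mulrC -scalerA.
congr (_ *: _); rewrite (lin_sum lh) scaler_sumr.
rewrite (reindex_inj (inv_inj (daddKl i))) /=; apply: eq_bigr => j _.
by rewrite (linZ lh) (hact_add lM) daddKl sgnDl scalerA.
Qed.

Lemma sum_homproj m : \sum_p homproj p m = m.
Proof.
have S i : \sum_p sgn k i p *: hact (gm i) m =
    (16 * (i == dzero)%:R) *: hact (gm i) m.
  rewrite -sgn_ortho scaler_suml; apply: eq_bigr => p _.
  by rewrite sgn0r mulr1 sgnC.
rewrite -scaler_sumr exchange_big /= (eq_bigr _ (fun i _ => S i)).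
rewrite (bigD1 dzero) //= mulr1 (hact0 lM) big1 => [|i /negPf ni]; last first.
  by rewrite ni mulr0 scale0r.
rewrite addr0 scalerA mulVf ?scale1r //.
by have /pcharf0P -> := char0.
Qed.

(** Every vector is the sum of its sixteen homogeneous components. *)
Lemma lin_eq_homog (V : lmodType k) (f g : M -> V) :
  linear f -> linear g -> (forall p m, homog p m -> f m = g m) -> f =1 g.
Proof.
move=> lf lg fg m; rewrite -(sum_homproj m) (lin_sum lf) (lin_sum lg).
by apply: eq_bigr => p _; apply: (fg p); apply: homog_homproj.
Qed.

Lemma rmul_linl a : linear (fun m : M => rmul m a).
Proof.
move=> c m m'; move: a; apply: lin_eq_bas => [||p].
- exact: (rmul_linr lM).
- by apply: lin_add; [apply: lin_scale|]; apply: (rmul_linr lM).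
by rewrite !(rmul_bas lM) hact_lin // lmul_linr.
Qed.

Lemma rmulZl c a (m : M) : rmul (c *: m) a = c *: rmul m a.
Proof. exact: (linZ (rmul_linl a)). Qed.

Lemma rmulE (m : M) a :
  rmul m a = \sw_(r, s <- Rbar k) lmul (act r a) (hact s m).
Proof.
move: a; apply: lin_eq_bas => [||p].
- exact: (rmul_linr lM).
- apply: sweed_linear_fun => r s; exact: (lin_comp (lmul_linl lM _) (act_linear r)).
rewrite (rmul_bas lM); apply/esym.
apply: (sweed_Rbar_homog char0 (F := fun s => lmul _ (hact s m))) => i j.
by rewrite act_bas lmulZl.
Qed.

(** The same as rmul_bas for an arbitrary scalar of degree p, for instance a
    product of two monomials. *)
Lemma rmul_homog p a (m : M) : (forall i, act (gm i) a = sgn k i p *: a) ->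
  rmul m a = lmul a (hact (gm p) m).
Proof.
move=> ha; rewrite rmulE.
apply: (sweed_Rbar_homog char0 (F := fun s => lmul _ (hact s m))) => i j.
by rewrite ha lmulZl.
Qed.

Lemma lmul_rmul a b (m : M) : lmul a (rmul m b) = rmul (lmul a m) b.
Proof.
move: b; apply: lin_eq_bas => [||p].
- apply: (lin_comp (lmul_linr lM _)); exact: (rmul_linr lM).
- exact: (rmul_linr lM).
by rewrite !(rmul_bas lM) (hact_lmul lM) !(lmulA lM) mulA_bas.
Qed.

Lemma rmulA (m : M) a b : rmul (rmul m a) b = rmul m (a * b).
Proof.
move: a; apply: lin_eq_bas => [||p].
- apply: (lin_comp (rmul_linl b)); exact: (rmul_linr lM).
- apply: (lin_comp (rmul_linr lM _)); exact: mulA_linl.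
move: b; apply: lin_eq_bas => [||q].
- exact: (rmul_linr lM).
- apply: (lin_comp (rmul_linr lM _)); exact: mulA_linr.
rewrite (@rmul_homog (dadd (dg p) (dg q)) (bas p * bas q)); last first.
  by move=> i; rewrite actM !act_bas -scalerAl -scalerAr scalerA sgnDr.
rewrite !(rmul_bas lM) (hact_lmul lM) (lmulA lM) -(mulA_bas q (bas p)) (hact_add lM).
by rewrite daddC.
Qed.

Lemma rmul1 (m : M) : rmul m 1 = m.
Proof. by rewrite (@rmul_homog dzero) ?(hact0 lM) ?(lmul1 lM) // => i; rewrite act1 sgn0r scale1r. Qed.

Lemma hact_rmul i (m : M) a :
  hact (gm i) (rmul m a) = rmul (hact (gm i) m) (act (gm i) a).
Proof.
move: a; apply: lin_eq_bas => [||p].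
- apply: (lin_comp (hact_lin lM _)); exact: (rmul_linr lM).
- apply: (lin_comp (rmul_linr lM _)); exact: act_linear.
rewrite act_bas rmulZr !(rmul_bas lM) (hact_lmul lM) act_bas.
rewrite lmulZl !(hact_add lM).
by rewrite (daddC (dg p)).
Qed.

Lemma homog_lmul p (q : idx (A k)) (m : M) :
  homog p m -> homog (dadd (dg q) p) (lmul (bas q : A k) m).
Proof.
move=> hm i; rewrite (hact_lmul lM) act_bas hm lmulZl.
by rewrite lmulZr scalerA sgnDr.
Qed.

Lemma homog_rmul p (q : idx (A k)) (m : M) :
  homog p m -> homog (dadd p (dg q)) (rmul m (bas q)).
Proof.
move=> hm i; rewrite hact_rmul // act_bas hm rmulZl.
by rewrite rmulZr scalerA sgnDr.
Qed.

(** The counterpart of rmul_homog for a homogeneous vector and an arbitrary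
    scalar. *)
Lemma lmul_homog p (m : M) a : homog p m -> lmul a m = rmul m (act (gm p) a).
Proof.
move=> hm; move: a; apply: lin_eq_bas => [||q].
- exact: lmul_linl.
- apply: (lin_comp (rmul_linr lM _)); exact: act_linear.
rewrite act_bas rmulZr (rmul_bas lM) hm lmulZr.
by rewrite sgnC sgnKl.
Qed.

Lemma rmul_homogl p (m : M) a : homog p m -> rmul m a = lmul (act (gm p) a) m.
Proof. by move=> hm; rewrite (lmul_homog _ hm) act_add daddii act0. Qed.

End OneBimodule.

(** * Tensor products over A *)

Section TensorInduction.
Variables M N : bimod k.

Lemma apure_linear_l (n : N) : linear (fun m : M => apure m n).
Proof.
apply: (lin_comp (@linearP _ _ _ _ _)).
by apply: (lin_comp (@linearP _ _ _ _ _)); apply: kpure_linear_l.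
Qed.

Lemma apure_linear_r (m : M) : linear (fun n : N => apure m n).
Proof.
apply: (lin_comp (@linearP _ _ _ _ _)).
by apply: (lin_comp (@linearP _ _ _ _ _)); apply: kpure_linear_r.
Qed.

(** A tensor over A is represented in a complement of the balancing
    relations, hence it is the projection of a combination of pure tensors of
    basis vectors. *)
Lemma lin_eq_apure (V : lmodType k) (f g : atens M N -> V) :
  linear f -> linear g ->
  (forall m n, f (apure m n) = g (apure m n)) -> f =1 g.
Proof.
move=> lf lg fg z.
pose P (y : 'M[k]_(\dim {:M}, \dim {:N})) : atens M N :=
  vsproj ((balancing M N)^C) (daddv_pi ((balancing M N)^C) (balancing M N) y).
have lP : linear P.
  by apply: (lin_comp (@linearP _ _ _ _ _)); apply: linearP.
have zP : z = P (vsval z).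
  rewrite /P daddv_pi_id ?vsvalK ?subvsP //.
  by rewrite capvC capv_compl.
have PE y : P y = \sum_i \sum_j y i j *: apure (vbasis {:M})`_i (vbasis {:N})`_j.
  rewrite {1}(matrix_sum_delta y) (lin_sum lP); apply: eq_bigr => i _.
  rewrite (lin_sum lP); apply: eq_bigr => j _; rewrite (linZ lP); congr (_ *: _).
  rewrite /apure -/(P _); congr (P _); apply/matrixP=> i' j'.
  rewrite !mxE !coord_free ?(basis_free (vbasisP _)) // -natrM mulnb.
  by rewrite (eq_sym i) (eq_sym j).
suff: f (P (vsval z)) = g (P (vsval z)) by rewrite -zP.
rewrite PE (lin_sum lf) (lin_sum lg); apply: eq_bigr => i _.
rewrite (lin_sum lf) (lin_sum lg); apply: eq_bigr => j _.
by rewrite (linZ lf) (linZ lg) fg.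
Qed.

Lemma alift_linear (V : lmodType k) (f : M -> N -> V) :
  linear (alift f : atens M N -> V).
Proof. by apply: (lin_comp (@kext_linear _ _ _ _ f)); apply: linearP. Qed.

Lemma alift_ext (V : lmodType k) (f g : M -> N -> V) (z : atens M N) :
  f =2 g -> alift f z = alift g z.
Proof.
by move=> fg; apply: eq_bigr => i _; apply: eq_bigr => j _; rewrite fg.
Qed.

End TensorInduction.

Section TensorLaws.
Variables M N : bimod k.
Hypotheses (lM : lawful M) (lN : lawful N).

Lemma apure_bal (m : M) a (n : N) : apure (rmul m a) n = apure m (lmul a n).
Proof.
apply: apure_balanced.
- exact: rmul_linr.
- exact: rmul_linl.
- exact: lmul_linr.
- exact: lmul_linl.
Qed.

Lemma lmul_apure a (m : M) (n : N) :
  lmul a (apure m n : atens M N) = apure (lmul a m) n.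
Proof.
apply: (@alift_pure _ _ _ _ (fun m n => apure (lmul a m) n)) => [m'|n'|m' b n'].
- exact: apure_linear_r.
- by apply: (lin_comp (apure_linear_l _)); apply: lmul_linr.
- by rewrite (lmul_rmul lM) apure_bal.
Qed.

Lemma rmul_apure a (m : M) (n : N) :
  rmul (apure m n : atens M N) a = apure m (rmul n a).
Proof.
apply: (@alift_pure _ _ _ _ (fun m n => apure m (rmul n a))) => [m'|n'|m' b n'].
- by apply: (lin_comp (apure_linear_r _)); apply: rmul_linl.
- exact: apure_linear_l.
- by rewrite apure_bal (lmul_rmul lN).
Qed.

Lemma hact_apure i (m : M) (n : N) :
  hact (gm i) (apure m n : atens M N) = apure (hact (gm i) m) (hact (gm i) n).
Proof.
have -> : hact (gm i) (apure m n : atens M N) =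
    alift (fun m n => apure (hact (gm i) m) (hact (gm i) n)) (apure m n).
  apply: alift_ext => m' n'.
  exact: (sweed_comul_grpl i (fun h1 h2 => apure (hact h1 m') (hact h2 n'))).
apply: (@alift_pure _ _ _ _ (fun m n => apure (hact (gm i) m) (hact (gm i) n))) => [m'|n'|m' b n'].
- by apply: (lin_comp (apure_linear_r _)); apply: hact_lin.
- by apply: (lin_comp (apure_linear_l _)); apply: hact_lin.
- by rewrite (hact_rmul lM) (hact_lmul lN) apure_bal.
Qed.

(** All laws are checked on pure tensors; the right action, which only sees
    the second leg, becomes a left action on the first leg by balancedness. *)
Lemma atens_lawful : lawful (atens M N).
Proof.
split.
- move=> z c a b; move: z; apply: lin_eq_apure => [||m n].
  + exact: alift_linear.
  + by apply: lin_add; [apply: lin_scale|]; apply: alift_linear.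
  by rewrite !lmul_apure (lmul_linl lM) apure_linear_l.
- move=> a; exact: alift_linear.
- move=> z c a b; move: z; apply: lin_eq_apure => [||m n].
  + exact: alift_linear.
  + by apply: lin_add; [apply: lin_scale|]; apply: alift_linear.
  by rewrite !rmul_apure (rmul_linr lN) apure_linear_r.
- move=> a b; apply: lin_eq_apure => [||m n].
  + by apply: lin_comp; apply: alift_linear.
  + exact: alift_linear.
  by rewrite !lmul_apure (lmulA lM).
- apply: lin_eq_apure => [||m n] //; first exact: alift_linear.
  by rewrite lmul_apure (lmul1 lM).
- move=> i; exact: alift_linear.
- move=> i j; apply: lin_eq_apure => [||m n].
  + by apply: lin_comp; apply: alift_linear.
  + exact: alift_linear.
  by rewrite !hact_apure (hact_add lM) (hact_add lN).
- apply: lin_eq_apure => [||m n] //; first exact: alift_linear.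
  by rewrite hact_apure (hact0 lM) (hact0 lN).
- move=> i a; apply: lin_eq_apure => [||m n].
  + by apply: lin_comp; apply: alift_linear.
  + by apply: lin_comp; apply: alift_linear.
  by rewrite lmul_apure !hact_apure lmul_apure (hact_lmul lM).
- move=> z p; move: z; apply: lin_eq_apure => [||m n].
  + exact: alift_linear.
  + by apply: lin_comp; apply: alift_linear.
  rewrite rmul_apure hact_apure lmul_apure (rmul_bas lN) -apure_bal.
  by rewrite (rmul_bas lM).
Qed.

End TensorLaws.
End Lawful.

(** * The symmetry of the tensor product *)

Section Braiding.
Variables (k : fieldType).
Hypothesis char0 : [pchar k] =i pred0.
Notation gm i := (grpl k i).

Lemma alift_linear_fun (M N : bimod k) (W V : lmodType k) (f : W -> M -> N -> V)
    (z : atens M N) :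
  (forall m n, linear (fun w => f w m n)) -> linear (fun w => alift (f w) z).
Proof.
move=> lf c w w'; rewrite /alift /kext scaler_sumr -big_split.
apply: eq_bigr => i _; rewrite scaler_sumr -big_split; apply: eq_bigr => j _ /=.
by rewrite lf scalerDr !scalerA mulrC.
Qed.

Lemma lin_bigsum (V W : lmodType k) (I : finType) (f : I -> V -> W) :
  (forall i, linear (f i)) -> linear (fun v => \sum_i f i v).
Proof.
move=> lf c v w; rewrite scaler_sumr -big_split; apply: eq_bigr => i _.
by rewrite lf.
Qed.

(** Linearity is needed only for the grouplikes in the legs: nothing is known
    about the action of other elements of H on an abstract bimodule. *)
Lemma lin_sweed_Rbar (V W : lmodType k) (f : V -> H k -> H k -> W) :
  (forall i j, linear (fun v => f v (gm i) (gm j))) ->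
  linear (fun v => sweed (Rbar k) (f v)).
Proof.
move=> lf; have E v := sweed_Rbar char0 (f v).
move=> c v w; rewrite !E; move: c v w.
apply: lin_scale; apply: lin_bigsum => i; apply: lin_bigsum => j.
exact: lin_scale.
Qed.

Section Tau.
Variables M N : bimod k.
Hypotheses (lM : lawful M) (lN : lawful N).

Let tauf (m : M) (n : N) : atens N M :=
  \sw_(r, s <- Rbar k) apure (hact r n) (hact s m).

Let tauf_hom p (m : M) (n : N) : homog p n -> tauf m n = apure n (hact (gm p) m).
Proof.
move=> hn; apply: (sweed_Rbar_homog char0 (F := fun s => apure n (hact s m))) => i j.
by rewrite hn (linZ (apure_linear_l _)).
Qed.

Let tauf_linear_l n : linear (fun m => tauf m n).
Proof.
apply: lin_sweed_Rbar => i j.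
by apply: (lin_comp (apure_linear_r _)); apply: hact_lin.
Qed.

Let tauf_linear_r m : linear (tauf m).
Proof.
apply: lin_sweed_Rbar => i j.
by apply: (lin_comp (apure_linear_l _)); apply: hact_lin.
Qed.

Let tauf_balanced m a n : tauf (rmul m a) n = tauf m (lmul a n).
Proof.
move: a; apply: lin_eq_bas => [||q].
- by apply: (lin_comp (tauf_linear_l _)); apply: rmul_linr.
- by apply: (lin_comp (tauf_linear_r _)); apply: lmul_linl.
move: n; apply: (lin_eq_homog char0 lN) => [||p n hn].
- exact: tauf_linear_r.
- by apply: (lin_comp (tauf_linear_r _)); apply: lmul_linr.
rewrite (tauf_hom _ hn) (tauf_hom _ (homog_lmul lN q hn)).
rewrite (hact_rmul lM) act_bas (rmulZr lM) (rmul_bas lM) (hact_add lM).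
rewrite (linZ (apure_linear_r _)) -(apure_bal lN lM) (rmul_bas lN) hn (lmulZr lN).
by rewrite (linZ (apure_linear_l _)) sgnC sgnKl.
Qed.

(** The braiding of a tensor with a homogeneous second leg. Balancedness of
    the braiding follows from the bicharacter property of sgn. *)
Lemma tau_apure p (m : M) (n : N) :
  homog p n -> tau (apure m n : atens M N) = apure n (hact (gm p) m) :> atens N M.
Proof.
move=> hn; rewrite -(tauf_hom _ hn).
apply: (@alift_pure _ _ _ _ tauf) => *.
- exact: tauf_linear_r.
- exact: tauf_linear_l.
- exact: tauf_balanced.
Qed.

Lemma tau_linear : linear (@tau k M N).
Proof. exact: alift_linear. Qed.

Lemma tau_lmul a (z : atens M N) : tau (lmul a z) = lmul a (tau z).
Proof.
move: z; apply: lin_eq_apure => [||m n].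
- by apply: (lin_comp tau_linear); apply: alift_linear.
- by apply: lin_comp; apply: alift_linear.
move: n; apply: (lin_eq_homog char0 lN) => [||p n hn].
- by apply: (lin_comp tau_linear); apply: (lin_comp (@alift_linear _ _ _ _ _)); apply: apure_linear_r.
- by apply: (lin_comp (@alift_linear _ _ _ _ _)); apply: (lin_comp tau_linear); apply: apure_linear_r.
rewrite (lmul_apure lM lN) !(tau_apure _ hn) (lmul_apure lN lM).
move: a; apply: lin_eq_bas => [||q].
- apply: (lin_comp (apure_linear_r _)); apply: (lin_comp (hact_lin lM _)).
  exact: lmul_linl.
- by apply: (lin_comp (apure_linear_l _)); apply: lmul_linl.
rewrite (hact_lmul lM) act_bas (lmulZl lM) (linZ (apure_linear_r _)).
rewrite -(apure_bal lN lM) (rmul_bas lN) hn (lmulZr lN).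
by rewrite (linZ (apure_linear_l _)) sgnC sgnKl.
Qed.

Lemma tau_rmul a (z : atens M N) : tau (rmul z a) = rmul (tau z) a.
Proof.
move: z; apply: lin_eq_apure => [||m n].
- by apply: (lin_comp tau_linear); apply: alift_linear.
- by apply: lin_comp; apply: alift_linear.
move: n; apply: (lin_eq_homog char0 lN) => [||p n hn].
- by apply: (lin_comp tau_linear); apply: (lin_comp (@alift_linear _ _ _ _ _)); apply: apure_linear_r.
- by apply: (lin_comp (@alift_linear _ _ _ _ _)); apply: (lin_comp tau_linear); apply: apure_linear_r.
rewrite (rmul_apure lM lN) (tau_apure _ hn) (rmul_apure lN lM).
move: a; apply: lin_eq_bas => [||q].
- apply: (lin_comp tau_linear); apply: (lin_comp (apure_linear_r _)).
  exact: rmul_linr.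
- by apply: (lin_comp (apure_linear_r _)); apply: rmul_linr.
rewrite (tau_apure _ (homog_rmul lN q hn)) (apure_bal lN lM) (rmul_bas lM).
by rewrite (hact_add lM) daddC.
Qed.

End Tau.

Section Assoc.
Variables M N P : bimod k.
Hypotheses (lM : lawful M) (lN : lawful N) (lP : lawful P).

Let assocf (m : M) (n : N) (p : P) : atens (atens M N) P :=
  apure (apure m n : atens M N) p.

Let assoc_in (m : M) (n : N) (p : P) :
  alift (fun n p => assocf m n p) (apure n p : atens N P) = assocf m n p.
Proof.
apply: (@alift_pure _ _ _ _ (fun n p => assocf m n p)) => [n'|p'|n' a p'].
- exact: apure_linear_r.
- by apply: (lin_comp (apure_linear_l _)); apply: apure_linear_r.
- by rewrite /assocf -(rmul_apure lM lN) (apure_bal (atens_lawful lM lN) lP).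
Qed.

Lemma assoc_apure (m : M) (n : N) (p : P) :
  assoc (apure m (apure n p : atens N P) : atens M (atens N P)) =
  apure (apure m n : atens M N) p.
Proof.
have ll (z : atens N P) : linear (fun m => alift (fun n p => assocf m n p) z).
  apply: alift_linear_fun => n' p'.
  by apply: (lin_comp (apure_linear_l _)); apply: apure_linear_l.
rewrite -[RHS]assoc_in.
apply: (@alift_pure _ _ _ _ (fun m (z : atens N P) => alift (fun n p => assocf m n p) z))
  => [m'|z'|m' a].
- exact: alift_linear.
- exact: ll.
apply: lin_eq_apure => [||n' p'].
- exact: alift_linear.
- by apply: (lin_comp (@alift_linear _ _ _ _ _)); apply: alift_linear.
by rewrite (lmul_apure lN lP) !assoc_in /assocf (apure_bal lM lN).
Qed.

Lemma assoc_linear : linear (@assoc k M N P).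
Proof. exact: alift_linear. Qed.

Lemma assoc_rmul a (z : atens M (atens N P)) : assoc (rmul z a) = rmul (assoc z) a.
Proof.
move: z; apply: lin_eq_apure => [||m].
- by apply: (lin_comp assoc_linear); apply: alift_linear.
- by apply: lin_comp; apply: alift_linear.
apply: lin_eq_apure => [||n p].
- apply: (lin_comp assoc_linear); apply: (lin_comp (@alift_linear _ _ _ _ _)).
  exact: apure_linear_r.
- by apply: lin_comp; [apply: alift_linear | apply: (lin_comp assoc_linear); apply: apure_linear_r].
rewrite (rmul_apure lM (atens_lawful lN lP)) (rmul_apure lN lP) !assoc_apure.
by rewrite (rmul_apure (atens_lawful lM lN) lP).
Qed.

End Assoc.

Section Tau23.
Variables M N P : bimod k.
Hypotheses (lM : lawful M) (lN : lawful N) (lP : lawful P).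

Let tauf (m : M) (n : N) (p : P) : atens (atens M P) N :=
  assoc (apure m (tau (apure n p : atens N P)) : atens M (atens P N)).

Let tauf_linear_m n p : linear (fun m => tauf m n p).
Proof.
by apply: (lin_comp (@assoc_linear _ _ _)); apply: apure_linear_l.
Qed.

Let tauf_linear_n m p : linear (fun n => tauf m n p).
Proof.
apply: (lin_comp (@assoc_linear _ _ _)); apply: (lin_comp (apure_linear_r _)).
by apply: (lin_comp (@tau_linear _ _)); apply: apure_linear_l.
Qed.

Let tauf_linear_p m n : linear (fun p => tauf m n p).
Proof.
apply: (lin_comp (@assoc_linear _ _ _)); apply: (lin_comp (apure_linear_r _)).
by apply: (lin_comp (@tau_linear _ _)); apply: apure_linear_r.
Qed.

Let tau_in (m : M) (n : N) (p : P) :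
  alift (fun m n => tauf m n p) (apure m n : atens M N) = tauf m n p.
Proof.
apply: (@alift_pure _ _ _ _ (fun m n => tauf m n p)) => [m'|n'|m' a n'] //.
rewrite /tauf -(lmul_apure lN lP) (tau_lmul lN lP).
by rewrite (apure_bal lM (atens_lawful lP lN)).
Qed.

Lemma tau23_linear : linear (@tau23 k M N P).
Proof. exact: alift_linear. Qed.

Lemma tau23_apure d (m : M) (n : N) (p : P) : homog d p ->
  tau23 (apure (apure m n : atens M N) p : atens (atens M N) P) =
  apure (apure m p : atens M P) (hact (gm d) n).
Proof.
move=> hp.
transitivity (tauf m n p); last first.
  by rewrite /tauf (tau_apure lN lP _ hp) (assoc_apure lM lP lN).
rewrite -tau_in.
apply: (@alift_pure _ _ _ _ (fun (y : atens M N) p => alift (fun m n => tauf m n p) y))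
  => [y'|p'|y' a p'].
- by apply: alift_linear_fun => m' n'.
- exact: alift_linear.
move: y'; apply: lin_eq_apure => [||m' n'].
- by apply: (lin_comp (@alift_linear _ _ _ _ _)); apply: alift_linear.
- exact: alift_linear.
by rewrite (rmul_apure lM lN) !tau_in /tauf (apure_bal lN lP).
Qed.

Lemma tau23_rmul a (z : atens (atens M N) P) : tau23 (rmul z a) = rmul (tau23 z) a.
Proof.
have E (m : M) (n : N) (p : P) :
    tau23 (apure (apure m n : atens M N) p : atens (atens M N) P) = tauf m n p.
  move: p; apply: (lin_eq_homog char0 lP) => [||d p hp].
  - by apply: (lin_comp tau23_linear); apply: apure_linear_r.
  - exact: tauf_linear_p.
  by rewrite (tau23_apure _ _ hp) /tauf (tau_apure lN lP _ hp) (assoc_apure lM lP lN).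
move: z; apply: lin_eq_apure => [||y p].
- by apply: (lin_comp tau23_linear); apply: alift_linear.
- by apply: lin_comp; [apply: alift_linear | apply: tau23_linear].
move: y; apply: lin_eq_apure => [||m n].
- apply: (lin_comp tau23_linear); apply: (lin_comp (@alift_linear _ _ _ _ _)).
  exact: apure_linear_l.
- apply: lin_comp; first exact: alift_linear.
  by apply: (lin_comp tau23_linear); apply: apure_linear_l.
rewrite (rmul_apure (atens_lawful lM lN) lP) !E /tauf -(rmul_apure lN lP).
rewrite (tau_rmul lN lP) -(rmul_apure lM (atens_lawful lP lN)).
by rewrite (assoc_rmul lM lP lN).
Qed.

End Tau23.
End Braiding.

(** * Vector fields and one-forms of A *)

Section Dual.
Variables (k : fieldType).
Hypothesis char0 : [pchar k] =i pred0.
Notation gm i := (grpl k i).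
(* The argument for one-forms, for any space O of functionals on X that are
   separated by evaluation. *)
Variables (X : bimod k) (O : vectType k) (ev : X -> O -> A k).
Variables (ol : A k -> O -> O) (omr : O -> A k -> O) (oa : H k -> O -> O).
Hypothesis lX : lawful X.
Hypothesis ext : forall th eta, (forall w, ev w th = ev w eta) -> th = eta.
Hypothesis ev_linear_l : forall th, linear (ev^~ th).
Hypothesis ev_linear_r : forall w, linear (ev w).
Hypothesis ev_lmul : forall a w th, ev (lmul a w) th = a * ev w th.
Hypothesis ev_ol : forall a w th, ev w (ol a th) = ev (rmul w a) th.
Hypothesis ev_or : forall a w th, ev w (omr th a) = ev w th * a.
Hypothesis ev_oa : forall i w th,
  ev w (oa (gm i) th) = act (gm i) (ev (hact (gm i) w) th).

Lemma dual_lawful : lawful (Bimod ol omr oa).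
Proof.
split=> /=.
- move=> th c a b; apply: ext => w; rewrite ev_linear_r !ev_ol (rmul_linr lX).
  exact: ev_linear_l.
- by move=> a c th eta; apply: ext => w; rewrite ev_linear_r !ev_ol ev_linear_r.
- by move=> th c a b; apply: ext => w; rewrite ev_linear_r !ev_or mulA_linr.
- by move=> a b th; apply: ext => w; rewrite !ev_ol (rmulA char0 lX).
- by move=> th; apply: ext => w; rewrite ev_ol (rmul1 char0 lX).
- move=> i c th eta; apply: ext => w.
  by rewrite ev_linear_r !ev_oa ev_linear_r act_linear.
- move=> i j th; apply: ext => w.
  by rewrite !ev_oa (act_add i j) (hact_add lX) (daddC j).
- by move=> th; apply: ext => w; rewrite ev_oa act0 (hact0 lX).
- move=> i a th; apply: ext => w.
  rewrite ev_oa !ev_ol ev_oa (hact_rmul lX).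
  by rewrite act_add daddii act0.
- move=> th p; apply: ext => w.
  rewrite ev_or ev_ol (rmul_bas lX) ev_lmul ev_oa mulA_bas.
  by rewrite (hact_invol lX).
Qed.

End Dual.

Section Fields.
Variables (k : fieldType).
Hypothesis char0 : [pchar k] =i pred0.
Notation gm i := (grpl k i).

Lemma vsval_mkvf (w : 'End(A k)) : braided_derivation w -> vsval (mkvf w) = w.
Proof. by move=> dw; rewrite vsprojK //; apply/vfieldsP. Qed.

Lemma vf_der (w : vf k) : braided_derivation (vsval w).
Proof. by apply/vfieldsP; apply: subvsP. Qed.

Lemma vf_ext (w v : vf k) : (forall a, vapp w a = vapp v a) -> w = v.
Proof. by move=> wv; apply: val_inj; apply/lfunP. Qed.

Lemma vapp_linear_l a : linear (fun w : vf k => vapp w a).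
Proof. by move=> c w v; rewrite /vapp linearP add_lfunE scale_lfunE. Qed.

Lemma vapp_linear_r (w : vf k) : linear (vapp w).
Proof. exact: linearP. Qed.

Lemma vapp_lmul a (w : vf k) b : vapp (vf_lmul a w) b = a * vapp w b.
Proof.
rewrite /vapp vsval_mkvf ?comp_lfunE ?lfunE //.
by apply: (der_lmul char0); apply: vf_der.
Qed.

Lemma vapp_act i (w : vf k) b :
  vapp (vf_act (gm i) w) b = act (gm i) (vapp w (act (gm i) b)).
Proof.
rewrite /vapp vsval_mkvf ?hactE_grpl //.
by apply: (der_hact char0); apply: vf_der.
Qed.

Lemma vapp_der (w : vf k) (p : idx (A k)) b :
  vapp w (bas p * b) = vapp w (bas p) * b + bas p * vapp (vf_act (gm (dg p)) w) b.
Proof.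
rewrite vapp_act /vapp; have /(derP char0) -> := vf_der w.
by rewrite hactE_grpl.
Qed.

Lemma vf_act_add i j (w : vf k) :
  vf_act (gm i) (vf_act (gm j) w) = vf_act (gm (dadd i j)) w.
Proof.
apply: vf_ext => a; apply: etrans (esym (vapp_act (dadd i j) w a)).
by rewrite (vapp_act i _ a) (vapp_act j _ _) (act_add i j) (act_add j i) (daddC j).
Qed.

Lemma X_lawful : lawful (X k).
Proof.
split.
- exact: vf_lmul_linear_l.
- exact: vf_lmul_linear_r.
- move=> w; apply: sweed_linear_fun => r s.
  exact: (lin_comp (vf_lmul_linear_l _) (act_linear r)).
- by move=> a b w; apply: vf_ext => c; rewrite !vapp_lmul mulrA.
- by move=> w; apply: vf_ext => c; rewrite vapp_lmul mul1r.
- move=> i c w v; apply: vf_ext => a.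
  by rewrite vapp_linear_l !vapp_act vapp_linear_l act_linear.
- exact: vf_act_add.
- by move=> w; apply: vf_ext => a; rewrite vapp_act !act0.
- by move=> i a w; apply: vf_ext => b; rewrite vapp_lmul !vapp_act vapp_lmul actM.
- move=> w p.
  apply: (sweed_Rbar_homog char0 (F := fun s => vf_lmul (bas p) (vf_act s w))) => i j.
  by rewrite act_bas (linZ (vf_lmul_linear_l _)).
Qed.

Lemma vsval_u : vsval (u k) = del k.
Proof. by apply: vsval_mkvf; apply: der_del. Qed.

Lemma vsval_u' : vsval (u' k) = del' k.
Proof. by apply: vsval_mkvf; apply: der_del'. Qed.

Definition genx : A k := bas (((true, false), (false, false)) : idx (A k)).
Definition genx' : A k := bas (((false, false), (true, false)) : idx (A k)).

Lemma oneA : 1 = bas (((false, false), (false, false)) : idx (A k)) :> A k.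
Proof. by rewrite bas_pure basK !expr0 mul1r pure1. Qed.

Lemma u_genx : vapp (u k) genx = 1.
Proof. by rewrite /vapp vsval_u /genx bas_pure del_bas scale1r -bas_pure oneA. Qed.

Lemma u_genx' : vapp (u k) genx' = 0.
Proof. by rewrite /vapp vsval_u /genx' bas_pure del_bas scale0r. Qed.

Lemma u'_genx : vapp (u' k) genx = 0.
Proof. by rewrite /vapp vsval_u' /genx bas_pure del'_bas scale0r. Qed.

Lemma u'_genx' : vapp (u' k) genx' = 1.
Proof. by rewrite /vapp vsval_u' /genx' bas_pure del'_bas scale1r -bas_pure oneA. Qed.

Lemma homog_u : homog (dgx : deg) (u k : X k).
Proof.
move=> i; apply: vf_ext => a; rewrite vapp_act (linZ (vapp_linear_l _)).
by rewrite /vapp vsval_u -hactE_grpl del_hact scale_lfunE.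
Qed.

Lemma homog_u' : homog (dgx' : deg) (u' k : X k).
Proof.
move=> i; apply: vf_ext => a; rewrite vapp_act (linZ (vapp_linear_l _)).
by rewrite /vapp vsval_u' -hactE_grpl del'_hact scale_lfunE.
Qed.

Lemma double_eq0 (V : lmodType k) (v : V) : v + v = 0 -> v = 0.
Proof.
move=> /eqP; rewrite -mulr2n -scaler_nat scaler_eq0 (negPf (two_neq0 char0)).
by move/eqP.
Qed.

Lemma vapp1 (w : vf k) : vapp w 1 = 0.
Proof.
have := vapp_der w ((false, false), (false, false)) 1.
rewrite -oneA mulr1 mulr1 mul1r vapp_act !act1 /dg /= -[(_, _, _)]/dzero act0.
by move=> e; apply: (addrI (vapp w 1)); rewrite addr0 -e.
Qed.

(** Such a monomial p has p p = 1 and commutation factor 1 with itself, so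
    the Leibniz rule gives 0 = 2 w(p) p. *)
Lemma vapp_grp (w : vf k) (p : idx (A k)) :
  dot (dg p) (dg p) = false -> bas p * bas p = 1 :> A k -> vapp w (bas p) = 0.
Proof.
move=> pp gg; have := vapp_der w p (bas p).
rewrite gg vapp1 vapp_act act_bas /sgn pp scale1r -mulA_bas => /esym/double_eq0 e.
by rewrite -[LHS]mulr1 -gg mulrA e mul0r.
Qed.

(** A braided derivation is determined by its values on generators, and it
    kills the grouplike generators g and g'. *)
Lemma vf_eq0 (w : vf k) : vapp w genx = 0 -> vapp w genx' = 0 -> w = 0.
Proof.
move=> wx wx'; pose Q b := forall i, vapp w (act (gm i) b) = 0.
have Qb p : vapp w (bas p) = 0 -> Q (bas p).
  by move=> e i; rewrite act_bas (linZ (vapp_linear_r w)) e scaler0.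
have QM p b : vapp w (bas p) = 0 -> Q b -> Q (bas p * b).
  move=> e Qb' i; rewrite actM act_bas -mulA_scale (linZ (vapp_linear_r w)).
  by rewrite vapp_der vapp_act act_add Qb' e mul0r (lin0 (act_linear _)) mulr0 addr0 scaler0.
have w0 : vapp w (bas (((false, false), (false, false)) : idx (A k))) = 0.
  by rewrite -oneA vapp1.
have wg : vapp w (bas (((false, true), (false, false)) : idx (A k))) = 0.
  apply: vapp_grp => //.
  by rewrite bas_pure pureM !basM /= expr0 !scale1r -bas_pure oneA.
have wg' : vapp w (bas (((false, false), (false, true)) : idx (A k))) = 0.
  apply: vapp_grp => //.
  by rewrite bas_pure pureM !basM /= expr0 !scale1r -bas_pure oneA.
(* A monomial is a product of generators, and Q is stable under left
   multiplication by a monomial on which w vanishes. *)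
have Qall (p : idx (A k)) : Q (bas p).
  case: p => [[a b] [c e]].
  have -> : bas (((a, b), (c, e)) : idx (A k)) =
     bas (((a, false), (false, false)) : idx (A k)) *
      (bas (((false, b), (false, false)) : idx (A k)) *
       (bas (((false, false), (c, false)) : idx (A k)) *
         bas (((false, false), (false, e)) : idx (A k)))).
    by rewrite !bas_pure !pureM !basK !expr0 !mulr1 !mul1r.
  apply: (QM); first by case: a.
  apply: (QM); first by case: b.
  apply: (QM); first by case: c.
  by apply: (Qb); case: e.
apply: vf_ext => a; rewrite (lin0 (vapp_linear_l a)).
move: a; apply: lin_eq_bas => [||p].
- exact: vapp_linear_r.
- by move=> l v z; rewrite scaler0 addr0.
by have := Qall p dzero; rewrite act0.
Qed.

Lemma vf_decomp (w : X k) :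
  w = lmul (vapp w genx) (u k : X k) + lmul (vapp w genx') (u' k : X k).
Proof.
apply/eqP; rewrite -subr_eq0; apply/eqP; apply: vf_eq0.
- rewrite (linB (vapp_linear_l _)) (linD (vapp_linear_l _)) !vapp_lmul.
  by rewrite u_genx u'_genx mulr0 addr0 mulr1 subrr.
- rewrite (linB (vapp_linear_l _)) (linD (vapp_linear_l _)) !vapp_lmul.
  by rewrite u_genx' u'_genx' mulr0 add0r mulr1 subrr.
Qed.

Lemma om_ext (th eta : omf k) : (forall w, ev w th = ev w eta) -> th = eta.
Proof. by move=> e; apply: val_inj; apply/lfunP. Qed.

Lemma ev_linear_l (th : omf k) : linear (fun w : vf k => ev w th).
Proof. exact: linearP. Qed.

Lemma ev_linear_r (w : vf k) : linear (fun th : omf k => ev w th).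
Proof. by move=> c th eta; rewrite /ev linearP add_lfunE scale_lfunE. Qed.

Lemma ev_lmul a (w : vf k) (th : omf k) : ev (vf_lmul a w) th = a * ev w th.
Proof. by have /formsP := subvsP th; apply. Qed.

Lemma ev_mkom (f : vf k -> A k) w :
  linear f -> (forall a v, f (vf_lmul a v) = a * f v) -> ev w (mkom f) = f w.
Proof.
move=> lf fl; rewrite /ev vsprojK ?linfunE //.
by apply/formsP => a v; rewrite !linfunE.
Qed.

Lemma ev_d w (a : A k) : ev w (d a) = vapp w a.
Proof.
apply: ev_mkom => [|b v]; first exact: vapp_linear_l.
exact: vapp_lmul.
Qed.

Lemma ev_om_lmul a w (th : omf k) : ev w (om_lmul a th) = ev (vf_rmul w a) th.
Proof.
apply: ev_mkom => [|b v].
  by apply: (lin_comp (ev_linear_l th)); apply: (rmul_linl X_lawful).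
rewrite -ev_lmul; congr (ev _ _); exact/esym/(lmul_rmul X_lawful).
Qed.

Lemma ev_om_rmul a w (th : omf k) : ev w (om_rmul th a) = ev w th * a.
Proof.
apply: ev_mkom => [|b v]; last by rewrite ev_lmul mulrA.
by apply: (lin_comp (mulA_linl a)); apply: ev_linear_l.
Qed.

Lemma ev_om_act i w (th : omf k) :
  ev w (om_act (gm i) th) = act (gm i) (ev (vf_act (gm i) w) th).
Proof.
have E v : sweed (comul (gm i)) (fun h1 h2 =>
    act h2 (ev (vf_act ((antip (H k))^-1%VF h1) v) th)) =
    act (gm i) (ev (vf_act (gm i) v) th).
  by rewrite sweed_comul_grpl antipV_grpl.
apply: etrans (E w); apply: ev_mkom => [c v v'|b v].
  apply: etrans (E _) _.
  apply/esym/(etrans (congr2 (fun x y => c *: x + y) (E v) (E v')))/esym.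
  have -> : vf_act (gm i) (c *: v + v') = c *: vf_act (gm i) v + vf_act (gm i) v'.
    exact: (hact_lin X_lawful).
  by rewrite ev_linear_l act_linear.
apply: etrans (E _) _; apply/esym/(etrans (congr1 (fun x => b * x) (E v)))/esym.
have -> : vf_act (gm i) (vf_lmul b v) = vf_lmul (act (gm i) b) (vf_act (gm i) v).
  exact: (hact_lmul X_lawful).
by rewrite ev_lmul actM act_add daddii act0.
Qed.

Lemma Om_lawful : lawful (Om k).
Proof.
apply: (dual_lawful char0 X_lawful (ev := @ev k : X k -> omf k -> A k)).
- exact: om_ext.
- exact: ev_linear_l.
- exact: ev_linear_r.
- by move=> a w th; apply: ev_lmul.
- exact: ev_om_lmul.
- exact: ev_om_rmul.
- exact: ev_om_act.
Qed.

End Fields.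

(** * Calculi with a two-element basis of commuting vector fields *)

(** The properties of X and Omega on which the Levi-Civita theorem rests:
    symmetric bimodules in duality, a basis of commuting braided derivations
    u1 and u2 with vanishing squares, whose degrees anticommute with
    themselves and commute with each other, and the dual basis o1, o2.
    Connections are studied for this structure instead of the concrete spaces
    of linear maps. *)
Record calculus (k : fieldType) := Calculus {
  vect : bimod k;
  covect : bimod k;
  vapply : vect -> A k -> A k;
  pairing : vect -> covect -> A k;
  dfun : A k -> covect;
  vect_lawful : lawful vect;
  covect_lawful : lawful covect;
  vapply_linear_l : forall a, linear (vapply^~ a);
  vapply_linear_r : forall w, linear (vapply w);
  vect_ext : forall w v, (forall a, vapply w a = vapply v a) -> w = v;
  vapply_lmul : forall a w b, vapply (lmul a w) b = a * vapply w b;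
  vapply_hact : forall i w b,
    vapply (hact (grpl k i) w) b = act (grpl k i) (vapply w (act (grpl k i) b));
  vapply_der : forall w p b, vapply w (bas p * b) =
    vapply w (bas p) * b + bas p * vapply (hact (grpl k (dg p)) w) b;
  covect_ext : forall th eta, (forall w, pairing w th = pairing w eta) -> th = eta;
  pairing_linear_l : forall th, linear (pairing^~ th);
  pairing_linear_r : forall w, linear (pairing w);
  pairing_lmul : forall a w th, pairing (lmul a w) th = a * pairing w th;
  pairing_covect_lmul : forall a w th, pairing w (lmul a th) = pairing (rmul w a) th;
  pairing_covect_rmul : forall a w th, pairing w (rmul th a) = pairing w th * a;
  pairing_hact : forall i w th, pairing w (hact (grpl k i) th) =
    act (grpl k i) (pairing (hact (grpl k i) w) th);
  pairing_dfun : forall w a, pairing w (dfun a) = vapply w a;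
  e1 : deg;
  e2 : deg;
  dot11 : dot e1 e1;
  dot22 : dot e2 e2;
  dot12 : dot e1 e2 = false;
  u1 : vect;
  u2 : vect;
  homog_u1 : homog e1 u1;
  homog_u2 : homog e2 u2;
  vapply11 : forall a, vapply u1 (vapply u1 a) = 0;
  vapply22 : forall a, vapply u2 (vapply u2 a) = 0;
  vapply12 : forall a, vapply u1 (vapply u2 a) = vapply u2 (vapply u1 a);
  o1 : covect;
  o2 : covect;
  pairing11 : pairing u1 o1 = 1;
  pairing12 : pairing u1 o2 = 0;
  pairing21 : pairing u2 o1 = 0;
  pairing22 : pairing u2 o2 = 1;
  vect_decomp : forall w, w = lmul (pairing w o1) u1 + lmul (pairing w o2) u2 }.

Arguments u1 {k c}.
Arguments u2 {k c}.
Arguments o1 {k c}.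
Arguments o2 {k c}.
Arguments e1 {k c}.
Arguments e2 {k c}.

Section Calculus.
Variables (k : fieldType).
Hypothesis char0 : [pchar k] =i pred0.
Variable C : calculus k.
Notation gm i := (grpl k i).
Notation X := (vect C).
Notation Om := (covect C).
Let lX := vect_lawful C.
Let lO := covect_lawful C.

(** A linear map on vector fields is determined by its values on multiples of
    the basis fields by monomials, which are homogeneous. *)
Lemma vect_basis_ext (V : lmodType k) (f g : X -> V) :
  linear f -> linear g ->
  (forall p, f (lmul (bas p : A k) u1) = g (lmul (bas p : A k) u1)) ->
  (forall p, f (lmul (bas p : A k) u2) = g (lmul (bas p : A k) u2)) ->
  f =1 g.
Proof.
move=> lf lg f1 f2 w; rewrite (vect_decomp w) !(linD lf) !(linD lg).
congr (_ + _).
  move: (pairing w o1); apply: lin_eq_bas => //.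
  + by apply: (lin_comp lf); apply: lmul_linl.
  + by apply: (lin_comp lg); apply: lmul_linl.
move: (pairing w o2); apply: lin_eq_bas => //.
+ by apply: (lin_comp lf); apply: lmul_linl.
+ by apply: (lin_comp lg); apply: lmul_linl.
Qed.

Lemma covect_basis_ext (th eta : Om) :
  pairing u1 th = pairing u1 eta -> pairing u2 th = pairing u2 eta -> th = eta.
Proof.
move=> h1 h2; apply: covect_ext => w; rewrite (vect_decomp w).
by rewrite !(linD (@pairing_linear_l k C _)) !pairing_lmul h1 h2.
Qed.

Lemma covect_decomp (th : Om) :
  th = rmul o1 (pairing u1 th) + rmul o2 (pairing u2 th).
Proof.
apply: covect_basis_ext; rewrite (linD (pairing_linear_r _)) !pairing_covect_rmul.
  by rewrite pairing11 pairing12 mul1r mul0r addr0.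
by rewrite pairing21 pairing22 mul1r mul0r add0r.
Qed.

(** Evaluation preserves degrees and u1 has a degree that is its own
    opposite. *)
Lemma homog_o1 : homog (@e1 k C) (o1 : Om).
Proof.
move=> i; apply: covect_basis_ext; rewrite (linZ (pairing_linear_r _)) pairing_hact.
  by rewrite homog_u1 (linZ (pairing_linear_l _)) pairing11 (linZ (act_linear _)) act1.
rewrite homog_u2 (linZ (pairing_linear_l _)) pairing21 (linZ (act_linear _)).
by rewrite (lin0 (act_linear _)) !scaler0.
Qed.

Lemma homog_o2 : homog (@e2 k C) (o2 : Om).
Proof.
move=> i; apply: covect_basis_ext; rewrite (linZ (pairing_linear_r _)) pairing_hact; last first.
  by rewrite homog_u2 (linZ (pairing_linear_l _)) pairing22 (linZ (act_linear _)) act1.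
rewrite homog_u1 (linZ (pairing_linear_l _)) pairing12 (linZ (act_linear _)).
by rewrite (lin0 (act_linear _)) !scaler0.
Qed.

Lemma dfun_linear : linear (dfun C).
Proof.
move=> c a b; apply: covect_ext => w; rewrite (pairing_linear_r w) !pairing_dfun.
exact: vapply_linear_r.
Qed.

Lemma hact_dfun i a : hact (gm i) (dfun C a) = dfun C (act (gm i) a).
Proof.
apply: covect_ext => w; rewrite pairing_hact !pairing_dfun vapply_hact.
by rewrite act_add daddii act0.
Qed.

Lemma vapply_rmul (w : X) p b :
  vapply (rmul w (bas p)) b = bas p * vapply (hact (gm (dg p)) w) b.
Proof. by rewrite (rmul_bas lX) vapply_lmul. Qed.

Lemma dfunM a b : dfun C (a * b) = rmul (dfun C a) b + lmul a (dfun C b).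
Proof.
apply: covect_ext => w; rewrite (linD (pairing_linear_r _)) pairing_covect_rmul.
rewrite pairing_covect_lmul !pairing_dfun; move: a; apply: lin_eq_bas => [||p].
- by apply: (lin_comp (vapply_linear_r w)); apply: mulA_linl.
- apply: lin_add; first by apply: (lin_comp (mulA_linl _)); apply: vapply_linear_r.
  by apply: (lin_comp (@vapply_linear_l _ C b)); apply: rmul_linr.
by rewrite vapply_der vapply_rmul.
Qed.

Lemma dfun1 : dfun C 1 = 0.
Proof.
have := dfunM 1 1; rewrite mulr1 (rmul1 char0 lO) (lmul1 lO) => e.
by apply: (addrI (dfun C 1)); rewrite addr0 -e.
Qed.

(** Contraction of a vector field with the first leg of a tensor; the second
    leg is a vector field or a one-form. *)
Definition contr (N : bimod k) (w : X) : atens Om N -> N :=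
  alift (fun th n => lmul (pairing w th) n).

Section Contraction.
Variable N : bimod k.
Hypothesis lN : lawful N.

Lemma contr_apure (w : X) (th : Om) (n : N) :
  contr w (apure th n) = lmul (pairing w th) n.
Proof.
apply: (@alift_pure _ _ _ _ (fun (th : Om) (n : N) => lmul (pairing w th) n))
  => [m|m|m a n'].
- exact: lmul_linr.
- by apply: (lin_comp (lmul_linl lN _)); apply: pairing_linear_r.
- by rewrite pairing_covect_rmul (lmulA lN).
Qed.

Lemma contr_linear (w : X) : linear (contr w : atens Om N -> N).
Proof. exact: alift_linear. Qed.

Lemma contr_linear_l (z : atens Om N) : linear (fun w => contr w z).
Proof.
apply: alift_linear_fun => th n.
by apply: (lin_comp (lmul_linl lN _)); apply: pairing_linear_l.
Qed.

Lemma contr_lmul_l a w (z : atens Om N) : contr (lmul a w) z = lmul a (contr w z).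
Proof.
move: z; apply: lin_eq_apure => [||th n].
- exact: contr_linear.
- by apply: (lin_comp (lmul_linr lN _)); apply: contr_linear.
by rewrite !contr_apure pairing_lmul (lmulA lN).
Qed.

Lemma contr_lmul a w (z : atens Om N) : contr w (lmul a z) = contr (rmul w a) z.
Proof.
move: z; apply: lin_eq_apure => [||th n].
- apply: (lin_comp (contr_linear _)); exact: alift_linear.
- exact: contr_linear.
by rewrite (lmul_apure lO lN) !contr_apure pairing_covect_lmul.
Qed.

Lemma contr_rmul a w (z : atens Om N) : contr w (rmul z a) = rmul (contr w z) a.
Proof.
move: z; apply: lin_eq_apure => [||th n].
- apply: (lin_comp (contr_linear _)); exact: alift_linear.
- by apply: (lin_comp (rmul_linl lN _)); apply: contr_linear.
by rewrite (rmul_apure lO lN) !contr_apure (lmul_rmul lN).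
Qed.

(** The first leg has right coordinates with respect to o1 and o2, which pass
    to the second leg by balancedness. *)
Lemma contr_decomp (z : atens Om N) :
  z = apure o1 (contr u1 z) + apure o2 (contr u2 z).
Proof.
move: z; apply: lin_eq_apure => [//||th n].
  apply: lin_add; apply: (lin_comp (apure_linear_r _)); exact: contr_linear.
rewrite !contr_apure {1}(covect_decomp th) (linD (apure_linear_l _)).
by rewrite !(apure_bal lO lN).
Qed.

Lemma contr_ext (z z' : atens Om N) :
  contr u1 z = contr u1 z' -> contr u2 z = contr u2 z' -> z = z'.
Proof. by move=> h1 h2; rewrite (contr_decomp z) (contr_decomp z') h1 h2. Qed.

End Contraction.
End Calculus.

(** * Torsion *)

Lemma addr_cancel (V : zmodType) (a b c e s : V) :
  a - (s + b) - (c - (s + e)) = a - b - (c - e).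
Proof.
have -> : c - (s + e) = c - e - s by rewrite opprD addrA addrAC.
have -> : a - (s + b) = a - b - s by rewrite opprD addrA addrAC.
by rewrite opprB addrA subrK opprB.
Qed.

Section Torsion.
Variables (k : fieldType).
Hypothesis char0 : [pchar k] =i pred0.
Variable C : calculus k.
Notation gm i := (grpl k i).
Notation X := (vect C).
Notation Om := (covect C).
Let lX := vect_lawful C.
Let lO := covect_lawful C.

Variable nabla : 'Hom(X, atens Om X).

Definition connection := forall (a : A k) (v : X),
  nabla (lmul a v) = apure (dfun C a) v + lmul a (nabla v).

(** Evaluated at an element of A, so that the bracket, which is only a linear
    map on A, has no lift to the vector fields to be constructed. *)
Definition torsion (w v : X) (a : A k) : A k :=
  vapply (contr w (nabla v) -
       \sw_(r, s <- Rbar k) contr (hact r v) (nabla (hact s w))) a -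
  (vapply w (vapply v a) - \sw_(r, s <- Rbar k) vapply (hact r v) (vapply (hact s w) a)).

Let tors (p : deg) (w v : X) (a : A k) : A k :=
  vapply (contr w (nabla v) - contr v (nabla (hact (gm p) w))) a -
  (vapply w (vapply v a) - vapply v (vapply (hact (gm p) w) a)).

Lemma torsion_homog p w v a : homog p v -> torsion w v a =
  vapply (contr w (nabla v) - contr v (nabla (hact (gm p) w))) a -
  (vapply w (vapply v a) - vapply v (vapply (hact (gm p) w) a)).
Proof.
move=> hv; rewrite /torsion.
rewrite (sweed_Rbar_homog char0 (p := p) (F := fun s => contr v (nabla (hact s w)))).
  rewrite (sweed_Rbar_homog char0 (p := p) (F := fun s => vapply v (vapply (hact s w) a))) //.
  by move=> i j; rewrite hv (linZ (vapply_linear_l _)).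
by move=> i j; rewrite hv (linZ (contr_linear_l lX _)).
Qed.

Let tors_linear_l p v a : linear (fun w => tors p w v a).
Proof.
apply: lin_add.
  apply: (lin_comp (@vapply_linear_l _ C a)); apply: lin_add.
    exact: contr_linear_l.
  apply: lin_opp; apply: (lin_comp (contr_linear v)).
  by apply: (lin_comp (@linearP _ _ _ _ nabla)); apply: hact_lin.
apply: lin_opp; apply: lin_add; first exact: vapply_linear_l.
apply: lin_opp; apply: (lin_comp (vapply_linear_r v)).
by apply: (lin_comp (@vapply_linear_l _ C a)); apply: hact_lin.
Qed.

Hypothesis cn : connection.

Let contr_nabla (w : X) p (v : X) : contr w (nabla (lmul (bas p : A k) v)) =
  lmul (vapply w (bas p)) v + lmul (bas p : A k) (contr (hact (gm (dg p)) w) (nabla v)).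
Proof.
rewrite cn (linD (contr_linear w)) (contr_apure lX) pairing_dfun; congr (_ + _).
by rewrite (contr_lmul lX) (rmul_bas lX) (contr_lmul_l lX).
Qed.

Let tors_lmul_r p q (w v : X) a : tors (dadd (dg q) p) w (lmul (bas q : A k) v) a =
  bas q * tors p (hact (gm (dg q)) w) v a.
Proof.
rewrite /tors contr_nabla (contr_lmul_l lX) !(linB (@vapply_linear_l _ C a)).
rewrite (linD (@vapply_linear_l _ C a)) !vapply_lmul vapply_der.
rewrite (hact_add lX) (daddC p) !mulrBr -[X in X - _]addrA -[X in _ - X]addrA.
by rewrite opprD addrACA subrr add0r.
Qed.

Let tors_lmul_l p q (w v : X) a : homog p v ->
  tors p (lmul (bas q : A k) w) v a = bas q * tors p w v a.
Proof.
move=> hv; rewrite /tors (hact_lmul lX) act_bas.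
set w' := hact (gm p) w.
rewrite (contr_lmul_l lX) (lmulZl lX) linearZ /= (linZ (contr_linear v)).
rewrite contr_nabla hv (linZ (contr_linear_l lX _)) (lmulZr lX) scalerDr.
rewrite sgnC sgnKl !(linB (@vapply_linear_l _ C a)) (linD (@vapply_linear_l _ C a)).
rewrite (linZ (@vapply_linear_l _ C a)) (linZ (@vapply_linear_l _ C _)).
rewrite !vapply_lmul (linZ (vapply_linear_r v)) vapply_der hv.
rewrite (linZ (@vapply_linear_l _ C _)) scalerDr -scalerAr sgnKl !mulrBr.
exact: addr_cancel.
Qed.

(** By tensoriality of the torsion in both arguments, tors_lmul_r and
    tors_lmul_l. *)
Lemma torsion_basis p q (v : X) : homog p v ->
  (forall a, tors p u1 v a = 0) -> (forall a, tors p u2 v a = 0) ->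
  forall w a, torsion w (lmul (bas q : A k) v) a = 0.
Proof.
move=> hv t1 t2 w a; rewrite (torsion_homog _ _ (homog_lmul lX q hv)) -/(tors _ _ _ _).
rewrite tors_lmul_r; set w' := hact _ w.
suff -> : tors p w' v a = 0 by rewrite mulr0.
move: w'; apply: vect_basis_ext => [||r|r].
- exact: tors_linear_l.
- by move=> c x y; rewrite scaler0 addr0.
- by rewrite tors_lmul_l // t1 mulr0.
- by rewrite tors_lmul_l // t2 mulr0.
Qed.

Definition torsionless := forall w v a, torsion w v a = 0.

(** It is enough to test the torsion on the basis. There the brackets vanish.
    The commutation factor of u_i with itself is -1, so the condition for u_i
    against itself is that twice the contraction vanishes, while the factor
    of u1 and u2 is 1. *)
Lemma torsionlessP : torsionless <->
  [/\ contr u1 (nabla u1) = 0, contr u2 (nabla u2) = 0 &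
      contr u1 (nabla u2) = contr u2 (nabla u1)].
Proof.
have h1 := @homog_u1 k C; have h2 := @homog_u2 k C.
have s11 : sgn k (@e1 k C) (@e1 k C) = -1 by rewrite /sgn (dot11 C) expr1.
have s22 : sgn k (@e2 k C) (@e2 k C) = -1 by rewrite /sgn (dot22 C) expr1.
have s12 : sgn k (@e1 k C) (@e2 k C) = 1 by rewrite /sgn (dot12 C).
have s21 : sgn k (@e2 k C) (@e1 k C) = 1 by rewrite sgnC.
have E11 a : tors (@e1 k C) u1 u1 a = vapply (contr u1 (nabla u1)) a *+ 2.
  rewrite /tors h1 s11 scaleN1r linearN /= (linN (contr_linear u1)) opprK.
  by rewrite (linN (@vapply_linear_l _ C _)) (linN (vapply_linear_r u1)) vapply11 oppr0 !subr0 (linD (@vapply_linear_l _ C _)).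
have E22 a : tors (@e2 k C) u2 u2 a = vapply (contr u2 (nabla u2)) a *+ 2.
  rewrite /tors h2 s22 scaleN1r linearN /= (linN (contr_linear u2)) opprK.
  by rewrite (linN (@vapply_linear_l _ C _)) (linN (vapply_linear_r u2)) vapply22 oppr0 !subr0 (linD (@vapply_linear_l _ C _)).
have E12 a : tors (@e2 k C) u1 u2 a =
    vapply (contr u1 (nabla u2)) a - vapply (contr u2 (nabla u1)) a.
  rewrite /tors h1 s21 scale1r vapply12 subrr subr0.
  by rewrite (linB (@vapply_linear_l _ C _)).
have E21 a : tors (@e1 k C) u2 u1 a =
    vapply (contr u2 (nabla u1)) a - vapply (contr u1 (nabla u2)) a.
  rewrite /tors h2 s12 scale1r vapply12 subrr subr0.
  by rewrite (linB (@vapply_linear_l _ C _)).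
have z0 (w : X) : (forall a, vapply w a = 0) -> w = 0.
  by move=> w0; apply: vect_ext => a; rewrite w0 (lin0 (@vapply_linear_l _ C a)).
have dbl (x : A k) : x *+ 2 = 0 -> x = 0.
  by move=> /eqP; rewrite -scaler_nat scaler_eq0 (negPf (two_neq0 char0)) => /eqP.
split=> [t0 | [n11 n22 n12]].
  split.
  - by apply: z0 => a; apply: dbl; rewrite -E11 /tors -torsion_homog.
  - by apply: z0 => a; apply: dbl; rewrite -E22 /tors -torsion_homog.
  - apply: vect_ext => a; apply/eqP; rewrite -subr_eq0 -E12 /tors -torsion_homog //.
    by rewrite t0.
move=> w v a; move: v; apply: vect_basis_ext => [||q|q].
- apply: lin_add.
    apply: (lin_comp (@vapply_linear_l _ C a)); apply: lin_add.
      by apply: (lin_comp (contr_linear w)); apply: linearP.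
    apply: lin_opp; apply: (lin_sweed_Rbar char0) => i j.
    by apply: (lin_comp (contr_linear_l lX _)); apply: hact_lin.
  apply: lin_opp; apply: lin_add.
    by apply: (lin_comp (vapply_linear_r w)); apply: vapply_linear_l.
  apply: lin_opp; apply: (lin_sweed_Rbar char0) => i j.
  by apply: (lin_comp (@vapply_linear_l _ C _)); apply: hact_lin.
- by move=> c x y; rewrite scaler0 addr0.
- apply: (torsion_basis _ h1) => b; first by rewrite E11 n11 (lin0 (@vapply_linear_l _ C b)) mul0rn.
  by rewrite E21 n12 subrr.
- apply: (torsion_basis _ h2) => b; last by rewrite E22 n22 (lin0 (@vapply_linear_l _ C b)) mul0rn.
  by rewrite E12 n12 subrr.
Qed.

End Torsion.

(** * The dual connection and its lift to the tensor square *)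

Section DualConnection.
Variables (k : fieldType).
Hypothesis char0 : [pchar k] =i pred0.
Variable C : calculus k.
Notation gm i := (grpl k i).
Notation X := (vect C).
Notation Om := (covect C).
Let lX := vect_lawful C.
Let lO := covect_lawful C.
Let lOO := atens_lawful lO lO.

(** Evaluation of a one-form on the second leg. *)
Definition contr_right (z : atens Om X) (th : Om) : Om :=
  alift (fun (eta : Om) (v : X) => rmul eta (pairing v th)) z.

Lemma contr_right_apure (eta : Om) (v : X) th :
  contr_right (apure eta v) th = rmul eta (pairing v th).
Proof.
apply: (@alift_pure _ _ _ _ (fun (eta : Om) (v : X) => rmul eta (pairing v th)))
  => [m|m|m a n].
- by apply: (lin_comp (rmul_linr lO _)); apply: pairing_linear_l.
- exact: rmul_linl.
- by rewrite (rmulA char0 lO) pairing_lmul.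
Qed.

Lemma contr_right_linear th : linear (contr_right^~ th).
Proof. exact: alift_linear. Qed.

Lemma contr_right_lmul a z th :
  contr_right (lmul a z) th = lmul a (contr_right z th).
Proof.
move: z; apply: lin_eq_apure => [||eta v].
- by apply: (lin_comp (contr_right_linear _)); apply: alift_linear.
- by apply: (lin_comp (lmul_linr lO _)); apply: contr_right_linear.
by rewrite (lmul_apure lO lX) !contr_right_apure (lmul_rmul lO).
Qed.

Lemma contr_right_rmul a z th :
  contr_right z (rmul th a) = rmul (contr_right z th) a.
Proof.
move: z; apply: lin_eq_apure => [||eta v].
- exact: contr_right_linear.
- by apply: (lin_comp (rmul_linl lO _)); apply: contr_right_linear.
by rewrite !contr_right_apure pairing_covect_rmul (rmulA char0 lO).
Qed.

Definition dual_conn (nabla : 'Hom(X, atens Om X)) (dn : 'Hom(Om, atens Om Om)) :=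
  forall v th,
    dfun C (pairing v th) = contr_right (nabla v) th + contr v (dn th).

(** The dual connection after it has been moved past a one-form of degree i.
    It differs from dn since a connection is not assumed to preserve degrees. *)
Definition twist (dn : 'Hom(Om, atens Om Om)) i (eta : Om) : atens Om Om :=
  hact (gm i) (dn (hact (gm i) eta)).

Definition conn_act (dn : 'Hom(Om, atens Om Om)) (h : H k) (eta : Om) :
    atens Om Om :=
  \sw_(h1, h2 <- comul h) hact h1 (dn (hact (antip (H k) h2) eta)).

Lemma conn_act_grpl dn i eta : conn_act dn (gm i) eta = twist dn i eta.
Proof. by rewrite /conn_act sweed_comul_grpl antip_grpl. Qed.

Definition conn_lift (dn : 'Hom(Om, atens Om Om)) :
    atens Om Om -> atens (atens Om Om) Om :=
  alift (fun th eta => tau23 (apure (dn th) eta) +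
    \sw_(r, s <- Rbar k) assoc (apure (hact r th) (conn_act dn s eta))).

Section Fixed.
Variables (nabla : 'Hom(X, atens Om X)) (dn : 'Hom(Om, atens Om Om)).
Hypothesis dual : dual_conn nabla dn.

(** The Leibniz rule of the dual connection follows from its defining
    equation, since one-forms are separated by contraction with vector
    fields. *)
Lemma dual_conn_rmul th a : dn (rmul th a) = rmul (dn th) a + apure th (dfun C a).
Proof.
suff E v : contr v (dn (rmul th a)) = contr v (rmul (dn th) a + apure th (dfun C a)).
  by apply: (contr_ext lO); rewrite E.
have e1 := dual v (rmul th a); have e2 := dual v th.
rewrite (linD (contr_linear v)) (contr_rmul lO) (contr_apure lO).
apply: (addrI (contr_right (nabla v) (rmul th a))); rewrite -e1.
rewrite contr_right_rmul pairing_covect_rmul dfunM e2 (linD (rmul_linl lO a)).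
by rewrite addrA.
Qed.

Lemma twist_rmul i th a :
  twist dn i (rmul th a) = rmul (twist dn i th) a + apure th (dfun C a).
Proof.
rewrite /twist (hact_rmul lO) dual_conn_rmul (linD (hact_lin lOO i)).
rewrite (hact_rmul lOO) (hact_apure lO lO) act_add daddii act0 (hact_invol lO).
by rewrite hact_dfun act_add daddii act0.
Qed.

Let twist_linear i : linear (twist dn i).
Proof.
apply: (lin_comp (hact_lin lOO i)); apply: (lin_comp (@linearP _ _ _ _ dn)).
exact: hact_lin.
Qed.

(** A left multiple of a homogeneous form is a right multiple up to sign,
    which reduces to twist_rmul. *)
Lemma twist_lmul i q r (th : Om) : homog r th ->
  twist dn i (lmul (bas q : A k) th) =
  lmul (bas q : A k) (twist dn (dadd i (dg q)) th)
  + sgn k r (dg q) *: apure th (dfun C (bas q)).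
Proof.
move=> hth; rewrite (lmul_homog lO _ hth) act_bas (rmulZr lO) (linZ (twist_linear i)).
rewrite twist_rmul scalerDr; congr (_ + _).
have E : hact (gm (dadd i (dg q))) th = sgn k r (dg q) *: hact (gm i) th.
  by rewrite -(hact_add lO) hth (hactZ lO) sgnC.
rewrite (rmul_bas lOO) {1}/twist (hact_add lOO) /twist E (linZ (@linearP _ _ _ _ dn)).
by rewrite (hactZ lOO) (lmulZr lOO) (daddC i).
Qed.

Let liftf (th eta : Om) : atens (atens Om Om) Om := tau23 (apure (dn th) eta) +
    \sw_(r, s <- Rbar k) assoc (apure (hact r th) (conn_act dn s eta)).

Let liftf_homog p (th eta : Om) : homog p th -> liftf th eta =
  tau23 (apure (dn th) eta) + assoc (apure th (twist dn p eta)).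
Proof.
move=> hth; rewrite /liftf -conn_act_grpl; congr (_ + _).
apply: (sweed_Rbar_homog char0 (F := fun s => assoc (apure th (conn_act dn s eta)))) => i j.
by rewrite hth (linZ (apure_linear_l _)) (linZ (@assoc_linear _ _ _ _)).
Qed.

Let liftf_linear_l eta : linear (fun th => liftf th eta).
Proof.
apply: lin_add.
  apply: (lin_comp (@tau23_linear _ _ _ _)); apply: (lin_comp (apure_linear_l _)).
  exact: linearP.
apply: (lin_sweed_Rbar char0) => i j; apply: (lin_comp (@assoc_linear _ _ _ _)).
by apply: (lin_comp (apure_linear_l _)); apply: hact_lin.
Qed.

Let liftf_linear_r th : linear (liftf th).
Proof.
apply: lin_add.
  by apply: (lin_comp (@tau23_linear _ _ _ _)); apply: apure_linear_r.
apply: (lin_sweed_Rbar char0) => i j; apply: (lin_comp (@assoc_linear _ _ _ _)).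
apply: (lin_comp (apure_linear_r _)) => c eta eta'.
by rewrite !conn_act_grpl twist_linear.
Qed.

Let liftf_balanced th a eta : liftf (rmul th a) eta = liftf th (lmul a eta).
Proof.
move: a; apply: lin_eq_bas => [||q].
- by apply: (lin_comp (liftf_linear_l _)); apply: rmul_linr.
- by apply: (lin_comp (liftf_linear_r _)); apply: lmul_linl.
move: th; apply: (lin_eq_homog char0 lO) => [||p th hth].
- by apply: (lin_comp (liftf_linear_l _)); apply: rmul_linl.
- exact: liftf_linear_l.
move: eta; apply: (lin_eq_homog char0 lO) => [||r eta heta].
- exact: liftf_linear_r.
- by apply: (lin_comp (liftf_linear_r _)); apply: lmul_linr.
rewrite (liftf_homog _ (homog_rmul lO q hth)) (liftf_homog _ hth).
rewrite dual_conn_rmul (linD (apure_linear_l _)) (linD (@tau23_linear _ _ _ _)).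
rewrite (apure_bal lOO lO) -addrA; congr (_ + _).
(* What remains is tau23 of th ⊗ d(bas q) ⊗ eta against th ⊗ eta ⊗ d(bas q),
   which agree up to the sign in twist_lmul. *)
rewrite (twist_lmul _ _ heta) (linD (apure_linear_r _)) (linD (@assoc_linear _ _ _ _)).
rewrite (apure_bal lO lOO) addrC; congr (_ + _).
rewrite (tau23_apure char0 lO lO lO _ _ heta) hact_dfun act_bas.
rewrite (linZ (@dfun_linear _ C)) !(linZ (apure_linear_r _)) (linZ (@assoc_linear _ _ _ _)).
by rewrite (assoc_apure lO lO lO).
Qed.

(** The right-hand side extends to a balanced map: the two terms produced by
    the Leibniz rules of dn and of its twist are exchanged by the braiding of
    the last two legs. *)
Lemma conn_lift_apure p (th eta : Om) : homog p th ->
  conn_lift dn (apure th eta) =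
  tau23 (apure (dn th) eta) + assoc (apure th (twist dn p eta)).
Proof.
move=> hth; rewrite -liftf_homog //.
by apply: (@alift_pure _ _ _ _ liftf).
Qed.

Lemma conn_lift_linear : linear (conn_lift dn).
Proof. exact: alift_linear. Qed.

End Fixed.
End DualConnection.

(** * Compatibility with the metric *)

Lemma regroup (V : zmodType) (a1 a2 a3 b1 b2 b3 p1 p2 q1 q2 : V) :
  a1 - a2 + (b1 + b2) + (p1 + q1) + (b3 - b1 + (a2 + a3) + (q2 + p2)) =
  a1 + a3 + (q1 + q2) + (b2 + b3 + (p1 + p2)).
Proof.
rewrite (AC (2*2*2*(2*2*2)) ((1*10)*(6*11)*((4*7)*(5*12))*((9*2)*(3*8)))) /=.
by rewrite !subrr !addr0.
Qed.

Section LeviCivita.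
Variables (k : fieldType).
Hypothesis char0 : [pchar k] =i pred0.
Variable C : calculus k.
Notation gm i := (grpl k i).
Notation X := (vect C).
Notation Om := (covect C).
Notation d1 := (@e1 k C).
Notation d2 := (@e2 k C).
Let lX := vect_lawful C.
Let lO := covect_lawful C.
Let lOO := atens_lawful lO lO.
Let lOX := atens_lawful lO lX.

Definition tri (x y z : Om) : atens (atens Om Om) Om :=
  apure (apure x y : atens Om Om) z.

Definition sympure (x y : Om) : atens Om Om := apure x y + apure y x.

Section HalfLift.
Variables (nabla : 'Hom(X, atens Om X)) (dn : 'Hom(Om, atens Om Om)).
Hypothesis dual : dual_conn nabla dn.

(** The lift of one half of the metric. The summand with a comes from dn x
    after the braiding of the last two legs, which changes the sign of y
    against y; the one with b comes from dn y, where moving dn past x changes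
    the sign of x ⊗ y + y ⊗ x. *)
Lemma conn_lift_half (x y : Om) (ex ey : deg) (a b t px py : A k) :
  homog ex x -> homog ey y -> dot ex ex -> dot ey ey -> dot ex ey = false ->
  dn x = - rmul (sympure x y) a -> dn y = - rmul (sympure x y) b ->
  dfun C t = rmul x px + rmul y py ->
  conn_lift dn (apure x (rmul y t)) =
  rmul (tri x y y - tri y y x) (act (gm ey) a * t)
  + rmul (tri x x y + tri x y x) (act (gm ex) b * t)
  + (rmul (tri x y x) px + rmul (tri x y y) py).
Proof.
move=> hx hy xx yy xy dnx dny dt.
have lOOO := atens_lawful lOO lO.
have sxx : sgn k ex ex = -1 by rewrite /sgn xx expr1.
have syy : sgn k ey ey = -1 by rewrite /sgn yy expr1.
have sxy : sgn k ex ey = 1 by rewrite /sgn xy.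
have syx : sgn k ey ex = 1 by rewrite sgnC.
rewrite (conn_lift_apure char0 dual _ hx) -addrA; congr (_ + _).
  rewrite dnx (linN (apure_linear_l _)) (linN (@tau23_linear _ _ _ _)).
  rewrite (apure_bal lOO lO) (lmul_rmul lO) (lmul_homog lO _ hy) (rmulA char0 lO).
  rewrite -(rmul_apure lOO lO) (tau23_rmul char0 lO lO lO).
  rewrite -(linN (rmul_linl lOOO _)); congr (rmul _ _).
  rewrite /sympure (linD (apure_linear_l _)) (linD (@tau23_linear _ _ _ _)).
  rewrite !(tau23_apure char0 lO lO lO _ _ hy) hy hx syy syx scale1r scaleN1r.
  by rewrite (linN (apure_linear_r _)) opprD opprK.
rewrite /twist (hact_rmul lO) hy sxy scale1r (dual_conn_rmul char0 dual) dny.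
rewrite (linD (hact_lin lOO ex)) (hact_rmul lOO) (hact_apure lO lO) hy sxy scale1r.
rewrite hact_dfun !act_add daddii !act0 (linN (hact_lin lOO ex)) (hact_rmul lOO).
rewrite /sympure (linD (hact_lin lOO ex)) !(hact_apure lO lO) hx hy sxx sxy.
rewrite scale1r scaleN1r (linN (apure_linear_l _)) (linN (apure_linear_r _)) -opprD.
rewrite (linN (rmul_linl lOO (act (gm ex) b))) opprK (rmulA char0 lOO) dt.
rewrite !(linD (apure_linear_r _)) !(linD (@assoc_linear _ _ _ _)); congr (_ + _).
  rewrite -(rmul_apure lO lOO) (assoc_rmul lO lO lO) (linD (apure_linear_r _)).
  by rewrite (linD (@assoc_linear _ _ _ _)) !(assoc_apure lO lO lO).
rewrite -!(rmul_apure lO lO) -!(rmul_apure lO lOO) !(assoc_rmul lO lO lO).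
by rewrite !(assoc_apure lO lO lO).
Qed.

End HalfLift.

Lemma contr_sympure1 : contr u1 (sympure o1 o2 : atens Om Om) = o2.
Proof.
rewrite (linD (contr_linear u1)) !(contr_apure lO) pairing11 pairing12.
by rewrite (lmul1 lO) (lin0 (lmul_linl lO _)) addr0.
Qed.

Lemma contr_sympure2 : contr u2 (sympure o1 o2 : atens Om Om) = o1.
Proof.
rewrite (linD (contr_linear u2)) !(contr_apure lO) pairing21 pairing22.
by rewrite (lmul1 lO) (lin0 (lmul_linl lO _)) add0r.
Qed.

Definition tetrad_metric (t : A k) : atens Om Om := rmul (sympure o1 o2) t.

Section Values.
Variables (nabla : 'Hom(X, atens Om X)) (s : X).
Hypotheses (nu1 : nabla u1 = apure o2 s) (nu2 : nabla u2 = apure o1 s).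
Variable dn : 'Hom(Om, atens Om Om).
Hypothesis dual : dual_conn nabla dn.

(** If both derivatives of a form vanish in the dual basis, only the
    contraction with the common value s of nabla_1 u2 and nabla_2 u1
    survives, up to sign. *)
Lemma dual_conn_const (o : Om) :
  dfun C (pairing u1 o) = 0 -> dfun C (pairing u2 o) = 0 ->
  dn o = - rmul (sympure o1 o2) (pairing s o).
Proof.
move=> c1 c2; apply: (contr_ext lO).
  rewrite (linN (contr_linear u1)) (contr_rmul lO) contr_sympure1.
  apply/eqP; rewrite -addr_eq0 addrC; have := dual u1 o.
  by rewrite nu1 (contr_right_apure char0) c1 => <-.
rewrite (linN (contr_linear u2)) (contr_rmul lO) contr_sympure2.
apply/eqP; rewrite -addr_eq0 addrC; have := dual u2 o.
by rewrite nu2 (contr_right_apure char0) c2 => <-.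
Qed.

(** In the sum of the two halves the tensors o1 ⊗ o1 ⊗ o2 and o2 ⊗ o2 ⊗ o1
    cancel, and the remaining ones pair up into two independent equations. *)
Lemma conn_lift_metric t : conn_lift dn (tetrad_metric t) =
  rmul (tri o1 o2 o2 + tri o2 o1 o2) (act (gm d2) (pairing s o1) * t + vapply (u2 : X) t)
  + rmul (tri o1 o2 o1 + tri o2 o1 o1) (act (gm d1) (pairing s o2) * t + vapply (u1 : X) t).
Proof.
have lOOO := atens_lawful lOO lO.
have df0 : dfun C 0 = 0 by rewrite (lin0 (@dfun_linear _ C)).
have df1 := dfun1 char0 C.
have dn1 : dn o1 = - rmul (sympure o1 o2) (pairing s o1).
  by apply: dual_conn_const; rewrite ?pairing11 ?pairing21.
have dn2 : dn o2 = - rmul (sympure o1 o2) (pairing s o2).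
  by apply: dual_conn_const; rewrite ?pairing12 ?pairing22.
have dt : dfun C t = rmul o1 (vapply (u1 : X) t) + rmul o2 (vapply (u2 : X) t).
  by rewrite {1}(covect_decomp (dfun C t)) !pairing_dfun.
have sC : sympure o1 o2 = sympure o2 o1 :> atens Om Om by rewrite /sympure addrC.
have dt' := dt; rewrite addrC in dt'.
have dn1' := dn1; rewrite sC in dn1'; have dn2' := dn2; rewrite sC in dn2'.
have h1 := @homog_o1 k C; have h2 := @homog_o2 k C.
have d21 : dot d2 d1 = false by rewrite dotC (dot12 C).
rewrite /tetrad_metric /sympure (linD (rmul_linl lOO t)) !(rmul_apure lO lO).
rewrite (linD (@conn_lift_linear _ _ _)).
rewrite (conn_lift_half dual h1 h2 (dot11 C) (dot22 C) (dot12 C) dn1 dn2 dt).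
rewrite (conn_lift_half dual h2 h1 (dot22 C) (dot11 C) d21 dn2' dn1' dt').
set a := act _ _ * t; set b := act _ _ * t; set p := vapply u1 t; set q := vapply u2 t.
have rB (x y : atens (atens Om Om) Om) c : rmul (x - y) c = rmul x c - rmul y c.
  exact: (linB (rmul_linl lOOO c)).
have rD (x y : atens (atens Om Om) Om) c : rmul (x + y) c = rmul x c + rmul y c.
  exact: (linD (rmul_linl lOOO c)).
have rDr (x : atens (atens Om Om) Om) c c' : rmul x (c + c') = rmul x c + rmul x c'.
  exact: (linD (rmul_linr lOOO x)).
rewrite !rDr !rB !rD; exact: regroup.
Qed.

Let phi (z : atens (atens Om Om) Om) : Om :=
  alift (fun (y : atens Om Om) (eta : Om) => lmul (pairing u2 (contr u1 y)) eta) z.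

Let phi_tri (x y z : Om) c : phi (rmul (tri x y z) c) =
  rmul (lmul (pairing u2 (lmul (pairing u1 x) y)) z) c.
Proof.
rewrite (rmul_apure lOO lO) -(lmul_rmul lO) -(contr_apure lO u1).
apply: (@alift_pure _ _ _ _ (fun (y : atens Om Om) (eta : Om) =>
   lmul (pairing u2 (contr u1 y)) eta)) => [y'|eta|y' a eta].
- exact: lmul_linr.
- apply: (lin_comp (lmul_linl lO _)); apply: (lin_comp (pairing_linear_r _)).
  exact: contr_linear.
- by rewrite (contr_rmul lO) pairing_covect_rmul (lmulA lO).
Qed.

(** Contraction of the first two legs with u1 and then u2 leaves o2 a + o1 b. *)
Lemma tri_free (a b : A k) :
  rmul (tri o1 o2 o2 + tri o2 o1 o2) a + rmul (tri o1 o2 o1 + tri o2 o1 o1) b = 0 ->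
  a = 0 /\ b = 0.
Proof.
move=> /(congr1 phi); have lp : linear phi by apply: alift_linear.
rewrite !(linD (rmul_linl (atens_lawful lOO lO) _)) !(linD lp) (lin0 lp) !phi_tri.
rewrite pairing11 pairing12 !(lmul1 lO) !(lin0 (lmul_linl lO _)).
rewrite (lin0 (pairing_linear_r _)) !(lin0 (lmul_linl lO _)) pairing22 !(lmul1 lO).
rewrite !(lin0 (rmul_linl lO _)) !addr0 => e; split.
  have := congr1 (pairing u2) e; rewrite (linD (pairing_linear_r _)).
  by rewrite !pairing_covect_rmul pairing22 pairing21 mul0r addr0 mul1r (lin0 (pairing_linear_r _)).
have := congr1 (pairing u1) e; rewrite (linD (pairing_linear_r _)).
by rewrite !pairing_covect_rmul pairing11 pairing12 mul0r add0r mul1r (lin0 (pairing_linear_r _)).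
Qed.

Lemma conn_lift_metric_eq0 t : t \is a GRing.unit ->
  conn_lift dn (tetrad_metric t) = 0 <->
  pairing s o1 = - act (gm d2) (vapply (u2 : X) t * t^-1) /\
  pairing s o2 = - act (gm d1) (vapply (u1 : X) t * t^-1).
Proof.
move=> ut; have aK i (x : A k) : act (gm i) (act (gm i) x) = x.
  by rewrite act_add daddii act0.
have aN i (x : A k) : act (gm i) (- x) = - act (gm i) x.
  exact: (linN (act_linear _)).
have E i (x y : A k) : act (gm i) x * t + y = 0 <-> x = - act (gm i) (y * t^-1).
  split=> [e | ->]; last by rewrite aN aK mulNr divrK // addNr.
  have -> : y = - (act (gm i) x * t) by apply/eqP; rewrite -addr_eq0 addrC e.
  by rewrite mulNr mulrK // aN aK opprK.
rewrite conn_lift_metric -!E; split=> [|[-> ->]]; first exact: tri_free.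
by rewrite !(lin0 (rmul_linr (atens_lawful lOO lO) _)) addr0.
Qed.

End Values.
End LeviCivita.

(** * The Levi-Civita connection *)

Section Existence.
Variables (k : fieldType).
Hypothesis char0 : [pchar k] =i pred0.
Variable C : calculus k.
Notation gm i := (grpl k i).
Notation X := (vect C).
Notation Om := (covect C).
Notation d1 := (@e1 k C).
Notation d2 := (@e2 k C).
Let lX := vect_lawful C.
Let lO := covect_lawful C.
Let lOO := atens_lawful lO lO.
Let lOX := atens_lawful lO lX.

Definition metric_conn (g : atens Om Om) (nabla : 'Hom(X, atens Om X)) :=
  exists2 dn, dual_conn nabla dn & conn_lift dn g = 0.

Definition levi_civita_conn (g : atens Om Om) (nabla : 'Hom(X, atens Om X)) :=
  [/\ connection nabla, torsionless nabla & metric_conn g nabla].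

Lemma connection_ext (nabla nabla' : 'Hom(X, atens Om X)) :
  connection nabla -> connection nabla' ->
  nabla u1 = nabla' u1 -> nabla u2 = nabla' u2 -> nabla = nabla'.
Proof.
move=> c c' h1 h2; apply/lfunP; apply: vect_basis_ext; try exact: linearP.
- by move=> p; rewrite c c' h1.
- by move=> p; rewrite c c' h2.
Qed.

(** The unique connection with prescribed values z1, z2 on the basis, by the
    Leibniz rule applied to the coordinates of v. *)
Definition conn_of (z1 z2 : atens Om X) : 'Hom(X, atens Om X) :=
  linfun (fun v => (apure (dfun C (pairing v o1)) u1 + lmul (pairing v o1) z1) +
                   (apure (dfun C (pairing v o2)) u2 + lmul (pairing v o2) z2)).

Lemma conn_ofE z1 z2 v : conn_of z1 z2 v =
  (apure (dfun C (pairing v o1)) u1 + lmul (pairing v o1) z1) +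
  (apure (dfun C (pairing v o2)) u2 + lmul (pairing v o2) z2).
Proof.
rewrite linfunE //; apply: lin_add; apply: lin_add.
- apply: (lin_comp (apure_linear_l _)); apply: (lin_comp (@dfun_linear _ C)).
  exact: pairing_linear_l.
- by apply: (lin_comp (lmul_linl lOX _)); apply: pairing_linear_l.
- apply: (lin_comp (apure_linear_l _)); apply: (lin_comp (@dfun_linear _ C)).
  exact: pairing_linear_l.
- by apply: (lin_comp (lmul_linl lOX _)); apply: pairing_linear_l.
Qed.

Lemma conn_of1 z1 z2 : conn_of z1 z2 u1 = z1.
Proof.
rewrite conn_ofE pairing11 pairing12 dfun1 // (lin0 (@dfun_linear _ C)).
by rewrite !(lin0 (apure_linear_l _)) (lmul1 lOX) (lin0 (lmul_linl lOX _)) !addr0 add0r.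
Qed.

Lemma conn_of2 z1 z2 : conn_of z1 z2 u2 = z2.
Proof.
rewrite conn_ofE pairing21 pairing22 dfun1 // (lin0 (@dfun_linear _ C)).
by rewrite !(lin0 (apure_linear_l _)) (lmul1 lOX) (lin0 (lmul_linl lOX _)) !add0r.
Qed.

Lemma conn_of_connection z1 z2 : connection (conn_of z1 z2).
Proof.
have E a c (z : atens Om X) u : apure (dfun C (a * c)) u + lmul (a * c) z =
    apure (dfun C a) (lmul c u) + lmul a (apure (dfun C c) u + lmul c z : atens Om X).
  rewrite dfunM (linD (apure_linear_l _)) (apure_bal lO lX) -addrA; congr (_ + _).
  by rewrite (linD (lmul_linr lOX a)) (lmul_apure lO lX) (lmulA lOX).
move=> a v; rewrite !conn_ofE !pairing_lmul !E addrACA.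
by rewrite -(linD (apure_linear_r _)) -vect_decomp -(linD (lmul_linr lOX a)).
Qed.

Section Dual.
Variables (nabla : 'Hom(X, atens Om X)) (s : X).
Hypotheses (nu1 : nabla u1 = apure o2 s) (nu2 : nabla u2 = apure o1 s).
Hypothesis cn : connection nabla.

(* Forced by the defining equation contracted with u1 and u2. *)
Let dnf (th : Om) : atens Om Om :=
  apure o1 (dfun C (pairing u1 th)) + apure o2 (dfun C (pairing u2 th))
  - rmul (sympure o1 o2) (pairing s th).

Let dnf_linear : linear dnf.
Proof.
apply: lin_add; [apply: lin_add|apply: lin_opp].
- apply: (lin_comp (apure_linear_r _)); apply: (lin_comp (@dfun_linear _ C)).
  exact: pairing_linear_r.
- apply: (lin_comp (apure_linear_r _)); apply: (lin_comp (@dfun_linear _ C)).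
  exact: pairing_linear_r.
by apply: (lin_comp (rmul_linr lOO _)); apply: pairing_linear_r.
Qed.

Lemma dual_conn_exists : exists dn, dual_conn nabla dn.
Proof.
exists (linfun dnf) => v th; rewrite linfunE //.
pose D w := contr_right (nabla w) th + contr w (dnf th).
have lD : linear D.
  apply: lin_add; last exact: contr_linear_l.
  by apply: (lin_comp (contr_right_linear th)); apply: linearP.
have D1 : D u1 = dfun C (pairing u1 th).
  rewrite /D nu1 (contr_right_apure char0) /dnf (linB (contr_linear u1)).
  rewrite (contr_rmul lO) contr_sympure1 addrC subrK.
  rewrite (linD (contr_linear u1)) !(contr_apure lO) pairing11 pairing12.
  by rewrite (lmul1 lO) (lin0 (lmul_linl lO _)) addr0.
have D2 : D u2 = dfun C (pairing u2 th).
  rewrite /D nu2 (contr_right_apure char0) /dnf (linB (contr_linear u2)).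
  rewrite (contr_rmul lO) contr_sympure2 addrC subrK.
  rewrite (linD (contr_linear u2)) !(contr_apure lO) pairing21 pairing22.
  by rewrite (lmul1 lO) (lin0 (lmul_linl lO _)) add0r.
have DM a w : D (lmul a w) = rmul (dfun C a) (pairing w th) + lmul a (D w).
  rewrite /D cn (linD (contr_right_linear th)) (contr_right_apure char0) -addrA.
  congr (_ + _); rewrite (contr_right_lmul char0) (contr_lmul_l lO).
  by rewrite (linD (lmul_linr lO a)).
rewrite -/(D v); move: v; apply: vect_basis_ext => [||p|p] //.
- by apply: (lin_comp (@dfun_linear _ C)); apply: pairing_linear_l.
- by rewrite DM D1 pairing_lmul dfunM.
- by rewrite DM D2 pairing_lmul dfunM.
Qed.

End Dual.

(** A torsion free connection has the values o2 ⊗ s' on u1 and o1 ⊗ s' on u2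
    for one vector field s', and metric compatibility determines both
    coordinates of s'. *)
Theorem levi_civita_abstract (t : A k) (s : X) : t \is a GRing.unit ->
  pairing s o1 = act (gm d2) (vapply (u2 : X) t * t^-1) ->
  pairing s o2 = act (gm d1) (vapply (u1 : X) t * t^-1) ->
  exists nabla : 'Hom(X, atens Om X),
    [/\ levi_civita_conn (tetrad_metric C t) nabla,
        (forall nabla', levi_civita_conn (tetrad_metric C t) nabla' -> nabla' = nabla),
        nabla u1 = - apure o2 s & nabla u2 = - apure o1 s].
Proof.
move=> ut s1 s2; pose nabla := conn_of (apure o2 (- s)) (apure o1 (- s)).
have n1 : nabla u1 = apure o2 (- s) by apply: conn_of1.
have n2 : nabla u2 = apure o1 (- s) by apply: conn_of2.
have cn : connection nabla by apply: conn_of_connection.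
have pN (w : X) (th : Om) : pairing (- w) th = - pairing w th.
  exact: (linN (pairing_linear_l th)).
exists nabla; split.
- split=> //.
    apply/(torsionlessP char0 cn); rewrite n1 n2 !(contr_apure lX).
    rewrite pairing12 pairing21 pairing11 pairing22.
    by split=> //; rewrite (lin0 (lmul_linl lX _)).
  have [dn dual] := dual_conn_exists n1 n2 cn; exists dn => //.
  by apply/(conn_lift_metric_eq0 char0 n1 n2 dual ut); rewrite !pN s1 s2.
- move=> nabla' [cn' tf [dn dual lift0]].
  have [t11 t22 t12] := (torsionlessP char0 cn').1 tf.
  pose s' := contr u2 (nabla' u1).
  have n1' : nabla' u1 = apure o2 s'.
    by rewrite {1}(contr_decomp lX (nabla' u1)) t11 (lin0 (apure_linear_r _)) add0r.
  have n2' : nabla' u2 = apure o1 s'.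
    by rewrite {1}(contr_decomp lX (nabla' u2)) t22 t12 (lin0 (apure_linear_r _)) addr0.
  have [p1 p2] := (conn_lift_metric_eq0 char0 n1' n2' dual ut).1 lift0.
  have ss' : s' = - s.
    by rewrite (vect_decomp s') (vect_decomp (- s)) !pN s1 s2 p1 p2.
  by apply: connection_ext => //; rewrite ?n1 ?n2 ?n1' ?n2' ss'.
- by rewrite n1 (linN (apure_linear_r _)).
- by rewrite n2 (linN (apure_linear_r _)).
Qed.

(** Moving the coefficients to the left of the basis fields removes one of
    the two sign changes. *)
Lemma pairing_twisted (b1 b2 : A k)
    (s : X := rmul u1 (act (gm (dadd d1 d2)) b1) + rmul u2 (act (gm (dadd d1 d2)) b2)) :
  pairing s o1 = act (gm d2) b1 /\ pairing s o2 = act (gm d1) b2.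
Proof.
rewrite /s (rmul_homogl lX _ (@homog_u1 k C)) (rmul_homogl lX _ (@homog_u2 k C)).
rewrite !(linD (pairing_linear_l _)) !pairing_lmul !act_add daddKl.
rewrite pairing11 pairing12 pairing21 pairing22 !mulr1 !mulr0 addr0 add0r.
by rewrite (daddC d1) daddKl.
Qed.

End Existence.

(** * The calculus of the tensor square of the Sweedler algebra *)

Section Instance.
Variables (k : fieldType).
Hypothesis char0 : [pchar k] =i pred0.
Notation gm i := (grpl k i).

(** Changing the sign of all generators is the action of the grouplike whose
    index is the sum of the degrees of x and x'. *)
Lemma tildeE (a : A k) : tilde a = act (gm (dadd dgx dgx')) a.
Proof.
move: a; apply: lin_eq_bas => [c a b||p].
- apply/ffunP=> p; rewrite !ffunE /= mulrDr; congr (_ + _).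
  by rewrite /GRing.scale /= mulrCA.
- exact: act_linear.
rewrite act_bas; apply/ffunP=> q; rewrite !ffunE.
have [-> | nq] := eqVneq q p; last by rewrite mulr0 scaler0.
congr (_ * _); rewrite /sgn /dot /dg /dadd /=; case: p => [[a b] [c e]] /=.
by rewrite -signr_odd !oddD !oddb; congr (_ ^+ nat_of_bool _); case: a b c e => [] [] [] [].
Qed.

Lemma del11 (a : A k) : del k (del k a) = 0.
Proof.
move: a; apply: lin_eq_bas => [||[p q]].
- by apply: (lin_comp (@linearP _ _ _ _ (del k))); apply: linearP.
- by move=> c x y; rewrite scaler0 addr0.
by rewrite bas_pure del_bas linearZ /= del_bas scale0r scaler0.
Qed.

Lemma del22 (a : A k) : del' k (del' k a) = 0.
Proof.
move: a; apply: lin_eq_bas => [||[p q]].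
- by apply: (lin_comp (@linearP _ _ _ _ (del' k))); apply: linearP.
- by move=> c x y; rewrite scaler0 addr0.
by rewrite bas_pure del'_bas linearZ /= del'_bas scale0r scaler0.
Qed.

Lemma del12 (a : A k) : del k (del' k a) = del' k (del k a).
Proof.
move: a; apply: lin_eq_bas => [||[p q]].
- by apply: (lin_comp (@linearP _ _ _ _ (del k))); apply: linearP.
- by apply: (lin_comp (@linearP _ _ _ _ (del' k))); apply: linearP.
rewrite bas_pure del_bas del'_bas !linearZ /= del_bas del'_bas !scalerA.
by rewrite mulrC.
Qed.

Variables omega omega' : Om k.
Hypothesis dual : dual_basis omega omega'.

Lemma ev_decomp (w : X k) : w = lmul (ev w omega) (u k : X k) + lmul (ev w omega') (u' k : X k).
Proof.
case: dual => d11 d21 d12 d22.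
have e1 : ev w omega = vapp w (genx k).
  rewrite {1}(vf_decomp char0 w) (linD (ev_linear_l _)) !ev_lmul d11 d21.
  by rewrite mulr1 mulr0 addr0.
have e2 : ev w omega' = vapp w (genx' k).
  rewrite {1}(vf_decomp char0 w) (linD (ev_linear_l _)) !ev_lmul d12 d22.
  by rewrite mulr1 mulr0 add0r.
by rewrite e1 e2; apply: vf_decomp.
Qed.

Lemma vapp_uu a : vapp (u k) (vapp (u k) a) = 0.
Proof. by rewrite /vapp vsval_u // del11. Qed.

Lemma vapp_u'u' a : vapp (u' k) (vapp (u' k) a) = 0.
Proof. by rewrite /vapp vsval_u' // del22. Qed.

Lemma vapp_uu' a : vapp (u k) (vapp (u' k) a) = vapp (u' k) (vapp (u k) a).
Proof. by rewrite /vapp vsval_u // vsval_u' // del12. Qed.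

Let d11 : ev (u k) omega = 1. Proof. by case: dual. Qed.
Let d12 : ev (u k) omega' = 0. Proof. by case: dual. Qed.
Let d21 : ev (u' k) omega = 0. Proof. by case: dual. Qed.
Let d22 : ev (u' k) omega' = 1. Proof. by case: dual. Qed.

Definition sweedler_calculus : calculus k :=
  @Calculus k (X k) (Om k) (@vapp k) (@ev k) (@d k)
    (X_lawful char0) (Om_lawful char0)
    (@vapp_linear_l k) (@vapp_linear_r k) (@vf_ext k)
    (vapp_lmul char0) (vapp_act char0) (vapp_der char0)
    (@om_ext k) (@ev_linear_l k) (@ev_linear_r k)
    (@ev_lmul k) (ev_om_lmul char0) (@ev_om_rmul k) (ev_om_act char0)
    (ev_d char0) dgx dgx' isT isT erefl
    (u k) (u' k) (homog_u char0) (homog_u' char0)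
    vapp_uu vapp_u'u' vapp_uu' omega omega' d11 d12 d21 d22 ev_decomp.

Lemma bracketE (w v : X k) a : bracket w v a =
  vapp w (vapp v a) -
  \sw_(r, s <- Rbar k) vapp (vf_act r v) (vapp (vf_act s w) a).
Proof.
rewrite /bracket add_lfunE opp_lfunE comp_lfunE; congr (_ - _).
pose L (f : 'End(A k)) := f a.
have lL : linear L by move=> c f f'; rewrite /L add_lfunE scale_lfunE.
rewrite -[LHS]/(L _) (lin_sweed _ _ lL); apply: sweed_ext => r s.
by rewrite /L comp_lfunE.
Qed.

(** Vector fields are compared as linear maps in one form and by their values
    in the other. *)
Lemma torsion_freeP (nabla : 'Hom(X k, atens (Om k) (X k))) :
  torsion_free nabla <-> @torsionless k sweedler_calculus nabla.
Proof.
have E w v a : (vsval (interior w (nabla v)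
    - \sw_(r, s <- Rbar k) interior (hact r v) (nabla (hact s w))) - bracket w v) a =
  @torsion k sweedler_calculus nabla w v a.
  by rewrite add_lfunE opp_lfunE bracketE.
split=> [t0 w v a | t0 w v].
  by rewrite -E t0 zero_lfunE.
by apply/lfunP => a; rewrite E t0 zero_lfunE.
Qed.

Lemma levi_civitaP g nabla :
  levi_civita g nabla <-> @levi_civita_conn k sweedler_calculus g nabla.
Proof.
split=> [[cn /torsion_freeP tf mc] | [cn /torsion_freeP tf mc]].
  by split.
by split.
Qed.

End Instance.

Theorem theorem7p1 (k : fieldType) (char0 : [pchar k] =i pred0)
    (omega omega' : Om k) (dual : dual_basis omega omega')
    (t : A k) (t_unit : t \is a GRing.unit) :
  let g : atens (Om k) (Om k) :=
    rmul (apure omega omega' + apure omega' omega : atens (Om k) (Om k)) t in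
  let s : X k := rmul (u k) (tilde (vapp (u' k) t * t^-1)) +
                 rmul (u' k) (tilde (vapp (u k) t * t^-1)) in
  exists nabla : 'Hom(X k, atens (Om k) (X k)),
    [/\ levi_civita g nabla,
        (forall nabla' : 'Hom(X k, atens (Om k) (X k)),
           levi_civita g nabla' -> nabla' = nabla),
        nabla (u k) = - apure omega' s
      & nabla (u' k) = - apure omega s].
Proof.
move=> g s; pose S := sweedler_calculus char0 dual.
have sE : s = rmul (u k) (act (grpl k (dadd dgx dgx')) (vapp (u' k) t * t^-1)) +
              rmul (u' k) (act (grpl k (dadd dgx dgx')) (vapp (u k) t * t^-1)).
  by rewrite /s !tildeE.
have [s1 s2] := @pairing_twisted k S (vapp (u' k) t * t^-1) (vapp (u k) t * t^-1).
rewrite -sE in s1 s2.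
have [nabla [lc uniq n1 n2]] := @levi_civita_abstract k char0 S t s t_unit s1 s2.
exists nabla; split; last exact: n2; last exact: n1.
  exact: (levi_civitaP char0 dual _ _).2 lc.
by move=> nabla' /(levi_civitaP char0 dual g nabla')/uniq.
Qed.
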